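(* The operad $\Pi$ is isomorphic to the quotient of the free operad on $\Pi(\{1,2\})$ (with basis $1\otimes 2$, $2\otimes 1$ in dimension $0$ and $1\wedge 2=-\,2\wedge 1$ in dimension $1$) by the ideal generated by the relations \begin{align*} (1\otimes 2)\circ_1 (1\otimes 2)&=(1\otimes 2)\circ_2 (1\otimes 2)+(1\otimes 2)\circ_2 (2\otimes 1),\\ (1\wedge 2)\circ_2(1\otimes 2)&=(1\otimes 2)\circ_1(1\wedge2)=\tau \big((1\wedge 2)\circ_1(2\otimes 1)\big),\\ (2\wedge 1)\circ_1(1\wedge2)&=(1\wedge 2)\circ_2 (1\wedge2), \end{align*} where $\tau$ is the relabelling by the cycle $3\mapsto 2\mapsto 1\mapsto 3$. In particular $\Pi$ is a binary quadratic operad.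
   Context: Operads are symmetric operads in complexes of $\mathbb{Z}$-modules, viewed as functors on the groupoid of finite non-empty sets, with partial compositions $\circ_i:\mathcal P(I)\otimes \mathcal P(J)\to \mathcal P((I\setminus\{i\})\sqcup J)$. For operations on $\{1,\dots,m\}$ and $\{1,\dots,n\}$, the set $(\{1,\dots,m\}\setminus\{i\})\sqcup\{1,\dots,n\}$ is identified with $\{1,\dots,m+n-1\}$ in the standard way (the inserted labels become $i,\dots,i+n-1$). Definition of the differential graded operad $\Pi$. For a finite non-empty set $I$, $\Pi(I)$ is the free $\mathbb{Z}$-module generated by expressions $\pi=\pi_1\otimes\pi_2\otimes\dots\otimes\pi_p$, where $\pi_j=i_{j,1}\wedge\dots\wedge i_{j,p_j}$ ($p_j\ge 1$, $i_{j,k}\in I$), every element of $I$ appearing in exactly one $\pi_j$ and exactly once, modulo the antisymmetry relations of the exterior products. Bijections act by relabelling. Set $\dim(\pi_j)=p_j-1$ and $\dim(\pi)=\sum_j\dim(\pi_j)$; this is the grading. The differential is $$d(\pi)=\sum_{j=1}^{p-1}(-1)^{\dim(\pi_1)+\dots+\dim(\pi_j)}\,\pi_1\otimes\dots\otimes \pi_j\wedge\pi_{j+1}\otimes\dots\otimes\pi_p .$$ Composition: let $\pi=\pi_1\otimes\dots\otimes\pi_p\in\Pi(I)$, $\mu=\mu_1\otimes\dots\otimes\mu_q\in\Pi(J)$, $i\in I$, and let $\ell$ be the unique index such that $i$ appears in $\pi_\ell$. Up to a sign write $\pi_\ell=\pi'_\ell\wedge i$ (if $\pi_\ell=i$, the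 convention is $\pi'_\ell\wedge\nu=\nu$). Then $$\pi\circ_i\mu=\sum_\sigma\varepsilon(\sigma)\,\pi_1\otimes\dots\otimes\pi_{\ell-1}\otimes\pi'_\ell\wedge\mu_1\otimes\sigma(\pi_{\ell+1}\otimes\dots\otimes\pi_p\,,\,\mu_2\otimes\dots\otimes\mu_q),$$ where $\sigma$ runs over the shuffles of $\pi_{\ell+1},\dots,\pi_p$ with $\mu_2,\dots,\mu_q$, $\sigma(\cdots)$ is the tensor product of these blocks in the order specified by $\sigma$, and $\varepsilon(\sigma)$ is the Koszul sign (for the grading by $\dim$) for passing from $\pi_{\ell+1}\otimes\dots\otimes\pi_p\otimes\mu_1\otimes\dots\otimes\mu_q$ to $\mu_1\otimes\sigma(\pi_{\ell+1}\otimes\dots\otimes\pi_p,\mu_2\otimes\dots\otimes\mu_q)$. The unit is $1\in\Pi(\{1\})$. An operad is binary quadratic if it is the quotient of the free operad on a module $E=E(2)$ concentrated in arity $2$ by an ideal generated by elements of arity $3$. *)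

(* Defs.v *)
From HB Require Import structures.
From mathcomp Require Import all_boot all_order all_algebra.
From mathcomp Require Import generic_quotient ring_quotient.
From mathcomp Require Import boolp.
From mathcomp Require Import freeg.

Set Implicit Arguments.
Unset Strict Implicit.
Unset Printing Implicit Defensive.

Import GRing.Theory.
Local Open Scope ring_scope.
Local Open Scope quotient_scope.

(** * The groupoid of finite non-empty sets *)

Record nfset := NFSet { nfcar :> finType; nfset_gt0 : (0 < #|nfcar|)%N }.

Record bij (I J : nfset) := Bij { bfun :> I -> J; bfunP : bijective bfun }.

(* [nset n] is the set {1, ..., n+1}: the label k is the ordinal of value k-1. *)
Lemma nset_subproof n : (0 < #|'I_n.+1|)%N.
Proof. by rewrite card_ord. Qed.
Definition nset (n : nat) : nfset := NFSet (nset_subproof n).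

Notation fin1 := (nset 0).
Notation fin2 := (nset 1).
Notation fin3 := (nset 2).

Section Graft.
Variables (I : nfset) (i : I) (J : nfset).
Definition graft_sort : finType := ({x : I | x != i} + J)%type.
Lemma graft_subproof : (0 < #|graft_sort|)%N.
Proof. by rewrite card_sum addn_gt0 (nfset_gt0 J) orbT. Qed.
(* (I \ {i}) ⊔ J *)
Definition graft : nfset := NFSet graft_subproof.
End Graft.
Arguments graft {I} i J.

(** The bijections entering the axioms of partial compositions. *)

Section GraftMap.
Variables (I I' J J' : nfset) (f : bij I I') (g : bij J J') (i : I).

Lemma graft_map_subproof (x : {x : I | x != i}) : f (val x) != f i.
Proof. by rewrite (inj_eq (bij_inj (bfunP f))); exact: valP x. Qed.

Definition graft_map_fun (z : graft i J) : graft (f i) J' :=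
  match z with
  | inl x => inl (Sub (f (val x)) (graft_map_subproof x))
  | inr y => inr (g y)
  end.

Lemma graft_map_bij : bijective graft_map_fun.
Proof.
have [f' fK f'K] := bfunP f; have [g' gK g'K] := bfunP g.
have h (x : {x : I' | x != f i}) : f' (val x) != i.
  by rewrite -(inj_eq (bij_inj (bfunP f))) f'K; exact: valP x.
exists (fun z : graft (f i) J' => match z return graft i J with
  | inl x => inl (Sub (f' (val x)) (h x)) | inr y => inr (g' y) end).
- case=> [x|y] /=; last by rewrite gK.
  by congr inl; apply: val_inj; rewrite /= fK.
- case=> [x|y] /=; last by rewrite g'K.
  by congr inl; apply: val_inj; rewrite /= f'K.
Qed.

Definition graft_map : bij (graft i J) (graft (f i) J') := Bij graft_map_bij.
End GraftMap.

Section GraftAssoc.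
Variables (I J K : nfset).

Section Sequential.
Variables (i : I) (j : J).
Local Notation A := (graft (inr j : graft i J) K).
Local Notation B := (graft i (graft j K)).

Definition seq_assoc_fun (z : A) : B :=
  match z with
  | inl (exist (inl x) _) => inl x
  | inl (exist (inr y) h) => inr (inl (exist (fun y => y != j) y h))
  | inr k => inr (inr k)
  end.

Lemma seq_assoc_bij : bijective seq_assoc_fun.
Proof.
exists (fun z : B => match z return A with
  | inl x => inl (exist (fun z : graft i J => z != inr j) (inl x) isT)
  | inr (inl (exist y h)) =>
      inl (exist (fun z : graft i J => z != inr j) (inr y) h)
  | inr (inr k) => inr k
  end).
- case=> [[[x|y] h]|k] //=.
  by congr inl; apply: val_inj.
- by case=> [x|[[y h]|k]].
Qed.

Definition seq_assoc : bij A B := Bij seq_assoc_bij.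
End Sequential.

Section Parallel.
Variables (i k : I) (ik : i != k).

Lemma parallel_subproof : k != i. Proof. by rewrite eq_sym. Qed.

Definition par_left : graft i J := inl (exist (fun x => x != i) k parallel_subproof).
Definition par_right : graft k K := inl (exist (fun x => x != k) i ik).
Local Notation A := (graft par_right J).
Local Notation B := (graft par_left K).

Definition par_assoc_fun (z : A) : B :=
  match z with
  | inl (exist (inl (exist x hk)) hi) =>
      inl (exist (fun z : graft i J => z != par_left)
                 (inl (exist (fun x => x != i) x hi)) hk)
  | inl (exist (inr y) _) => inr y
  | inr y => inl (exist (fun z : graft i J => z != par_left) (inr y) isT)
  end.

Lemma par_assoc_bij : bijective par_assoc_fun.
Proof.
exists (fun z : B => match z return A with
  | inl (exist (inl (exist x hi)) hk) =>
      inl (exist (fun z : graft k K => z != par_right)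
                 (inl (exist (fun x => x != k) x hk)) hi)
  | inl (exist (inr y) _) => inr y
  | inr y => inl (exist (fun z : graft k K => z != par_right) (inr y) isT)
  end).
- by case=> [[[[x hk]|y] h]|y] //=; congr inl; apply: val_inj.
- by case=> [[[[x hk]|y] h]|y] //=; congr inl; apply: val_inj.
Qed.

Definition par_assoc : bij A B := Bij par_assoc_bij.
End Parallel.
End GraftAssoc.
Arguments seq_assoc {I J} K i j.
Arguments par_assoc {I} J K {i k} ik.
Arguments par_left {I} J {i k} ik.
Arguments par_right {I} K {i k} ik.

Section GraftUnit.
Variable I : nfset.

Definition graft_unitl_fun (x : I) : graft (ord0 : fin1) I := inr x.
Lemma graft_unitl_bij : bijective graft_unitl_fun.
Proof.
apply: inj_card_bij; first by move=> x y [].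
rewrite card_sum [X in (X + _)%N](_ : _ = 0)%N // card_sig.
by apply: eq_card0 => x; rewrite !inE /= ord1 eqxx.
Qed.
Definition graft_unitl : bij I (graft (ord0 : fin1) I) := Bij graft_unitl_bij.

Variable i : I.
Definition graft_unitr_fun (z : graft i fin1) : I :=
  match z with inl x => val x | inr _ => i end.
Lemma graft_unitr_bij : bijective graft_unitr_fun.
Proof.
exists (fun x : I => match insub x return graft i fin1 with
  | Some y => inl (y : {x : I | x != i}) | None => inr (ord0 : 'I_1) end).
- case=> [[x h]|u] /=; first by rewrite insubT.
  by rewrite insubF ?eqxx // (ord1 u).
- by move=> x /=; case: insubP => [u _ <- //|]; rewrite negbK => /eqP ->.
Qed.
Definition graft_unitr : bij (graft i fin1) I := Bij graft_unitr_bij.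
End GraftUnit.

(* The identification of ({1,...,m+1} \ {i}) ⊔ {1,...,n+1} with
   {1,...,m+n+1}: labels of the first set greater than i are shifted by n,
   and the labels of the second set become i, ..., i+n. *)
Section GraftStd.
Variables (m n : nat) (i : nset m).

Definition graft_std_fun (z : graft i (nset n)) : nset (m + n)%N :=
  match z with
  | inl x => let k := nat_of_ord (val x) in
             inord (if (k < nat_of_ord i)%N then k else k + n)%N
  | inr y => inord (nat_of_ord i + nat_of_ord (y : 'I_n.+1))%N
  end.

Lemma graft_std_bij : bijective graft_std_fun.
Proof.
have lti : (nat_of_ord i <= m)%N by rewrite -ltnS.
apply: inj_card_bij; last first.
  have cardi : #|[pred x : 'I_m.+1 | x != i]| = m.
    transitivity #|predC1 (i : 'I_m.+1)|; last by rewrite cardC1 card_ord.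
    by apply: eq_card => x; rewrite !inE.
  by rewrite card_ord card_sum card_sig card_ord cardi addnS.
have in1 (x : {x : nset m | x != i}) :
    ((if (nat_of_ord (val x) < nat_of_ord i)%N then nat_of_ord (val x)
      else nat_of_ord (val x) + n)%N < (m + n).+1)%N.
  rewrite ltnS; have: (nat_of_ord (val x) <= m)%N by rewrite -ltnS.
  case: ifP => _ h; first exact: leq_trans h (leq_addr _ _).
  by rewrite leq_add2r.
have in2 (y : 'I_n.+1) : (nat_of_ord i + nat_of_ord y < (m + n).+1)%N.
  by rewrite ltnS leq_add // -ltnS.
have ne (x : {x : nset m | x != i}) : nat_of_ord (val x) <> nat_of_ord i.
  by move=> e; have /eqP := valP x; apply; apply: val_inj.
have neq12 (x : {x : nset m | x != i}) (y : 'I_n.+1) :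
    (if (nat_of_ord (val x) < nat_of_ord i)%N then nat_of_ord (val x)
     else (nat_of_ord (val x) + n)%N) <> (nat_of_ord i + nat_of_ord y)%N.
  have := ne x; have := ltn_ord y; rewrite ltnS.
  move: (nat_of_ord (val x)) (nat_of_ord i) (nat_of_ord y) => a b c lecn neab.
  case: ltnP => [lt|le] e; first by move: lt; rewrite e ltnNge leq_addr.
  have lt : (b < a)%N by rewrite ltn_neqAle le andbT; apply/eqP => h; apply: neab.
  by have := leq_add lt lecn; rewrite addSn e ltnn.
move=> [x|y] [x'|y'] /= /(congr1 val) /=; rewrite !inordK; do ?[exact: in1|exact: in2].
- move=> e; congr inl; apply: val_inj; apply: val_inj; move: e => /=.
  move: (nat_of_ord (val x)) (nat_of_ord (val x')) => a b.
  case: ltnP => la; case: ltnP => lb //=.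
  + by move=> e; move: la; rewrite e ltnNge (leq_trans lb (leq_addr _ _)).
  + by move=> e; move: lb; rewrite -e ltnNge (leq_trans la (leq_addr _ _)).
  + by move/addIn.
- by move=> e; case: (neq12 x y').
- by move=> e; case: (neq12 x' y).
- by move/addnI => e; congr inr; apply: val_inj.
Qed.

Definition graft_std : bij (graft i (nset n)) (nset (m + n)%N) :=
  Bij graft_std_bij.
End GraftStd.

(** * Complexes of abelian groups *)

Definition zquot (V : zmodType) (S : zmodClosed V) : zmodType :=
  Quotient.quot S.
Definition zproj (V : zmodType) (S : zmodClosed V) (x : V) : zquot S :=
  \pi_(Quotient.quot S) x.
Definition zrepr (V : zmodType) (S : zmodClosed V) (x : zquot S) : V :=
  repr (x : Quotient.quot S).

(* Complexes are internally graded: [hdeg n x] says that x is homogeneous of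
   degree n; differentials have degree +1. *)
Record complex := Complex {
  ccar :> zmodType;
  hdeg : int -> ccar -> Prop;
  diff : ccar -> ccar }.
Arguments hdeg {c} n x.
Arguments diff {c} x.

Record is_complex (C : complex) : Prop := IsComplex {
  hdeg0 : forall n, hdeg n (0 : C);
  hdegB : forall n (x y : C), hdeg n x -> hdeg n y -> hdeg n (x - y);
  hdeg_span : forall x : C, exists (s : seq int) (f : int -> C),
    [/\ uniq s, forall n, hdeg n (f n) & x = \sum_(n <- s) f n];
  hdeg_direct : forall (s : seq int) (f : int -> C),
    uniq s -> (forall n, hdeg n (f n)) -> \sum_(n <- s) f n = 0 ->
    forall n, n \in s -> f n = 0;
  diffD : forall x y : C, diff (x + y) = diff x + diff y;
  diff_hdeg : forall n (x : C), hdeg n x -> hdeg (n + 1) (diff x);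
  diffK : forall x : C, diff (diff x) = 0 }.

Record is_cmorphism (C D : complex) (f : C -> D) : Prop := IsCMorphism {
  cmorphD : forall x y, f (x + y) = f x + f y;
  cmorph_hdeg : forall n x, hdeg n x -> hdeg n (f x);
  cmorph_diff : forall x, f (diff x) = diff (f x) }.

(** * Operads *)

Record operad := Operad {
  ocar :> nfset -> complex;
  oact : forall I J : nfset, bij I J -> ocar I -> ocar J;
  ounit : ocar fin1;
  ocomp : forall (I : nfset) (i : I) (J : nfset),
    ocar I -> ocar J -> ocar (graft i J) }.
Arguments oact {o I J} f x.
Arguments ounit {o}.
Arguments ocomp {o I} i {J} x y.

Definition sgnz (n : int) : int := (-1) ^ n.

Record is_operad (P : operad) : Prop := IsOperad {
  operad_complex : forall I, is_complex (P I);
  act_cmorphism : forall I J (f : bij I J), is_cmorphism (oact f : P I -> P J);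
  act_id : forall I (f : bij I I) (x : P I), f =1 id -> oact f x = x;
  act_comp : forall I J K (f : bij I J) (g : bij J K) (h : bij I K) (x : P I),
    h =1 g \o f -> oact h x = oact g (oact f x);
  one_hdeg : hdeg 0 (ounit : P fin1);
  one_diff : diff (ounit : P fin1) = 0;
  compDl : forall (I : nfset) (i : I) J (x x' : P I) (y : P J),
    ocomp i (x + x') y = ocomp i x y + ocomp i x' y;
  compDr : forall (I : nfset) (i : I) J (x : P I) (y y' : P J),
    ocomp i x (y + y') = ocomp i x y + ocomp i x y';
  comp_hdeg : forall (I : nfset) (i : I) J m n (x : P I) (y : P J),
    hdeg m x -> hdeg n y -> hdeg (m + n) (ocomp i x y);
  comp_diff : forall (I : nfset) (i : I) J m (x : P I) (y : P J), hdeg m x ->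
    diff (ocomp i x y) = ocomp i (diff x) y + ocomp i x (diff y) *~ sgnz m;
  comp_act : forall (I I' J J' : nfset) (f : bij I I') (g : bij J J') (i : I)
      (x : P I) (y : P J),
    ocomp (f i) (oact f x) (oact g y) = oact (graft_map f g i) (ocomp i x y);
  comp_seq : forall (I J K : nfset) (i : I) (j : J) (x : P I) (y : P J) (z : P K),
    oact (seq_assoc K i j) (ocomp (inr j : graft i J) (ocomp i x y) z)
    = ocomp i x (ocomp j y z);
  comp_par : forall (I J K : nfset) (i k : I) (ik : i != k) m n
      (x : P I) (y : P J) (z : P K), hdeg m y -> hdeg n z ->
    ocomp (par_left J ik) (ocomp i x y) z
    = oact (par_assoc J K ik) (ocomp (par_right K ik) (ocomp k x z) y)
      *~ sgnz (m * n);
  comp_onel : forall J (y : P J),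
    ocomp (ord0 : fin1) ounit y = oact (graft_unitl J) y;
  comp_oner : forall (I : nfset) (i : I) (x : P I),
    oact (graft_unitr i) (ocomp i x (ounit : P fin1)) = x }.

Record is_morphism (P Q : operad) (phi : forall I, P I -> Q I) : Prop :=
  IsMorphism {
  morph_cmorphism : forall I, is_cmorphism (@phi I);
  morph_act : forall I J (f : bij I J) x, phi J (oact f x) = oact f (phi I x);
  morph_one : phi fin1 ounit = ounit;
  morph_comp : forall (I : nfset) (i : I) J x y,
    phi _ (ocomp i x y) = ocomp i (phi I x) (phi J y) }.

Definition operad_isomorphic (P Q : operad) : Prop :=
  exists (phi : forall I, P I -> Q I) (psi : forall I, Q I -> P I),
  [/\ is_morphism phi, is_morphism psi,
      forall I, cancel (phi I) (psi I) & forall I, cancel (psi I) (phi I)].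

(* The partial composition of operations on {1,...,m+1} and {1,...,n+1}. *)
Definition scomp (P : operad) m n (i : nset m) (x : P (nset m)) (y : P (nset n))
  : P (nset (m + n)%N) := oact (graft_std n i) (ocomp i x y).

(** ** Ideals and quotients *)

Record is_ideal (P : operad) (S : forall I, zmodClosed (P I)) : Prop :=
  IsIdeal {
  ideal_act : forall I J (f : bij I J) x, x \in S I -> oact f x \in S J;
  ideal_diff : forall I x, x \in S I -> diff x \in S I;
  ideal_graded : forall I (s : seq int) (f : int -> P I),
    uniq s -> (forall n, hdeg n (f n)) -> \sum_(n <- s) f n \in S I ->
    forall n, n \in s -> f n \in S I;
  ideal_compl : forall (I : nfset) (i : I) J (x : P I) (y : P J),
    x \in S I -> ocomp i x y \in S (graft i J);
  ideal_compr : forall (I : nfset) (i : I) J (x : P I) (y : P J),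
    y \in S J -> ocomp i x y \in S (graft i J) }.

(* The smallest ideal containing a set [R] of elements of P({1,...,n+1}). *)
Definition ideal_gen (P : operad) n (R : P (nset n) -> Prop) (I : nfset)
  : {pred P I} :=
  fun x => `[< forall S : (forall J, zmodClosed (P J)), is_ideal S ->
                 (forall r, R r -> r \in S (nset n)) -> x \in S I >].

Lemma ideal_gen_closed P n R I : zmod_closed (@ideal_gen P n R I).
Proof.
split; first by apply/asboolP => S _ _; exact: rpred0.
move=> x y /asboolP hx /asboolP hy; apply/asboolP => S hS hR.
by apply: rpredB; [exact: hx | exact: hy].
Qed.
HB.instance Definition _ (P : operad) n (R : P (nset n) -> Prop) I :=
  GRing.isZmodClosed.Build (P I) (@ideal_gen P n R I) (ideal_gen_closed R I).

Section QuotientOperad.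
Variables (P : operad) (S : forall I, zmodClosed (P I)).

(* The operations are computed on representatives, which is meaningful only
   when [is_ideal S]. *)
Definition quot_complex I : complex := {|
  ccar := zquot (S I);
  hdeg := fun n x => exists2 y : P I, hdeg n y & x = zproj (S I) y;
  diff := fun x => zproj (S I) (diff (zrepr x)) |}.

Definition quot_operad : operad := {|
  ocar := quot_complex;
  oact := fun I J f x => zproj (S J) (oact f (zrepr x));
  ounit := zproj (S fin1) ounit;
  ocomp := fun I i J x y => zproj (S (graft i J)) (ocomp i (zrepr x) (zrepr y)) |}.
End QuotientOperad.

Definition quot_by (P : operad) n (R : P (nset n) -> Prop) : operad :=
  quot_operad (fun I => @ideal_gen P n R I : zmodClosed (P I)).

(** ** Free operads on modules concentrated in arity 2 *)

Record s2complex := S2Complex {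
  s2car :> complex;
  s2act : bij fin2 fin2 -> s2car -> s2car }.

Record is_s2complex (E : s2complex) : Prop := IsS2Complex {
  s2_complex : is_complex E;
  s2act_cmorphism : forall f, is_cmorphism (@s2act E f);
  s2act_id : forall (f : bij fin2 fin2) (x : E), f =1 id -> s2act f x = x;
  s2act_comp : forall (f g h : bij fin2 fin2) (x : E),
    h =1 g \o f -> s2act h x = s2act g (s2act f x) }.

Definition arity2 (P : operad) : s2complex :=
  {| s2car := P fin2; s2act := fun f => oact f |}.

Record is_s2morphism (E : s2complex) (P : operad) (f : E -> P fin2) : Prop :=
  IsS2Morphism {
  s2morph_cmorphism : is_cmorphism f;
  s2morph_act : forall (s : bij fin2 fin2) x, f (s2act s x) = oact s (f x) }.

(* [F], together with [eta], is the free operad on [E]. *)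
Record is_free_operad (E : s2complex) (F : operad) (eta : E -> F fin2) : Prop :=
  IsFreeOperad {
  free_operad : is_operad F;
  free_eta : is_s2morphism eta;
  free_univ : forall (Q : operad) (f : E -> Q fin2),
    is_operad Q -> is_s2morphism f ->
    exists phi : forall I, F I -> Q I,
    [/\ is_morphism phi, forall x, phi fin2 (eta x) = f x &
        forall psi : (forall I, F I -> Q I),
          is_morphism psi -> (forall x, psi fin2 (eta x) = f x) ->
          forall I x, psi I x = phi I x] }.

Definition binary_quadratic (P : operad) : Prop :=
  exists (E : s2complex) (F : operad) (eta : E -> F fin2)
         (R : F fin3 -> Prop),
  [/\ is_s2complex E, is_free_operad eta & operad_isomorphic (quot_by R) P].

(** * The operad Pi *)

(* The list [:: pi_1; ...; pi_p] of lists of labels encodes the expression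
   pi_1 ⊗ ... ⊗ pi_p, where [:: i_1; ...; i_k] stands for i_1 ∧ ... ∧ i_k. *)
Definition is_expr (I : finType) (s : seq (seq I)) : bool :=
  ([::] \notin s) && perm_eq (flatten s) (enum I).

Definition expr (I : finType) := {s : seq (seq I) | is_expr s}.

Definition bdim (X : Type) (b : seq X) : nat := (size b).-1.
Definition wdim (X : Type) (s : seq (seq X)) : nat := (\sum_(b <- s) bdim b)%N.

(* The basis element of the free module given by a list of lists; the value 0
   is a default for lists which are not expressions. *)
Definition mono (I : finType) (s : seq (seq I)) : {freeg (expr I)} :=
  if insub s is Some e then << (e : expr I) >> else 0.

Definition linext (K : choiceType) (V : zmodType) (f : K -> V) (x : {freeg K})
  : V := \sum_(e <- dom x) f e *~ coeff e x.

(* The subgroup spanned by the antisymmetry relations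
   ... ⊗ (u ∧ a ∧ b ∧ v) ⊗ ... + ... ⊗ (u ∧ b ∧ a ∧ v) ⊗ ... *)
Definition antisym (I : finType) : {pred {freeg (expr I)}} :=
  fun x => `[< forall S : zmodClosed {freeg (expr I)},
    (forall (s t : seq (seq I)) (u v : seq I) (a b : I),
       mono (s ++ (u ++ a :: b :: v) :: t)
       + mono (s ++ (u ++ b :: a :: v) :: t) \in S) -> x \in S >].

Lemma antisym_closed I : zmod_closed (@antisym I).
Proof.
split; first by apply/asboolP => S _; exact: rpred0.
move=> x y /asboolP hx /asboolP hy; apply/asboolP => S hS.
by apply: rpredB; [exact: hx | exact: hy].
Qed.
HB.instance Definition _ (I : finType) :=
  GRing.isZmodClosed.Build {freeg (expr I)} (@antisym I) (@antisym_closed I).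

Definition Pi_car (I : finType) : zmodType :=
  zquot (@antisym I).

Definition Pi_proj (I : finType) (x : {freeg (expr I)}) : Pi_car I :=
  zproj (@antisym I) x.

Definition Pi_mono (I : finType) (s : seq (seq I)) : Pi_car I :=
  Pi_proj (mono s).

Definition wdiff (I : finType) (s : seq (seq I)) : {freeg (expr I)} :=
  \sum_(0 <= j < (size s).-1)
    mono (take j s ++ (nth [::] s j ++ nth [::] s j.+1) :: drop j.+2 s)
    *~ (-1) ^+ wdim (take j.+1 s).

(* The shuffles w of two lists of blocks u and v, each paired with the exponent
   of the Koszul sign for passing from u ⊗ v to w. *)
Fixpoint shuffles (X : Type) (u : seq (seq X)) :
    seq (seq X) -> seq (nat * seq (seq X)) :=
  match u with
  | [::] => fun v => [:: (0%N, v)]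
  | a :: u' => fix shuffles_u v :=
      match v with
      | [::] => [:: (0%N, u)]
      | b :: v' =>
          [seq (w.1, a :: w.2) | w <- shuffles u' v]
          ++ [seq ((w.1 + bdim b * wdim u)%N, b :: w.2) | w <- shuffles_u v']
      end
  end.

Section WordComp.
Variables (I : nfset) (i : I) (J : nfset).

(* A block of [I], deprived of [i] if it contains it. *)
Definition inl_block (b : seq I) : seq (graft i J) :=
  [seq inl x | x <- (pmap insub b : seq {x : I | x != i})].
Definition inr_block (b : seq J) : seq (graft i J) := [seq inr y | y <- b].

(* With pi_l = u ∧ i ∧ v, one has pi_l = (-1)^|v| pi'_l ∧ i for pi'_l = u ∧ v. *)
Definition wcomp (s : seq (seq I)) (t : seq (seq J))
  : {freeg (expr (graft i J))} :=
  let l := find (fun b => i \in b) s in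
  let b := nth [::] s l in
  let before := [seq inl_block c | c <- take l s] in
  let after := [seq inl_block c | c <- drop l.+1 s] in
  let mu1 := inr_block (head [::] t) in
  let mus := [seq inr_block c | c <- behead t] in
  \sum_(w <- shuffles after mus)
    mono (before ++ (inl_block b ++ mu1) :: w.2)
    *~ (-1) ^+ (size b - (index i b).+1 + bdim mu1 * wdim after + w.1)%N.
End WordComp.

(* The operations are defined on expressions, extended linearly to the free
   module, and computed on representatives in the quotient. *)
Definition Pi_complex (I : nfset) : complex := {|
  ccar := Pi_car I;
  hdeg := fun n x => exists2 y : {freeg (expr I)},
    (forall e, e \in dom y -> (wdim (val e))%:Z = n) & x = Pi_proj y;
  diff := fun x => Pi_proj (linext (fun e : expr I => wdiff (val e)) (zrepr x)) |}.

Definition Pi : operad := {|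
  ocar := Pi_complex;
  oact := fun I J f x =>
    Pi_proj (linext (fun e : expr I => mono [seq [seq f a | a <- b] | b <- val e])
           (zrepr x));
  ounit := Pi_mono ([:: [:: ord0]] : seq (seq fin1));
  ocomp := fun I i J x y =>
    Pi_proj (linext (fun e : expr I =>
           linext (fun e' : expr J => wcomp i (val e) (val e')) (zrepr y))
         (zrepr x)) |}.

(** ** The generators and relations *)

Notation lab1 := (ord0 : nfcar fin2).
Notation lab2 := (ord_max : nfcar fin2).

Definition t12 : Pi fin2 := Pi_mono [:: [:: lab1]; [:: lab2]].
Definition t21 : Pi fin2 := Pi_mono [:: [:: lab2]; [:: lab1]].
Definition w12 : Pi fin2 := Pi_mono [:: [:: lab1; lab2]].
Definition w21 : Pi fin2 := Pi_mono [:: [:: lab2; lab1]].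

Definition Pi2_basis : Prop :=
  [/\ hdeg 0 t12, hdeg 0 t21, hdeg 1 w12, w12 = - w21 &
      forall x : Pi fin2, exists! c : int * int * int,
        x = t12 *~ c.1.1 + t21 *~ c.1.2 + w12 *~ c.2].

(* The cycle 3 |-> 2 |-> 1 |-> 3. *)
Definition tau : bij fin3 fin3 := @Bij fin3 fin3 (@ord_pred 3) (@ord_pred_bij 3).

Section Relations.
Variables (F : operad) (eta : Pi fin2 -> F fin2).
Definition circ1 (x y : Pi fin2) : F fin3 := @scomp F 1 1 lab1 (eta x) (eta y).
Definition circ2 (x y : Pi fin2) : F fin3 := @scomp F 1 1 lab2 (eta x) (eta y).

Definition Pi_relations (r : F fin3) : Prop :=
  r \in [:: circ1 t12 t12 - (circ2 t12 t12 + circ2 t12 t21);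
            circ2 w12 t12 - circ1 t12 w12;
            circ1 t12 w12 - oact tau (circ1 w12 t21);
            circ1 w21 w12 - circ2 w12 w12].
End Relations.

(* Main.v *)
Require Import Defs.
From HB Require Import structures.
From mathcomp Require Import all_boot all_order all_algebra.
From mathcomp Require Import generic_quotient ring_quotient.
From mathcomp Require Import boolp.
From mathcomp Require Import freeg zify.

Set Implicit Arguments.
Unset Strict Implicit.
Unset Printing Implicit Defensive.

Import GRing.Theory.
Local Open Scope ring_scope.
Local Open Scope quotient_scope.

(** The labels of an expression are all distinct and exhaust I, which is not
    stable under taking away a block. The operad axioms are therefore proved for
    words ([wmod]): lists of blocks with arbitrary labels, modulo antisymmetry in
    each block. On words the operations are defined by recursion on the first
    block: [sh] is the shuffle product with the Koszul signs of the blocks, [kD]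
    the differential, and [sub f i x u] inserts u at the label i of x. They
    satisfy, by induction on words, the identities which an operad requires: the
    shuffle product is associative and graded commutative ([shA], [shC]), [kD] has
    square zero and is a derivation for the shuffle product ([kDK], [kD_sh]) and,
    when the labels are distinct, [kD] is a derivation for substitution ([kD_sub])
    and substitution is associative in sequence and in parallel ([sub_seq],
    [sub_par]). Pi(I) embeds into the words by [wemb], and
    [wemb] carries the operations of Pi to these operations ([wemb_diff],
    [wemb_act], [wemb_comp]); hence Pi is an operad.

    A free operad is obtained at no cost ([free_op_free]): take all formal terms
    built from the generators by the operations, and identify two combinations of
    terms when they have the same value in every operad. Each axiom holds because
    it holds in every operad.

    For the presentation, let F be a free operad on Pi({1,2}) and phi : F -> Pi the
    induced morphism. A right comb is g_1 ∘_2 (g_2 ∘_2 (... ∘_2 1)), where each g_k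
    is 1 ⊗ 2 or 1 ∧ 2. In Pi, grafting x on the second input of a generator puts a
    letter in front of the word x, as a new block for 1 ⊗ 2 and in the first block
    for 1 ∧ 2 ([wemb_comp_gen]); so phi maps the relabelled combs bijectively to the
    expressions. The relations hold in Pi, hence phi induces a map from the quotient
    of F to Pi. Its inverse sends an expression to the corresponding comb. This
    requires two facts:
    - swapping two consecutive letters in a block changes the sign of the comb
      modulo the relations ([comb_swap]), so that the inverse is well defined on Pi;
    - the relabelled combs span the quotient ([Sp_all]), so that the two maps are
      mutually inverse: the relations rewrite every composition of two generators at
      the first input into compositions at the second input, and an induction on
      the number of generators brings every composition of combs to a combination
      of combs ([Sp_comp12_comb], [Sp_comp]).

    The inverse of a morphism is a morphism, so no composition of combs is ever
    computed. *)

(** * Additive maps, signs, quotients and free modules *)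

Definition addm (U V : zmodType) (f : U -> V) := forall x y, f (x + y) = f x + f y.

Section AddMap.
Variables (U V : zmodType) (f : U -> V).
Hypothesis fD : addm f.

Lemma addm0 : f 0 = 0.
Proof. by apply: (addrI (f 0)); rewrite -fD !addr0. Qed.

Lemma addmN x : f (- x) = - f x.
Proof. by apply: (addrI (f x)); rewrite -fD !subrr addm0. Qed.

Lemma addmB x y : f (x - y) = f x - f y.
Proof. by rewrite fD addmN. Qed.

Lemma addm_sum I (s : seq I) (P : pred I) (F : I -> U) :
  f (\sum_(i <- s | P i) F i) = \sum_(i <- s | P i) f (F i).
Proof. exact: (big_morph f fD addm0). Qed.

Lemma addmMz x n : f (x *~ n) = f x *~ n.
Proof.
have fn (k : nat) : f (x *+ k) = f x *+ k.
  by elim: k => [|k IH]; rewrite ?mulr0n ?addm0 // !mulrS fD IH.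
by case: n => n; rewrite ?NegzE ?mulrNz ?addmN -!pmulrn fn.
Qed.
End AddMap.

(** Locked, like the operations on words below: conversion would otherwise unfold
    nested products. *)
HB.lock Definition sg (V : zmodType) (b : bool) (x : V) := if b then - x else x.

Lemma addm_add (U V : zmodType) (f g : U -> V) :
  addm f -> addm g -> addm (fun x => f x + g x).
Proof. by move=> fD gD x y; rewrite fD gD addrACA. Qed.

Section Sign.
Variable V : zmodType.
Implicit Types (x y : V).

Lemma sg_false x : sg false x = x. Proof. by rewrite unlock. Qed.
Lemma sg_true x : sg true x = - x. Proof. by rewrite unlock. Qed.

Lemma sgD b : addm (@sg V b).
Proof. by case: b => x y; rewrite ?(sg_false, sg_true) ?opprD. Qed.

Lemma sgsg a b x : sg a (sg b x) = sg (a (+) b) x.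
Proof. by case: a; case: b; rewrite !(sg_false, sg_true) ?opprK. Qed.

Lemma sgK b x : sg b (sg b x) = x.
Proof. by rewrite sgsg addbb sg_false. Qed.

Lemma sgN b x : sg b (- x) = - sg b x.
Proof. exact: (addmN (@sgD b)). Qed.

Lemma sg0 b : sg b 0 = 0 :> V.
Proof. exact: (addm0 (@sgD b)). Qed.

Lemma sgNb b x : sg (~~ b) x = - sg b x.
Proof. by case: b; rewrite ?(sg_false, sg_true) ?opprK. Qed.

Lemma mulz_sign n x : x *~ (-1) ^+ n = sg (odd n) x.
Proof. by rewrite -signr_odd; case: (odd n); rewrite ?(sg_false, sg_true). Qed.

Lemma mulz_sgnz (m : int) x : x *~ sgnz m = sg (odd `|m|) x.
Proof.
rewrite /sgnz; case: m => n; first exact: mulz_sign.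
by rewrite /exprz invr_sign mulz_sign.
Qed.
End Sign.

Lemma addm_sg (U V : zmodType) (f : U -> V) (fD : addm f) b x :
  f (sg b x) = sg b (f x).
Proof. by case: b; rewrite ?(sg_false, sg_true) ?(addmN fD). Qed.

Section Quot.
Variables (V : zmodType) (S : zmodClosed V).

Lemma zprojD : addm (@zproj V S).
Proof. by move=> x y; exact: raddfD. Qed.

Lemma zreprK (x : zquot S) : zproj S (zrepr x) = x.
Proof. exact: reprK. Qed.

Lemma zproj_eq x y : (zproj S x = zproj S y) <-> (x - y \in S).
Proof.
rewrite /zproj Quotient.idealrBE; split; first by move/eqP.
by move/eqP.
Qed.

Lemma zproj_eq0 x : (zproj S x = 0) <-> (x \in S).
Proof. by rewrite -(addm0 zprojD) zproj_eq subr0. Qed.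

Lemma zquot_lift (U : zmodType) (f : V -> U) : addm f ->
  (forall x, x \in S -> f x = 0) -> forall x, f (zrepr (zproj S x)) = f x.
Proof.
move=> fD fS x; apply: subr0_eq; rewrite -(addmB fD); apply: fS.
by apply/zproj_eq; rewrite zreprK.
Qed.
End Quot.

Section FreeExt.
Variable K : choiceType.
Implicit Types (x y : {freeg K}).

Lemma linext_wide (V : zmodType) (f : K -> V) x (s : seq K) :
  uniq s -> {subset dom x <= s} -> linext f x = \sum_(e <- s) f e *~ coeff e x.
Proof.
move=> us sub; rewrite /linext [RHS](bigID (fun e => e \in dom x)) /=.
rewrite [X in _ + X]big1 ?addr0; last by move=> e /coeff_outdom ->; rewrite mulr0z.
rewrite -[RHS]big_filter; apply: perm_big; apply: uniq_perm.
- exact: uniq_dom.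
- exact: filter_uniq.
- move=> e; rewrite mem_filter; case: (boolP (e \in dom x)) => // /sub -> //.
Qed.

Lemma linextD (V : zmodType) (f : K -> V) : addm (linext f).
Proof.
move=> x y; pose s := undup (dom x ++ dom y).
have us : uniq s by exact: undup_uniq.
rewrite !(@linext_wide _ f _ s) //; last 3 first.
- by move=> e h; rewrite mem_undup mem_cat h orbT.
- by move=> e h; rewrite mem_undup mem_cat h.
- by move=> e /domD_subset h; rewrite mem_undup.
by rewrite -big_split /=; apply: eq_bigr => e _; rewrite coeffD mulrzDr.
Qed.

Lemma linextU (V : zmodType) (f : K -> V) e : linext f << e >> = f e.
Proof. by rewrite /linext domU1 big_seq1 coeffU eqxx mulr1. Qed.

Lemma freegE x : x = linext (fun e => << e >>) x.
Proof.
rewrite /linext -[LHS]freeg_sumE; apply: eq_bigr => e _.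
by rewrite freegU_mulz intz.
Qed.

Lemma linext_comp (U V : zmodType) (g : U -> V) (f : K -> U) : addm g ->
  forall x, g (linext f x) = linext (g \o f) x.
Proof. by move=> gD x; rewrite /linext (addm_sum gD); apply: eq_bigr => e _; rewrite (addmMz gD). Qed.

Lemma eq_linext_dom (V : zmodType) (f g : K -> V) x :
  {in dom x, f =1 g} -> linext f x = linext g x.
Proof. by move=> h; rewrite /linext !big_seq; apply: eq_bigr => e /h ->. Qed.

Lemma eq_linext (V : zmodType) (f g : K -> V) : f =1 g -> linext f =1 linext g.
Proof. by move=> h x; apply: eq_linext_dom => e _. Qed.

Lemma linext_ind (V : zmodType) (f : K -> V) (P : V -> Prop) x :
  P 0 -> (forall v w, P v -> P w -> P (v + w)) -> (forall v, P v -> P (- v)) ->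
  {in dom x, forall e, P (f e)} -> P (linext f x).
Proof.
move=> P0 PD PN Pf; rewrite /linext big_seq; apply: big_ind => // e /Pf Pe.
have Pn (n : nat) : P (f e *+ n).
  by elim: n => [|n IH]; rewrite ?mulr0n // mulrS; apply: PD.
by case: (coeff e x) => n; rewrite ?NegzE ?mulrNz -pmulrn; [|apply: PN].
Qed.
End FreeExt.

Section Kernel.
Variables (U V : zmodType) (f : U -> V) (fD : addm f).

(** The proof of additivity is an argument so that the instance of [zmodClosed] can
    be inferred from the predicate. *)
Definition kerm (_ : addm f) : {pred U} := fun x => f x == 0.

Lemma kerm_closed : zmod_closed (kerm fD).
Proof.
split; first by apply/eqP; rewrite (addm0 fD).
by move=> x y /eqP fx /eqP fy; apply/eqP; rewrite (addmB fD) fx fy subrr.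
Qed.
End Kernel.
HB.instance Definition _ (U V : zmodType) (f : U -> V) (fD : addm f) :=
  GRing.isZmodClosed.Build U (kerm fD) (kerm_closed fD).

(** * Words modulo antisymmetry *)

Section Words.
Variable Z : choiceType.

Definition word := seq (seq Z).

Inductive swapped : word -> word -> Prop :=
| swap_head u a b v t : swapped ((u ++ a :: b :: v) :: t) ((u ++ b :: a :: v) :: t)
| swap_tail c s s' : swapped s s' -> swapped (c :: s) (c :: s').

Lemma swapped_cat s u a b v t :
  swapped (s ++ (u ++ a :: b :: v) :: t) (s ++ (u ++ b :: a :: v) :: t).
Proof. by elim: s => [|c s IH] /=; constructor. Qed.

Lemma swappedP s s' : swapped s s' ->
  exists p u a b v t, s = p ++ (u ++ a :: b :: v) :: t /\ s' = p ++ (u ++ b :: a :: v) :: t.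
Proof.
elim=> [u a b v t|c {}s {}s' _ [p [u [a [b [v [t [-> ->]]]]]]]].
  by exists [::], u, a, b, v, t.
by exists (c :: p), u, a, b, v, t.
Qed.

Definition anti (V : zmodType) (phi : word -> V) :=
  forall s s', swapped s s' -> phi s = - phi s'.

Definition wrel : {pred {freeg word}} :=
  fun x => `[< forall S : zmodClosed {freeg word},
    (forall s s', swapped s s' -> << s >> + << s' >> \in S) -> x \in S >].

Lemma wrel_closed : zmod_closed wrel.
Proof.
split; first by apply/asboolP => S _; exact: rpred0.
move=> x y /asboolP hx /asboolP hy; apply/asboolP => S hS.
by apply: rpredB; [exact: hx | exact: hy].
Qed.
HB.instance Definition _ :=
  GRing.isZmodClosed.Build {freeg word} wrel wrel_closed.

(** Labels may be repeated or missing; this is what makes induction on the blocks of a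
    word possible. *)
Definition wmod : zmodType := zquot wrel.
Definition wd (s : word) : wmod := zproj wrel << s >>.

Lemma wd_anti : anti wd.
Proof.
move=> s s' h; apply: subr0_eq; rewrite opprK -(zprojD wrel).
by apply/zproj_eq0/asboolP => S; apply.
Qed.

Lemma wmodE (x : wmod) : x = linext wd (zrepr x).
Proof. by rewrite -[LHS]zreprK [in LHS](freegE (zrepr x)) (linext_comp _ (zprojD _)). Qed.

Lemma wmod_ind (P : wmod -> Prop) :
  (forall x y, P x -> P y -> P (x + y)) -> (forall x, P x -> P (- x)) ->
  (forall s, P (wd s)) -> forall x, P x.
Proof.
move=> PD PN Pw x; rewrite (wmodE x); apply: linext_ind => //.
by rewrite -(subrr (wd [::])); apply: PD => //; apply: PN.
Qed.

Lemma wmod_ext (V : zmodType) (f g : wmod -> V) : addm f -> addm g ->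
  (forall s, f (wd s) = g (wd s)) -> f =1 g.
Proof.
move=> fD gD fg; apply: wmod_ind => // [x y fx fy|x fx]; first by rewrite fD gD fx fy.
by rewrite (addmN fD) (addmN gD) fx.
Qed.

Section Lift.
Variables (V : zmodType) (phi : word -> V).

Definition wlift (x : wmod) : V := linext phi (zrepr x).

Hypothesis phiA : anti phi.

Lemma wlift_proj x : wlift (zproj wrel x) = linext phi x.
Proof.
apply: zquot_lift; first exact: linextD.
move=> {}x /asboolP /(_ (kerm (linextD phi))) h; apply/eqP/h => s s' ss'.
by apply/eqP; rewrite linextD !linextU (phiA ss') addNr.
Qed.

Lemma wliftE s : wlift (wd s) = phi s.
Proof. by rewrite wlift_proj linextU. Qed.

Lemma wliftD : addm wlift.
Proof.
by move=> x y; rewrite -(zreprK x) -(zreprK y) -(zprojD wrel) !wlift_proj linextD.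
Qed.
End Lift.
End Words.
Arguments wd {Z} s.

(** * Blocks and the grade involution *)

Section Parity.
Variable Z : choiceType.
Implicit Types (a b : seq Z) (s : word Z).

(** The parity of the dimension of a block, where the empty block has dimension -1,
    so that [bpar_cat] has no exception. *)
Definition bpar b := ~~ odd (size b).
Definition wpar s := foldr (fun b p => bpar b (+) p) false s.

Lemma bpar_cat a b : bpar (a ++ b) = ~~ (bpar a (+) bpar b).
Proof. by rewrite /bpar size_cat oddD; case: odd; case: odd. Qed.

Lemma bpar_swap u p q v : bpar (u ++ p :: q :: v) = bpar (u ++ q :: p :: v).
Proof. by rewrite /bpar !size_cat. Qed.

Lemma wpar_swapped s s' : swapped s s' -> wpar s = wpar s'.
Proof. by elim=> [u a b v t|c {}s {}s' _ IH] /=; rewrite ?IH // bpar_swap. Qed.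

End Parity.

HB.lock Definition bcons (Z : choiceType) (a : seq Z) : wmod Z -> wmod Z :=
  wlift (fun s => wd (a :: s)).

Section Bcons.
Variable Z : choiceType.
Local Notation W := (wmod Z).
Implicit Types (a b c : seq Z) (s t A B : word Z) (x y z : W).

Lemma bcons_anti a : anti (fun s => wd (a :: s)).
Proof. by move=> s s' h; apply: wd_anti; constructor. Qed.

Lemma bconsE a s : bcons a (wd s) = wd (a :: s).
Proof. rewrite unlock; exact: (wliftE (@bcons_anti a)). Qed.

Lemma bconsD a : addm (bcons a).
Proof. rewrite unlock; exact: (wliftD (@bcons_anti a)). Qed.
Lemma bcons0 a : bcons a 0 = 0.
Proof. exact: (addm0 (@bconsD a)). Qed.
Lemma bconsN a x : bcons a (- x) = - bcons a x.
Proof. exact: (addmN (@bconsD a)). Qed.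
Lemma bcons_sg a k x : bcons a (sg k x) = sg k (bcons a x).
Proof. exact: (addm_sg (@bconsD a)). Qed.

Lemma bcons_swap u p q v x : bcons (u ++ p :: q :: v) x = - bcons (u ++ q :: p :: v) x.
Proof.
move: x; apply: wmod_ind => [x y Hx Hy|x Hx|s].
- by rewrite !bconsD Hx Hy opprD.
- by rewrite !bconsN Hx.
- by rewrite !bconsE; apply: wd_anti; constructor.
Qed.

Lemma wmod_bind (P : W -> Prop) :
  (forall x y, P x -> P y -> P (x + y)) -> (forall x, P x -> P (- x)) ->
  P (wd [::]) -> (forall a x, P x -> P (bcons a x)) -> forall x, P x.
Proof.
move=> PD PN P1 Pc; apply: wmod_ind => //; elim=> // a s IH.
by rewrite -bconsE; apply: Pc.
Qed.

Lemma bcons_move u q w v x :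
  bcons (u ++ q :: w ++ v) x = sg (odd (size w)) (bcons (u ++ w ++ q :: v) x).
Proof.
elim: w u => [|r w IH] u /=; first by rewrite sg_false.
by rewrite bcons_swap -cat1s catA IH -catA /= sgNb.
Qed.

Lemma bcons_exchange u a b v x :
  bcons (u ++ a ++ b ++ v) x =
  sg (odd (size a) && odd (size b)) (bcons (u ++ b ++ a ++ v) x).
Proof.
elim: a u => [|q a IH] u /=; first by rewrite sg_false.
rewrite -cat1s catA IH -catA cat1s bcons_move sgsg.
by congr sg; case: odd; case: odd.
Qed.

End Bcons.

(** On the empty word, which has no first block, the value 0 is the one for which the
    formula [kD_bcons] gives a zero differential to words of one block. *)
Definition wwedge (Z : choiceType) (a : seq Z) (s : word Z) : wmod Z :=
  if s is b :: s' then wd ((a ++ b) :: s') else 0.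

HB.lock Definition wedge (Z : choiceType) (a : seq Z) : wmod Z -> wmod Z :=
  wlift (wwedge a).

Section Wedge.
Variable Z : choiceType.
Local Notation W := (wmod Z).
Implicit Types (a b c : seq Z) (s t A B : word Z) (x y z : W).

Lemma wedge_anti a : anti (wwedge a).
Proof.
move=> s s' [u p q v t|c {}s {}s' h] /=; last by apply: wd_anti; constructor.
by rewrite !catA; apply: wd_anti; constructor.
Qed.

Lemma wedgeD a : addm (wedge a). Proof. rewrite unlock; exact: (wliftD (@wedge_anti a)). Qed.
Lemma wedge0 a : wedge a 0 = 0.
Proof. exact: (addm0 (@wedgeD a)). Qed.
Lemma wedgeN a x : wedge a (- x) = - wedge a x.
Proof. exact: (addmN (@wedgeD a)). Qed.
Lemma wedge_sg a k x : wedge a (sg k x) = sg k (wedge a x).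
Proof. exact: (addm_sg (@wedgeD a)). Qed.

Lemma wedge1 a : wedge a (wd [::]) = 0. Proof. rewrite unlock; exact: (wliftE (@wedge_anti a)). Qed.

Lemma wedge_bcons a b x : wedge a (bcons b x) = bcons (a ++ b) x.
Proof.
move: x; apply: wmod_ext => [x y|x y|s]; rewrite ?bconsD ?wedgeD //.
by rewrite !bconsE [wedge]unlock [LHS](wliftE (@wedge_anti a)).
Qed.

Lemma wedge_wedge a b x : wedge a (wedge b x) = wedge (a ++ b) x.
Proof.
move: x; apply: wmod_bind => [x y Hx Hy|x Hx||c x _].
- by rewrite !wedgeD Hx Hy.
- by rewrite !wedgeN Hx.
- by rewrite !wedge1 wedge0.
- by rewrite !wedge_bcons catA.
Qed.

End Wedge.

(** The grade involution, raised to the power k: the exponents met in shuffles add up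
    by [sig_sig]. *)
HB.lock Definition sig (Z : choiceType) (k : bool) : wmod Z -> wmod Z :=
  wlift (fun s => sg (k && wpar s) (wd s)).
Arguments sig {Z} k x : rename.

Section Sig.
Variable Z : choiceType.
Local Notation W := (wmod Z).
Implicit Types (a b c : seq Z) (s t A B : word Z) (x y z : W).

Lemma sig_anti k : anti (fun s => sg (k && wpar s) (wd s)).
Proof. by move=> s s' h; rewrite (wpar_swapped h) (wd_anti h) sgN. Qed.

Lemma sigE k s : sig k (wd s) = sg (k && wpar s) (wd s).
Proof. rewrite unlock; exact: (wliftE (@sig_anti k)). Qed.

Lemma sigD k : addm (@sig Z k). Proof. rewrite unlock; exact: (wliftD (@sig_anti k)). Qed.
Lemma sig0 l : sig l 0 = 0 :> W.
Proof. exact: (addm0 (@sigD l)). Qed.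
Lemma sigN l x : sig l (- x) = - sig l x.
Proof. exact: (addmN (@sigD l)). Qed.
Lemma sig_sg l k x : sig l (sg k x) = sg k (sig l x).
Proof. exact: (addm_sg (@sigD l)). Qed.

Lemma sig1 k : sig k (wd [::]) = wd [::] :> W.
Proof. by rewrite sigE andbF sg_false. Qed.

Lemma sig_bcons k a x : sig k (bcons a x) = sg (k && bpar a) (bcons a (sig k x)).
Proof.
move: x; apply: wmod_ext => [x y|x y|s]; rewrite ?bconsD ?sigD ?bconsD ?sgD //.
by rewrite bconsE !sigE bcons_sg bconsE sgsg; congr sg => /=; case: k; case: bpar.
Qed.

Lemma sig_sig k l x : sig k (sig l x) = sig (k (+) l) x.
Proof.
move: x; apply: wmod_ext => [x y|x y|s]; rewrite ?sigD //.
rewrite !sigE sig_sg sigE sgsg; congr sg.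
by case: k; case: l; case: wpar.
Qed.

Lemma sigF x : sig false x = x.
Proof. by move: x; apply: wmod_ext => [x y|x y|s]; rewrite ?sigD // sigE sg_false. Qed.

(** * The signed shuffle product *)

(** When b is taken first, it moves across all of A, whence the sign. *)
Fixpoint wshuffle A : word Z -> W :=
  match A with
  | [::] => fun B => wd B
  | a :: A' => fix shA B := match B with
      | [::] => wd A
      | b :: B' => bcons a (wshuffle A' B)
                   + sg (bpar b && wpar A) (bcons b (shA B'))
      end
  end.

Lemma wshuffle_cons a A b B : wshuffle (a :: A) (b :: B) =
  bcons a (wshuffle A (b :: B))
  + sg (bpar b && wpar (a :: A)) (bcons b (wshuffle (a :: A) B)).
Proof. by []. Qed.

Lemma wshuffle_nilr A : wshuffle A [::] = wd A.
Proof. by case: A. Qed.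

Lemma wshuffle_antir A : anti (wshuffle A).
Proof.
elim: A => [|a A IHA]; first exact: wd_anti.
move=> B B'; elim=> [u p q v t|c {}B {}B' h IH]; rewrite !wshuffle_cons.
  rewrite (IHA _ ((u ++ q :: p :: v) :: t)); last by constructor.
  by rewrite bconsN bcons_swap bpar_swap sgN opprD.
rewrite (IHA _ (c :: B')); last by constructor.
by rewrite IH !bconsN sgN opprD.
Qed.

Lemma wshuffle_antil B : anti (fun A => wshuffle A B).
Proof.
move=> A A' h; elim: h B => [u p q v t|c {}A {}A' h IHA].
  elim=> [|b B IHB]; first by apply: wd_anti; constructor.
  rewrite !wshuffle_cons IHB bcons_swap bconsN sgN -opprD.
  by rewrite /= bpar_swap.
elim=> [|b B IHB]; first by apply: wd_anti; constructor.
rewrite !wshuffle_cons IHA IHB !bconsN sgN -opprD.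
by rewrite /= (wpar_swapped h).
Qed.

End Sig.

HB.lock Definition sh (Z : choiceType) (x y : wmod Z) : wmod Z :=
  wlift (fun A => wlift (wshuffle A) y) x.
Arguments sh {Z} x y.

Section Sh.
Variable Z : choiceType.
Local Notation W := (wmod Z).
Implicit Types (a b c : seq Z) (s t A B : word Z) (x y z : W).

Lemma sh_anti y : anti (fun A => wlift (wshuffle A) y).
Proof.
move=> A A' h; move: y; apply: wmod_ind => [x y Hx Hy|x Hx|B].
- by rewrite !(wliftD (@wshuffle_antir Z _)) Hx Hy opprD.
- by rewrite !(addmN (wliftD (@wshuffle_antir Z _))) Hx.
- by rewrite !(wliftE (@wshuffle_antir Z _)); apply: (wshuffle_antil B).
Qed.

Lemma shDl y : addm (sh^~ y). Proof. rewrite unlock; exact: (wliftD (@sh_anti y)). Qed.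
Lemma sh0l y : sh 0 y = 0.
Proof. exact: (addm0 (@shDl y)). Qed.
Lemma shNl y x : sh (- x) y = - sh x y.
Proof. exact: (addmN (@shDl y)). Qed.
Lemma sh_sgl y k x : sh (sg k x) y = sg k (sh x y).
Proof. exact: (addm_sg (@shDl y)). Qed.

Lemma shEl A y : sh (wd A) y = wlift (wshuffle A) y.
Proof. rewrite unlock; exact: (wliftE (@sh_anti y)). Qed.

Lemma shDr x : addm (sh x).
Proof.
move=> y z; move: x; apply: wmod_ext => [x x'|x x'|A].
- exact: shDl.
- by rewrite !shDl addrACA.
- by rewrite !shEl (wliftD (@wshuffle_antir Z _)).
Qed.
Lemma sh0r y : sh y 0 = 0.
Proof. exact: (addm0 (@shDr y)). Qed.
Lemma shNr y x : sh y (- x) = - sh y x.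
Proof. exact: (addmN (@shDr y)). Qed.
Lemma sh_sgr y k x : sh y (sg k x) = sg k (sh y x).
Proof. exact: (addm_sg (@shDr y)). Qed.

Lemma shE A B : sh (wd A) (wd B) = wshuffle A B.
Proof. by rewrite shEl (wliftE (@wshuffle_antir Z _)). Qed.

Lemma sh1l y : sh (wd [::]) y = y.
Proof. by move: y; apply: wmod_ext => [y z|y z|B] //; rewrite ?shDr // shE. Qed.

Lemma sh1r x : sh x (wd [::]) = x.
Proof. by move: x; apply: wmod_ext => [y z|y z|A] //; rewrite ?shDl // shE wshuffle_nilr. Qed.

Lemma sh_bcons a x b y : sh (bcons a x) (bcons b y) =
  bcons a (sh x (bcons b y)) + bcons b (sh (sig (bpar b) (bcons a x)) y).
Proof.
move: x; apply: wmod_ext => [x x'|x x'|A].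
- by rewrite bconsD shDl.
- by rewrite bconsD shDl sigD shDl !bconsD addrACA.
move: y; apply: wmod_ext => [y y'|y y'|B].
- by rewrite bconsD shDr.
- by rewrite bconsD !shDr !bconsD addrACA.
rewrite !bconsE sigE sh_sgl bcons_sg !shE.
by congr (_ + _).
Qed.

Lemma sig_wshuffle k A B :
  sig k (wshuffle A B) = sg (k && (wpar A (+) wpar B)) (wshuffle A B).
Proof.
elim: A B => [|a A IHA] B; first by rewrite sigE.
elim: B => [|b B IHB]; first by rewrite sigE addbF.
rewrite wshuffle_cons sigD sgD sig_sg !sig_bcons IHA IHB.
rewrite !bcons_sg !sgsg.
by congr (sg _ _ + sg _ _) => /=; case: (k); case: bpar; case: bpar; case: wpar; case: wpar.
Qed.

Lemma sig_sh k x y : sig k (sh x y) = sh (sig k x) (sig k y).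
Proof.
move: x; apply: wmod_ext => [x x'|x x'|A]; rewrite ?sigD ?shDl ?sigD //.
move: y; apply: wmod_ext => [x x'|x x'|B]; rewrite ?sigD ?shDr ?sigD //.
rewrite !sigE sh_sgl sh_sgr !shE sig_wshuffle sgsg.
by congr sg; case: k.
Qed.

(** The form of [sh_bcons] which is preserved in inductions: crossing b increments the
    power of the involution applied to the left factor. *)
Lemma sh_bconsN k a x b y : sh (sig k (bcons a x)) (bcons b y) =
  sg (k && bpar a) (bcons a (sh (sig k x) (bcons b y)))
  + bcons b (sh (sig (bpar b (+) k) (bcons a x)) y).
Proof.
rewrite sig_bcons sh_sgl sh_bcons sgD; congr (_ + _).
by rewrite -bcons_sg -sh_sgl -sig_sg -sig_bcons sig_sig.
Qed.

(** Both sides are sums over the shuffles of three words. Sorting these by the word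
    that provides the first block gives three terms on each side, which agree by
    induction; the powers k and l of the involution make the induction hypothesis
    apply after a block has crossed x or y. *)
Lemma shA x y z : sh (sh x y) z = sh x (sh y z).
Proof.
suff {x y z}: forall x k y l z,
    sh (sh (sig k x) (sig l y)) z = sh (sig k x) (sh (sig l y) z).
  by move=> h; rewrite -(sigF x) -(sigF y) h.
apply: wmod_bind => [x x' Hx Hx'|x Hx||a x IHx] k.
- by move=> y l z; rewrite !(sigD, shDl) Hx Hx'.
- by move=> y l z; rewrite sigN !shNl Hx.
- by move=> y l z; rewrite sig1 !sh1l.
move=> y; move: y k; apply: wmod_bind => [y y' Hy Hy'|y Hy||b y IHy] k l.
- by move=> z; rewrite !(sigD, shDl, shDr) Hy Hy'.
- by move=> z; rewrite sigN !(shNl, shNr) Hy.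
- by move=> z; rewrite sig1 sh1r sh1l.
move=> z; move: z k l; apply: wmod_bind => [z z' Hz Hz'|z Hz||c z IHz] k l.
- by rewrite !shDr Hz Hz'.
- by rewrite !shNr Hz.
- by rewrite !sh1r.
have IHz' : sh (sig (bpar c) (sh (sig k (bcons a x)) (bcons b (sig l y)))) z =
    sh (sig (bpar c (+) k) (bcons a x)) (sh (sig (bpar c) (bcons b (sig l y))) z).
  have E : sig (bpar c) (bcons b (sig l y)) =
      sg (l && bpar b) (sig (bpar c (+) l) (bcons b y)).
    rewrite !sig_bcons sig_sig sgsg; congr sg.
    by case: (bpar c); case: (l); case: bpar.
  by rewrite sig_sh sig_sig E !(sh_sgr, sh_sgl) IHz.
rewrite [sig l (bcons b y)]sig_bcons !(sh_sgl, sh_sgr).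
congr (sg _ _).
rewrite [sh (bcons b (sig l y)) (bcons c z)]sh_bcons shDr [in RHS]sh_bconsN [in RHS]sh_bconsN.
rewrite -IHz' !sh_bconsN !(sigD, shDl, bconsD).
rewrite sh_sgl sig_sg sh_sgl bcons_sg.
rewrite sh_bcons [sh (bcons b _) (bcons c z)]sh_bcons sgD IHy.
have -> : sh (sh (sig k x) (bcons b (sig l y))) (bcons c z) =
    sh (sig k x) (bcons b (sh (sig l y) (bcons c z)))
    + sh (sig k x) (bcons c (sh (sig (bpar c) (bcons b (sig l y))) z)).
  by rewrite -[bcons b (sig l y)]sigF IHx sigF sh_bcons shDr.
rewrite bconsD sgD addrACA [X in X + _ = _]addrC -!addrA.
exact: addrCA.
Qed.

(** The involution expresses the Koszul sign for moving B across x without assuming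
    that x is homogeneous. *)
Lemma shC x B : sh x (wd B) = sh (wd B) (sig (wpar B) x).
Proof.
move: x; apply: wmod_ext => [x x'|x x'|A]; first exact: shDl.
  by rewrite sigD shDr.
rewrite sigE sh_sgr !shE.
elim: A B => [|a A IHA] B; first by rewrite andbF wshuffle_nilr sg_false.
elim: B => [|b B IHB]; first by rewrite /= sg_false.
rewrite !wshuffle_cons IHA IHB !bcons_sg sgD !sgsg addrC.
by congr (sg _ _ + sg _ _) => /=; case: bpar; case: bpar; case: wpar; case: wpar.
Qed.

End Sh.

(** The half-shuffles [shl] and [shr] are the two parts of the shuffle product,
    according to the factor which provides the first block ([sh_splitr]). *)
Definition wshl (Z : choiceType) (y : wmod Z) (s : word Z) : wmod Z :=
  if s is a :: s' then bcons a (sh (wd s') y) else 0.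

Definition wshr (Z : choiceType) (x : wmod Z) (s : word Z) : wmod Z :=
  if s is b :: s' then bcons b (sh (sig (bpar b) x) (wd s')) else 0.

HB.lock Definition shl (Z : choiceType) (x y : wmod Z) : wmod Z := wlift (wshl y) x.

HB.lock Definition shr (Z : choiceType) (x y : wmod Z) : wmod Z := wlift (wshr x) y.
Arguments shl {Z} x y.
Arguments shr {Z} x y.

Section HalfSh.
Variable Z : choiceType.
Local Notation W := (wmod Z).
Implicit Types (a b c : seq Z) (s t A B : word Z) (x y z : W).

Lemma wshl_anti y : anti (wshl y).
Proof.
move=> s s' [u p q v t|c {}s {}s' h] /=; first exact: bcons_swap.
by rewrite (wd_anti h) shNl bconsN.
Qed.

Lemma shlDl y : addm (shl^~ y). Proof. rewrite unlock; exact: (wliftD (@wshl_anti y)). Qed.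
Lemma shl0l y : shl 0 y = 0.
Proof. exact: (addm0 (@shlDl y)). Qed.
Lemma shlNl y x : shl (- x) y = - shl x y.
Proof. exact: (addmN (@shlDl y)). Qed.
Lemma shl_sgl y k x : shl (sg k x) y = sg k (shl x y).
Proof. exact: (addm_sg (@shlDl y)). Qed.

Lemma shl1 y : shl (wd [::]) y = 0. Proof. rewrite unlock; exact: (wliftE (@wshl_anti y)). Qed.

Lemma shl_bcons a x y : shl (bcons a x) y = bcons a (sh x y).
Proof.
move: x; apply: wmod_ext => [x x'|x x'|s].
- by rewrite bconsD shlDl.
- by rewrite shDl bconsD.
- by rewrite bconsE; rewrite unlock; exact: (wliftE (@wshl_anti y)).
Qed.

Lemma wshr_anti x : anti (wshr x).
Proof.
move=> s s' [u p q v t|c {}s {}s' h] /=; first by rewrite bpar_swap; exact: bcons_swap.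
by rewrite (wd_anti h) shNr bconsN.
Qed.

Lemma shrDr x : addm (shr x). Proof. rewrite unlock; exact: (wliftD (@wshr_anti x)). Qed.
Lemma shr0r y : shr y 0 = 0.
Proof. exact: (addm0 (@shrDr y)). Qed.
Lemma shrNr y x : shr y (- x) = - shr y x.
Proof. exact: (addmN (@shrDr y)). Qed.
Lemma shr_sgr y k x : shr y (sg k x) = sg k (shr y x).
Proof. exact: (addm_sg (@shrDr y)). Qed.

Lemma shr1 x : shr x (wd [::]) = 0. Proof. rewrite unlock; exact: (wliftE (@wshr_anti x)). Qed.

Lemma shr_bcons x b y : shr x (bcons b y) = bcons b (sh (sig (bpar b) x) y).
Proof.
move: y; apply: wmod_ext => [y y'|y y'|s].
- by rewrite bconsD shrDr.
- by rewrite shDr bconsD.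
- by rewrite bconsE; rewrite unlock; exact: (wliftE (@wshr_anti x)).
Qed.

Lemma shrDl y : addm (shr^~ y).
Proof.
move=> x x'; move: y; apply: wmod_bind => [y y' Hy Hy'|y Hy||b y _].
- by rewrite !shrDr Hy Hy' addrACA.
- by rewrite !shrNr Hy opprD.
- by rewrite !shr1 addr0.
- by rewrite !shr_bcons sigD shDl bconsD.
Qed.
Lemma shrNl y x : shr (- x) y = - shr x y.
Proof. exact: (addmN (@shrDl y)). Qed.
Lemma shr_sgl y k x : shr (sg k x) y = sg k (shr x y).
Proof. exact: (addm_sg (@shrDl y)). Qed.

Lemma sh_split a x y : sh (bcons a x) y = shl (bcons a x) y + shr (bcons a x) y.
Proof.
move: y; apply: wmod_bind => [y y' Hy Hy'|y Hy||b y _].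
- by rewrite shDr Hy Hy' !shl_bcons shDr bconsD shrDr addrACA.
- by rewrite shNr Hy !shl_bcons shNr bconsN shrNr opprD.
- by rewrite shr1 addr0 sh1r shl_bcons sh1r.
- by rewrite sh_bcons shl_bcons shr_bcons.
Qed.

Lemma sh_splitr x b y : sh x (bcons b y) = shl x (bcons b y) + shr x (bcons b y).
Proof.
move: x; apply: wmod_bind => [x x' Hx Hx'|x Hx||a x _]; last exact: sh_split.
- by rewrite shDl Hx Hx' shlDl shrDl addrACA.
- by rewrite !(shNl, shlNl, shrNl) Hx opprD.
- by rewrite sh1l shl1 add0r shr_bcons sig1 sh1l.
Qed.

Lemma wedge_shr b x y : wedge b (shr x y) = shr (sig (~~ bpar b) x) (wedge b y).
Proof.
move: y; apply: wmod_bind => [y y' Hy Hy'|y Hy||c y _].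
- by rewrite !(shrDr, wedgeD) Hy Hy'.
- by rewrite !(shrNr, wedgeN) Hy.
- by rewrite !(wedge1, shr1) wedge0 shr0r.
rewrite wedge_bcons !shr_bcons wedge_bcons sig_sig bpar_cat; congr (bcons _ (sh (sig _ _) _)).
by case: bpar; case: bpar.
Qed.

Lemma wedge_shl a x y : wedge a (shl x y) = shl (wedge a x) y.
Proof.
move: x; apply: wmod_bind => [x x' Hx Hx'|x Hx||b x _].
- by rewrite !(shlDl, wedgeD) Hx Hx'.
- by rewrite !(shlNl, wedgeN) Hx.
- by rewrite !(wedge1, shl1) wedge0 shl0l.
- by rewrite !(wedge_bcons, shl_bcons).
Qed.

Lemma wedge_sh a x y : wedge a (sh x y) = shl (wedge a x) y + wedge a (shr x y).
Proof.
move: x; apply: wmod_bind => [x x' Hx Hx'|x Hx||b x _].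
- by rewrite !(shDl, wedgeD, shlDl, shrDl) Hx Hx' addrACA.
- by rewrite !(shNl, wedgeN, shlNl, shrNl) Hx opprD.
- rewrite sh1l wedge1 shl0l add0r.
  move: y; apply: wmod_bind => [y y' Hy Hy'|y Hy||b y _].
  + by rewrite shrDr !wedgeD Hy Hy'.
  + by rewrite shrNr !wedgeN Hy.
  + by rewrite shr1 wedge1 wedge0.
  + by rewrite shr_bcons sig1 sh1l.
- by rewrite sh_split wedgeD wedge_shl.
Qed.

Lemma sig_shr k x y : sig k (shr x y) = shr (sig k x) (sig k y).
Proof.
move: y; apply: wmod_bind => [y y' Hy Hy'|y Hy||b y _].
- by rewrite !(shrDr, sigD) Hy Hy'.
- by rewrite shrNr !sigN shrNr Hy.
- by rewrite sig1 !shr1 sig0.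
- by rewrite shr_bcons !sig_bcons shr_sgr shr_bcons sig_sh !sig_sig [k (+) _]addbC.
Qed.

Lemma sig_wedge k a x : sig k (wedge a x) = sg (k && odd (size a)) (wedge a (sig k x)).
Proof.
move: x; apply: wmod_bind => [y y' Hy Hy'|y Hy||b y _].
- by rewrite !(wedgeD, sigD) Hy Hy' sgD.
- by rewrite !(wedgeN, sigN) Hy sgN.
- by rewrite wedge1 sig1 wedge1 sg0 sig0.
- rewrite wedge_bcons !sig_bcons wedge_sg wedge_bcons sgsg; congr sg.
  by rewrite bpar_cat {1}/bpar; case: k; case: odd; case: bpar.
Qed.

(** * The differential on words *)

(** The exponents of the differential of Pi accumulate the dimensions of the blocks, so
    the sign of the first block is common to all terms. *)
Fixpoint wD (s : word Z) : W :=
  if s is a :: s' then sg (bpar a) (wedge a (wd s') + bcons a (wD s')) else 0.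

Lemma wD_anti : anti wD.
Proof.
move=> s s'; elim=> [u p q v t|c {}s {}s' h IH] /=.
  rewrite bpar_swap bcons_swap.
  have -> : wedge (u ++ p :: q :: v) (wd t) = - wedge (u ++ q :: p :: v) (wd t).
    case: t => [|b t]; first by rewrite !wedge1 oppr0.
    by rewrite -bconsE !wedge_bcons -!catA bcons_swap.
  by rewrite -opprD sgN.
by rewrite IH (wd_anti h) bconsN wedgeN -opprD sgN.
Qed.

End HalfSh.

HB.lock Definition kD (Z : choiceType) : wmod Z -> wmod Z := wlift (@wD Z).
Arguments kD {Z} x : rename.

Section Ops.
Variable Z : choiceType.
Local Notation W := (wmod Z).
Implicit Types (a b c : seq Z) (s t A B : word Z) (x y z : W).
Lemma kDD : addm (@kD Z). Proof. rewrite unlock; exact: (wliftD (@wD_anti Z)). Qed.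
Lemma kD0 : kD 0 = 0 :> W.
Proof. exact: (addm0 (@kDD)). Qed.
Lemma kDN x : kD (- x) = - kD x.
Proof. exact: (addmN (@kDD)). Qed.
Lemma kD_sg k x : kD (sg k x) = sg k (kD x).
Proof. exact: (addm_sg (@kDD)). Qed.
Lemma kDE s : kD (wd s) = wD s. Proof. rewrite unlock; exact: (wliftE (@wD_anti Z)). Qed.
Lemma kD1 : kD (wd [::]) = 0 :> W. Proof. by rewrite kDE. Qed.

Lemma kD_bcons a x : kD (bcons a x) = sg (bpar a) (wedge a x + bcons a (kD x)).
Proof.
move: x; apply: wmod_ext => [x x'|x x'|s].
- by rewrite bconsD kDD.
- by rewrite !(wedgeD, kDD, bconsD) -sgD addrACA.
- by rewrite bconsE !kDE.
Qed.

Lemma sig_kD k x : sig k (kD x) = sg k (kD (sig k x)).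
Proof.
move: x; apply: wmod_bind => [x x' Hx Hx'|x Hx||a x Hx].
- by rewrite !(kDD, sigD) Hx Hx' sgD.
- by rewrite !(kDN, sigN) Hx sgN.
- by rewrite sig1 kD1 sg0 sig0.
rewrite kD_bcons sig_sg sigD sig_wedge !sig_bcons kD_sg kD_bcons !sgsg.
rewrite Hx bcons_sg !sgD !sgsg.
by congr (sg _ _ + sg _ _); rewrite /bpar; case: (k); case: odd.
Qed.

(** Wedging with the block a raises dim by dim(a) + 1: the sign is the Koszul sign of
    an operator of this degree. *)
Lemma kD_wedge a x : kD (wedge a x) = - sg (bpar a) (wedge a (kD x)).
Proof.
move: x; apply: wmod_bind => [x x' Hx Hx'|x Hx||b x _].
- by rewrite !(wedgeD, kDD, sgD) Hx Hx' opprD.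
- by rewrite !(wedgeN, kDN, sgN) Hx.
- by rewrite wedge1 kD1 !(wedge0, kD0) sg0 oppr0.
rewrite wedge_bcons !kD_bcons wedge_sg wedgeD wedge_wedge wedge_bcons.
by rewrite sgsg bpar_cat sgNb.
Qed.

(** The terms which merge the first block with the rest cancel by [kD_wedge], and
    induction applies to the other ones. *)
Lemma kDK x : kD (kD x) = 0.
Proof.
move: x; apply: wmod_bind => [x x' Hx Hx'|x Hx||a x Hx].
- by rewrite !kDD Hx Hx' addr0.
- by rewrite !kDN Hx oppr0.
- by rewrite kD1 kD0.
rewrite kD_bcons kD_sg kDD kD_bcons Hx bcons0 addr0.
by rewrite kD_wedge addNr sg0.
Qed.

Lemma bcons_cat_exchange a b x :
  bcons (a ++ b) x = sg (odd (size a) && odd (size b)) (bcons (b ++ a) x).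
Proof. by have := bcons_exchange [::] a b [::] x; rewrite !cats0. Qed.

(** The differential of a shuffle also merges neighbouring blocks that come from
    different factors. For the first blocks a of x and b of y this happens once as
    a ∧ b and once as b ∧ a, and the two terms cancel by antisymmetry; the other
    ones cancel by induction. *)
Lemma kD_sh x y : kD (sh x y) = sh (kD x) y + sh (sig true x) (kD y).
Proof.
suff {x y}: forall x k y, kD (sh (sig k x) y) = sh (kD (sig k x)) y + sh (sig true (sig k x)) (kD y).
  by move=> h; rewrite -(sigF x) h.
apply: wmod_bind => [x x' Hx Hx'|x Hx||a x IHx] k.
- by move=> y; rewrite !(kDD, shDl, sigD) Hx Hx' addrACA.
- by move=> y; rewrite !(sigN, shNl, kDN) Hx opprD.
- by move=> y; rewrite !sig1 !sh1l kD1 sh0l add0r.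
move=> y; move: y k; apply: wmod_bind => [y y' Hy Hy'|y Hy||b y IHy] k.
- by rewrite !(kDD, shDr) Hy Hy' addrACA.
- by rewrite !(shNr, kDN) Hy opprD.
- by rewrite !sh1r kD1 sh0r addr0.
rewrite sig_bcons sh_sgl !kD_sg !sig_sg !sh_sgl -sgD; congr sg.
set x' := sig k x.
set Y := bcons b y; set X := bcons a x'.
(* The cancelling term, which occurs in [E1] and with the opposite sign in [E2]. *)
pose M := bcons (a ++ b) (sh (sig (bpar b) x') y).
have E1 : wedge a (sh x' Y) = shl (wedge a x') Y + M.
  by rewrite wedge_sh shr_bcons wedge_bcons.
have E2 : sg (bpar b) (wedge b (sh (sig (bpar b) X) y)) =
    - sg (bpar a) M + sg (bpar b) (shr (sig true X) (wedge b y)).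
  rewrite wedge_sh wedge_shr sig_sig addNb sgD addbb; congr (_ + _).
  rewrite sig_bcons wedge_sg wedge_bcons shl_sgl shl_bcons /M.
  rewrite bcons_cat_exchange !sgsg -sgNb; congr sg; rewrite /bpar.
  by case: odd; case: odd.
have E3 : sg (bpar b) (bcons b (sh (kD (sig (bpar b) X)) y)) = shr (kD X) Y.
  by rewrite shr_bcons sig_kD sh_sgl bcons_sg.
have E4 : shl (kD X) Y = sg (bpar a) (shl (wedge a x') Y + bcons a (sh (kD x') Y)).
  by rewrite kD_bcons shl_sgl shlDl shl_bcons.
have E5 : sh (sig true X) (kD Y) =
    sg (bpar a) (bcons a (sh (sig true x') (kD Y))) + shr (sig true X) (kD Y).
  rewrite sig_bcons sh_sgl shr_sgl sh_split sgD shl_bcons; exact: erefl.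
have E6 : shr (sig true X) (kD Y) = sg (bpar b) (shr (sig true X) (wedge b y))
    + sg (bpar b) (bcons b (sh (sig true (sig (bpar b) X)) (kD y))).
  rewrite kD_bcons shr_sgr shrDr sgD; congr (_ + sg _ _).
  by rewrite shr_bcons !sig_sig addbC.
have IHyX : kD (sh (sig (bpar b) X) y) =
    sh (kD (sig (bpar b) X)) y + sh (sig true (sig (bpar b) X)) (kD y).
  have -> : X = sg (k && bpar a) (sig k (bcons a x)) by rewrite sig_bcons sgK.
  rewrite !sig_sg [sig (bpar b) (sig k _)]sig_sig.
  by rewrite !(sh_sgl, kD_sg) IHy !(sh_sgl, sgD).
have IHx' := IHx k Y; rewrite -/x' in IHx'.
have -> : sh X Y = bcons a (sh x' Y) + bcons b (sh (sig (bpar b) X) y) by exact: sh_bcons.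
rewrite kDD [kD (bcons a _)]kD_bcons [kD (bcons b _)]kD_bcons E1 IHx'.
rewrite !(bconsD, sgD) E2 IHyX !(bconsD, sgD) E3.
rewrite E5 E6 [sh (kD X) Y]sh_splitr E4 !sgD.
have AC (L m P Q R S T : W) : (L + m + (P + Q)) + ((- m + R) + (S + T))
    = ((L + P) + S) + (Q + (R + T)).
  rewrite [L + m]addrC -!addrA (addrCA Q) (addrCA P) (addrCA L) addNKr.
  by rewrite (addrCA R) (addrCA Q).
exact: AC.
Qed.
End Ops.

(** * Relabelling *)

Section WMap.
Variables (X Y : choiceType).
Implicit Types (f : X -> Y) (s : word X) (x : wmod X).

Definition wmap f : word X -> word Y := map (map f).

Lemma wmap_cons f a s : wmap f (a :: s) = map f a :: wmap f s.
Proof. by []. Qed.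

Lemma wmap_anti f : anti (fun s => wd (wmap f s)).
Proof.
move=> s s' h; apply: wd_anti; elim: h => [u p q v t|c {}s {}s' h IH] /=.
  by rewrite !map_cat; constructor.
by constructor.
Qed.

End WMap.

HB.lock Definition kmap (X Y : choiceType) (f : X -> Y) : wmod X -> wmod Y :=
  wlift (fun s => wd (wmap f s)).
Arguments kmap {X Y} f x : rename.

Section Map.
Variables (X Y : choiceType).
Implicit Types (f : X -> Y) (s : word X) (x : wmod X).

Lemma kmapD f : addm (kmap f). Proof. rewrite unlock; exact: (wliftD (@wmap_anti _ _ f)). Qed.
Lemma kmap0 f : kmap f 0 = 0.
Proof. exact: (addm0 (@kmapD f)). Qed.
Lemma kmapN f x : kmap f (- x) = - kmap f x.
Proof. exact: (addmN (@kmapD f)). Qed.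
Lemma kmap_sg f k x : kmap f (sg k x) = sg k (kmap f x).
Proof. exact: (addm_sg (@kmapD f)). Qed.
Lemma kmapE f s : kmap f (wd s) = wd (wmap f s).
Proof. rewrite unlock; exact: (wliftE (@wmap_anti _ _ f)). Qed.

Lemma kmap1 f : kmap f (wd [::]) = wd [::].
Proof. exact: kmapE. Qed.

Lemma kmap_bcons f a x : kmap f (bcons a x) = bcons (map f a) (kmap f x).
Proof.
move: x; apply: wmod_ext => [x y|x y|s]; rewrite ?(bconsD, kmapD, bconsD) //.
by rewrite bconsE !kmapE bconsE.
Qed.

Lemma bpar_map f a : bpar (map f a) = bpar a.
Proof. by rewrite /bpar size_map. Qed.

Lemma wpar_map f s : wpar (wmap f s) = wpar s.
Proof. by elim: s => //= a s ->; rewrite bpar_map. Qed.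

Lemma kmap_sig f k x : kmap f (sig k x) = sig k (kmap f x).
Proof.
move: x; apply: wmod_ext => [x y|x y|s]; rewrite ?(sigD, kmapD, sigD) //.
by rewrite sigE kmap_sg !kmapE sigE wpar_map.
Qed.

Lemma kmap_sh f x y : kmap f (sh x y) = sh (kmap f x) (kmap f y).
Proof.
move: x; apply: wmod_ext => [x x'|x x'|A]; rewrite ?(shDl, kmapD, shDl) //.
move: y; apply: wmod_ext => [x x'|x x'|B]; rewrite ?(shDr, kmapD, shDr) //.
rewrite !kmapE !shE; elim: A B => [|a A IHA]; first by move=> B; rewrite kmapE.
elim=> [|b B IHB]; first by rewrite kmapE.
rewrite !wmap_cons !wshuffle_cons kmapD kmap_sg !kmap_bcons IHA IHB.
by rewrite -!wmap_cons !bpar_map wpar_map.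
Qed.

Lemma kmap_wedge f a x : kmap f (wedge a x) = wedge (map f a) (kmap f x).
Proof.
move: x; apply: wmod_bind => [x x' Hx Hx'|x Hx||b x _].
- by rewrite !(wedgeD, kmapD) Hx Hx' ?wedgeD.
- by rewrite !(wedgeN, kmapN) Hx.
- by rewrite kmapE !wedge1 kmap0.
- by rewrite wedge_bcons !kmap_bcons wedge_bcons map_cat.
Qed.

Lemma kmap_shr f x y : kmap f (shr x y) = shr (kmap f x) (kmap f y).
Proof.
move: y; apply: wmod_bind => [y y' Hy Hy'|y Hy||b y _].
- by rewrite !(shrDr, kmapD) Hy Hy'.
- by rewrite !(shrNr, kmapN) Hy.
- by rewrite kmapE !shr1 kmap0.
- by rewrite shr_bcons !kmap_bcons kmap_sh kmap_sig shr_bcons bpar_map.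
Qed.

Lemma kmap_kD f x : kmap f (kD x) = kD (kmap f x).
Proof.
move: x; apply: wmod_bind => [x x' Hx Hx'|x Hx||b x Hx].
- by rewrite !(kDD, kmapD) Hx Hx'.
- by rewrite !(kDN, kmapN) Hx.
- by rewrite kmapE !kD1 kmap0.
- by rewrite kD_bcons kmap_sg kmapD kmap_wedge !kmap_bcons Hx kD_bcons bpar_map.
Qed.

Lemma eq_kmap f g s : {in flatten s, f =1 g} -> kmap f (wd s) = kmap g (wd s).
Proof.
move=> fg; rewrite !kmapE; congr wd; apply/eq_in_map => b bs.
by apply/eq_in_map => x xb; apply: fg; apply/flattenP; exists b.
Qed.
End Map.

Lemma kmap_comp (X Y Z : choiceType) (g : Y -> Z) (f : X -> Y) x :
  kmap g (kmap f x) = kmap (g \o f) x.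
Proof.
move: x; apply: wmod_ext => [x y|x y|s]; rewrite ?kmapD //.
by rewrite !kmapE; congr wd; rewrite /wmap -map_comp; apply: eq_map => b /=; rewrite -map_comp.
Qed.

Lemma kmap_id (X : choiceType) (f : X -> X) x : f =1 id -> kmap f x = x.
Proof.
move=> fid; move: x; apply: wmod_ext => [x y|x y|s]; rewrite ?kmapD //.
by rewrite kmapE /wmap; congr wd; rewrite -[RHS]map_id; apply: eq_map => b; rewrite /= -[RHS]map_id; apply: eq_map.
Qed.

Lemma wedge_swap (Z : choiceType) (u v : seq Z) p q x :
  wedge (u ++ p :: q :: v) x = - wedge (u ++ q :: p :: v) x.
Proof.
move: x; apply: wmod_bind => [x x' Hx Hx'|x Hx||b x Hx].
- by rewrite !wedgeD Hx Hx' opprD.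
- by rewrite !wedgeN Hx.
- by rewrite !wedge1 oppr0.
- by rewrite !wedge_bcons -!catA bcons_swap.
Qed.

(** * Substitution *)

Section WSub.
Variables (X Z : choiceType) (f : X -> Z) (i : X).
Implicit Types (a b p q : seq X) (s : word X) (x : wmod X) (u : wmod Z).

(** The sign in π_l = ± π'_l ∧ i, when i occurs once in π_l = b. *)
Definition esgn b := odd (size b - (index i b).+1).

(** The half-shuffle [shr] puts the first block of u in front of the blocks which
    follow that of i, and this block is then multiplied by what remains of the block
    of i. If i occurs twice in a block, the value 0 is the one for which [wsub] is
    antisymmetric. *)
Fixpoint wsub u s : wmod Z :=
  if s is b :: s' then
    match count_mem i b with
    | 0 => bcons (map f b) (wsub u s')
    | 1 => sg (esgn b) (wedge (map f (filter (predC1 i) b)) (shr (kmap f (wd s')) u))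
    | _ => 0
    end
  else 0.

Lemma esgnE p q : i \notin p -> esgn (p ++ i :: q) = odd (size q).
Proof.
move=> ip; rewrite /esgn index_cat (negbTE ip) /= eqxx addn0 size_cat /=.
by rewrite addnS subSS addKn.
Qed.

Lemma filter_predC1 p q : i \notin p -> i \notin q ->
  filter (predC1 i) (p ++ i :: q) = p ++ q.
Proof.
have fid (a : seq X) : i \notin a -> filter (predC1 i) a = a.
  by move=> ia; apply/all_filterP/allP => x xa /=; apply: contraNneq ia => <-.
by move=> ip iq; rewrite filter_cat /= eqxx /= !fid.
Qed.

Lemma count_mem1P b : count_mem i b = 1%N ->
  exists p q, [/\ b = p ++ i :: q, i \notin p & i \notin q].
Proof.
move=> h; have ib : i \in b by rewrite -has_pred1 has_count h.
move: h; case/splitPr: ib => p q; rewrite count_cat /= eqxx addnCA add1n => -[] /eqP.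
by rewrite addn_eq0 => /andP[/eqP/count_memPn ? /eqP/count_memPn ?]; exists p, q.
Qed.

Lemma wsub_anti u : anti (wsub u).
Proof.
move=> s s'; elim=> [b p q c t|c {}s {}s' h IH] /=; last first.
  rewrite IH (wd_anti h) bconsN kmapN shrNl.
  rewrite wedgeN sgN; by case: count => [|[|n]] //; rewrite oppr0.
have -> : count_mem i (b ++ q :: p :: c) = count_mem i (b ++ p :: q :: c).
  by apply/permP; rewrite perm_cat2l (perm_catCA [:: q] [:: p]).
case E : count => [|[|n]]; last by rewrite oppr0.
  by rewrite !map_cat /= bcons_swap.
have {E} : (count_mem i b + ((p == i) + ((q == i) + count_mem i c)))%N = 1%N.
  by rewrite -E count_cat.
case: (eqVneq p i) => [->|pi]; case: (eqVneq q i) => [->|qi].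
- by move=> h; exfalso; lia.
- move=> h; have ib : i \notin b by apply/count_memPn; lia.
  have -> : esgn (b ++ q :: i :: c) = odd (size c).
    by rewrite -cat_rcons esgnE // mem_rcons inE negb_or eq_sym qi.
  by rewrite esgnE // -sgNb /= ?negbK !filter_cat /= eqxx qi.
- move=> h; have ib : i \notin b by apply/count_memPn; lia.
  have -> : esgn (b ++ p :: i :: c) = odd (size c).
    by rewrite -cat_rcons esgnE // mem_rcons inE negb_or eq_sym pi.
  by rewrite esgnE // -sgNb /= ?negbK !filter_cat /= eqxx pi.
move=> _; rewrite -sgN; have -> : esgn (b ++ q :: p :: c) = esgn (b ++ p :: q :: c).
  rewrite /esgn !index_cat !size_cat /=; case: ifP => // _.
  by rewrite (negbTE pi) (negbTE qi).
by rewrite !filter_cat /= pi qi !map_cat /= wedge_swap.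
Qed.

End WSub.

HB.lock Definition sub (X Z : choiceType) (f : X -> Z) (i : X) (x : wmod X)
  (u : wmod Z) : wmod Z := wlift (wsub f i u) x.
Arguments sub {X Z} f i x u.

Section Sub.
Variables (X Z : choiceType) (f : X -> Z) (i : X).
Implicit Types (a b p q : seq X) (s : word X) (x : wmod X) (u : wmod Z).
Local Notation sub := (sub f i).
Local Notation wsub := (wsub f i).
Local Notation esgn := (esgn i).

Lemma subDl u : addm (sub^~ u). Proof. rewrite unlock; exact: (wliftD (@wsub_anti _ _ _ _ u)). Qed.
Lemma sub_0l u : sub 0 u = 0.
Proof. exact: (addm0 (@subDl u)). Qed.
Lemma subNl u x : sub (- x) u = - sub x u.
Proof. exact: (addmN (@subDl u)). Qed.
Lemma sub_sgl u k x : sub (sg k x) u = sg k (sub x u).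
Proof. exact: (addm_sg (@subDl u)). Qed.
Lemma subE s u : sub (wd s) u = wsub u s. Proof. rewrite unlock; exact: (wliftE (@wsub_anti _ _ _ _ u)). Qed.
Lemma sub1 u : sub (wd [::]) u = 0. Proof. exact: subE. Qed.

Lemma sub_notin b x u : i \notin b -> sub (bcons b x) u = bcons (map f b) (sub x u).
Proof.
move=> ib; move: x; apply: wmod_ext => [x y|x y|s]; rewrite ?(bconsD, subDl, bconsD) //.
by rewrite bconsE !subE /=; have /count_memPn -> := ib.
Qed.

Lemma sub_in p q x u : i \notin p -> i \notin q ->
  sub (bcons (p ++ i :: q) x) u =
  sg (odd (size q)) (wedge (map f (p ++ q)) (shr (kmap f x) u)).
Proof.
move=> ip iq; move: x; apply: wmod_ext => [x y|x y|s].
- by rewrite bconsD subDl.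
- by rewrite kmapD shrDl wedgeD sgD.
rewrite bconsE subE /= count_cat /= eqxx; have /count_memPn -> := ip; have /count_memPn -> := iq.
by rewrite esgnE // filter_predC1.
Qed.

Lemma sub_last p x u : i \notin p ->
  sub (bcons (rcons p i) x) u = wedge (map f p) (shr (kmap f x) u).
Proof. by move=> ip; rewrite -cats1 sub_in // cats0 sg_false. Qed.

Lemma sub_many b x u : (1 < count_mem i b)%N -> sub (bcons b x) u = 0.
Proof.
move=> h; move: x; apply: wmod_ext => [x y|x y|s]; rewrite ?(bconsD, subDl, addr0) //.
by rewrite bconsE subE /=; case: count h => [|[]].
Qed.

Lemma sub_case b : [\/ i \notin b, exists p q, [/\ b = p ++ i :: q, i \notin p & i \notin q]
  | (1 < count_mem i b)%N].
Proof.
case E : (count_mem i b) => [|[|n]].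
- by constructor 1; apply/count_memPn.
- by constructor 2; apply: count_mem1P.
- by constructor 3.
Qed.

Lemma subDr x : addm (sub x).
Proof.
move=> u v; move: x; apply: wmod_bind => [x y Hx Hy|x Hx||b x Hx].
- by rewrite !subDl Hx Hy addrACA.
- by rewrite !subNl Hx opprD.
- by rewrite !sub1 addr0.
case: (sub_case b) => [ib|[p [q [-> ip iq]]]|h].
- by rewrite !sub_notin // Hx bconsD.
- by rewrite !sub_in // shrDr wedgeD sgD.
- by rewrite !sub_many ?addr0.
Qed.
Lemma sub_0r y : sub y 0 = 0.
Proof. exact: (addm0 (@subDr y)). Qed.
Lemma subNr y u : sub y (- u) = - sub y u.
Proof. exact: (addmN (@subDr y)). Qed.
Lemma sub_sgr y k u : sub y (sg k u) = sg k (sub y u).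
Proof. exact: (addm_sg (@subDr y)). Qed.

Lemma sig_sub k x u : sig k (sub x u) = sub (sig k x) (sig k u).
Proof.
move: x; apply: wmod_bind => [x y Hx Hy|x Hx||b x Hx].
- by rewrite !(subDl, sigD) Hx Hy.
- by rewrite !(subNl, sigN) Hx.
- by rewrite sig1 !sub1 sig0.
rewrite sig_bcons sub_sgl.
case: (sub_case b) => [ib|[p [q [-> ip iq]]]|h].
- by rewrite !sub_notin // sig_bcons bpar_map Hx.
- rewrite !sub_in // sig_sg sig_wedge sig_shr kmap_sig !sgsg; congr sg.
  rewrite size_map /bpar !size_cat /= !oddD oddS.
  by case: (k); case: odd; case: odd.
- by rewrite !sub_many // sig0 sg0.
Qed.

Lemma sub_wedge a x u : i \notin a -> sub (wedge a x) u = wedge (map f a) (sub x u).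
Proof.
move=> ia; move: x; apply: wmod_bind => [x y Hx Hy|x Hx||b x Hx].
- by rewrite !(subDl, wedgeD) Hx Hy ?(subDl, wedgeD).
- by rewrite !(subNl, wedgeN) Hx.
- by rewrite wedge1 sub1 sub_0l wedge0.
rewrite wedge_bcons; case: (sub_case b) => [ib|[p [q [-> ip iq]]]|h].
- by rewrite !sub_notin ?mem_cat ?negb_or ?ia // wedge_bcons map_cat.
- by rewrite catA !sub_in ?mem_cat ?negb_or ?ia // wedge_sg wedge_wedge -map_cat catA.
- by rewrite !sub_many ?wedge0 // count_cat ltn_addl.
Qed.

(** Shuffling with A before or after the insertion of u amounts to the same, by
    associativity of the shuffle product; the blocks of A are only relabelled. *)
Lemma sub_sh_right A y u : i \notin flatten A ->
  sub (sh (wd A) y) u = sh (kmap f (wd A)) (sub y u).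
Proof.
move=> iA.
suff: forall k, sub (sh (sig k (wd A)) y) u = sh (sig k (kmap f (wd A))) (sub y u).
  by move/(_ false); rewrite !sigF.
elim: A y iA => [|a A IHA] y; first by move=> _ k; rewrite kmapE !sig1 !sh1l.
rewrite /= mem_cat negb_or -bconsE => /andP[ia iA].
move: y; apply: wmod_bind => [x y Hx Hy|x Hx||b y Hy] k.
- by rewrite !(shDr, subDl) Hx Hy.
- by rewrite !(shNr, subNl) Hx.
- rewrite sh1r sub1 sh0r sig_bcons sub_sgl sub_notin //.
  have := IHA (wd [::]) iA k; rewrite sh1r sub1 sh0r => ->.
  by rewrite bcons0 sg0.
rewrite sh_bconsN subDl sub_sgl sub_notin // IHA // kmap_bcons.
case: (sub_case b) => [ib|[p [q [-> ip iq]]]|h].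
- by rewrite !sub_notin // Hy kmap_bcons sh_bconsN !bpar_map.
- rewrite !sub_in // !sh_sgr !bcons_sg.
  move: u {Hy IHA}; apply: wmod_ext => [v v'|v v'|[|c u]].
  + by rewrite !(shrDr, wedgeD, shDr, bconsD, sgD) addrACA.
  + by rewrite !(shrDr, wedgeD, shDr, bconsD, sgD).
  + by rewrite !shr1 !wedge0 !sh0r bcons0 !sg0 addr0.
  rewrite -bconsE !shr_bcons !wedge_bcons [in RHS]sh_bconsN sgD !bpar_map.
  congr (_ + _); first by rewrite !sgsg addbC.
  congr (sg _ (bcons _ _)); rewrite kmap_sh kmap_sig kmap_bcons sig_sh sig_sig -shA.
  congr (sh (sh (sig _ _) _) _).
  by rewrite /bpar !size_cat size_map size_cat /= !oddD /=; case: odd; case: odd; case: odd; case: (k).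
- by rewrite !sub_many // !sh0r bcons0 sg0 addr0.
Qed.

(** The involution on u is the sign of u moving across B. *)
Lemma sub_sh_left x B u : i \notin flatten B ->
  sub (sh x (wd B)) u = sh (sub x (sig (wpar B) u)) (kmap f (wd B)).
Proof.
move=> iB; rewrite shC sub_sh_right // kmapE shC wpar_map; congr sh.
by rewrite sig_sub sig_sig addbb sigF.
Qed.

Lemma sub_shr_left x B u : i \notin flatten B ->
  sub (shr x (wd B)) u = shr (sub x (sig (wpar B) u)) (kmap f (wd B)).
Proof.
case: B => [_|c B]; first by rewrite kmapE !shr1 sub_0l.
rewrite /= mem_cat negb_or => /andP[ic iB].
rewrite -bconsE shr_bcons sub_notin // sub_sh_left // kmap_bcons shr_bcons bpar_map.
by rewrite sig_sub sig_sig /= addKb.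
Qed.
End Sub.

Section SubTheory.

Lemma count_map_inj (X Y : choiceType) (g : X -> Y) j b :
  (forall x, g x = g j -> x = j) -> count_mem (g j) (map g b) = count_mem j b.
Proof.
move=> gj; rewrite count_map; apply: eq_count => x /=.
by apply/eqP/eqP => [/gj|->].
Qed.

(** The substituted label disappears, so the value of f there does not matter. This
    makes it possible to use total functions for maps defined outside i only. *)
Lemma sub_ext (X Z : choiceType) (f g : X -> Z) i s u : uniq (flatten s) ->
  {in flatten s, forall x, x != i -> f x = g x} ->
  sub f i (wd s) u = sub g i (wd s) u.
Proof.
elim: s => [|b s IH] /=; first by rewrite !sub1.
rewrite cat_uniq => /and3P[_ /hasPn bs us] fg.
have {}IH : sub f i (wd s) u = sub g i (wd s) u.
  by apply: IH => // x xs; apply: fg; rewrite mem_cat xs orbT.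
rewrite -bconsE; case: (sub_case i b) => [ib|[p [q [Eb ip iq]]]|h].
- rewrite !sub_notin // IH; congr bcons; apply/eq_in_map => x xb.
  by apply: fg; [rewrite mem_cat xb|apply: contraNneq ib => <-].
- rewrite Eb !sub_in //; congr (sg _ (wedge _ (shr _ _))).
    apply/eq_in_map => x; rewrite mem_cat => xpq; apply: fg.
      by rewrite Eb !mem_cat inE; case/orP: xpq => ->; rewrite ?orbT.
    by apply: contraTneq xpq => ->; rewrite negb_or ip.
  apply: eq_kmap => x xs; apply: fg; first by rewrite mem_cat xs orbT.
  apply: contraNneq (bs _ xs) => ->; by rewrite Eb mem_cat inE eqxx orbT.
- by rewrite !sub_many.
Qed.

Lemma kmap_sub (X Y Z : choiceType) (h : Y -> Z) (f : X -> Y) i x u :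
  kmap h (sub f i x u) = sub (h \o f) i x (kmap h u).
Proof.
move: x; apply: wmod_bind => [x y Hx Hy|x Hx||b x Hx].
- by rewrite !(subDl, kmapD) Hx Hy.
- by rewrite !(subNl, kmapN) Hx.
- by rewrite !sub1 kmap0.
case: (sub_case i b) => [ib|[p [q [-> ip iq]]]|w].
- by rewrite !sub_notin // kmap_bcons Hx -map_comp.
- by rewrite !sub_in // kmap_sg kmap_wedge kmap_shr kmap_comp -map_comp.
- by rewrite !sub_many // kmap0.
Qed.

Lemma sub_kmap (X Y Z : choiceType) (F : Y -> Z) (g : X -> Y) j y u :
  (forall x, g x = g j -> x = j) ->
  sub F (g j) (kmap g y) u = sub (F \o g) j y u.
Proof.
move=> gj; have mem_g b : (g j \in map g b) = (j \in b).
  by apply/mapP/idP => [[x xb /esym/gj <-]|jb] //; exists j.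
move: y; apply: wmod_bind => [x y Hx Hy|x Hx||b x Hx].
- by rewrite !(kmapD, subDl) Hx Hy.
- by rewrite !(subNl, kmapN) Hx.
- by rewrite kmapE !sub1.
rewrite kmap_bcons; case: (sub_case j b) => [ib|[p [q [-> ip iq]]]|w].
- by rewrite !sub_notin ?mem_g // Hx -map_comp.
- by rewrite map_cat /= !sub_in ?mem_g // -map_cat -map_comp kmap_comp size_map.
- by rewrite !sub_many ?count_map_inj.
Qed.

Section OneAlphabet.
Variable Z : choiceType.
Local Notation W := (wmod Z).

(** The last term is where the first block c of the right factor, which [shr] puts
    first, is merged with the first block of X. *)
Lemma kD_shr (X : W) c y : kD (shr X (bcons c y)) =
  shr (sig true X) (kD (bcons c y)) + shr (kD X) (bcons c y)
  + sg (bpar c) (shl (wedge c (sig (bpar c) X)) y).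
Proof.
rewrite shr_bcons !kD_bcons shr_sgr shrDr !shr_bcons kD_sh wedge_sh wedge_shr.
rewrite !sig_sig addNb addbb addbT !(bconsD, sgD) sig_kD sh_sgl bcons_sg.
move: (sg _ (shl _ _)) (sg _ (shr _ _)) => P Q; move: (sg _ _) (sg _ _) => R T.
by rewrite -!addrA addrCA; congr (_ + _); rewrite addrA addrC; congr (_ + _); rewrite addrC.
Qed.

(** One of the axioms of dendriform algebras. *)
Lemma shr_sh (X Y U : W) : shr (sh X Y) U = shr X (shr Y U).
Proof.
move: U; apply: wmod_bind => [x y Hx Hy|x Hx||d u _].
- by rewrite !shrDr Hx Hy.
- by rewrite !shrNr Hx.
- by rewrite !shr1 shr0r.
- by rewrite !shr_bcons sig_sh shA.
Qed.

Lemma shr_wedge b (X Y : W) : shr X (wedge b Y) = wedge b (shr (sig (~~ bpar b) X) Y).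
Proof. by rewrite wedge_shr sig_sig addbb sigF. Qed.

End OneAlphabet.

(** The term of the differential which merges the block r ∧ i with the next block d.
    Moving i and c across d, where c comes to the place of i, turns it into the last
    term of [kD_shr]. *)
Lemma sub_wedge_rcons (X Z : choiceType) (f : X -> Z) i r s c y :
  i \notin r -> i \notin flatten s ->
  sub f i (wedge (rcons r i) (wd s)) (bcons c y) =
  sg (bpar c) (wedge (map f r) (shl (wedge c (sig (bpar c) (kmap f (wd s)))) y)).
Proof.
move=> ir; case: s => [_|d s].
  by rewrite wedge1 sub_0l kmapE sig1 wedge1 shl0l wedge0 sg0.
rewrite /= mem_cat negb_or => /andP[id is'].
rewrite -bconsE wedge_bcons cat_rcons sub_in // shr_bcons wedge_bcons kmap_bcons sig_bcons.
rewrite wedge_sg wedge_bcons shl_sgl shl_bcons wedge_sg wedge_bcons map_cat -catA.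
have := bcons_exchange (map f r) (map f d) c [::]; rewrite !cats0 => ->.
rewrite !sgsg; congr sg; rewrite bpar_map /bpar size_map.
by case: odd; case: odd.
Qed.

(** If i is not in the first block, the statement follows by induction. Otherwise i can
    be moved to the end of this block, and the statement becomes the derivation rule
    [kD_shr]. *)
Lemma kD_sub (X Z : choiceType) (f : X -> Z) i s u : uniq (flatten s) ->
  kD (sub f i (wd s) u) = sub f i (kD (wd s)) u + sub f i (sig true (wd s)) (kD u).
Proof.
elim: s => [|b s IH] /=; first by rewrite sig1 kD1 !sub1 sub_0l addr0 kD0.
rewrite cat_uniq => /and3P[ub /hasPn bs us]; have {}IH := IH us.
rewrite -bconsE; case: (sub_case i b) => [ib|[p [q [Eb ip iq]]]|h].
- rewrite sub_notin // !kD_bcons sig_bcons !sub_sgl bpar_map IH -sgD; congr sg.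
  by rewrite subDl !sub_notin // sub_wedge // bconsD addrA.
- have is' : i \notin flatten s by apply/negP => /bs; rewrite Eb mem_cat inE eqxx orbT.
  pose r := p ++ q; have ir : i \notin r by rewrite mem_cat negb_or ip.
  have -> : bcons b (wd s) = sg (odd (size q)) (bcons (rcons r i) (wd s)).
    by rewrite Eb -[in LHS](cats0 q) bcons_move catA cats1.
  rewrite sub_sgl !kD_sg sig_sg.
  rewrite !sub_sgl -sgD; congr sg.
  rewrite kD_bcons sig_bcons !sub_sgl subDl !sub_last // kD_wedge bpar_map.
  have -> : bpar (rcons r i) = ~~ bpar r by rewrite /bpar size_rcons.
  rewrite kmap_sig kmap_kD -sgNb -sgD; congr sg.
  move: u {IH}; apply: wmod_ext => [v w||[|c u]].
  + by rewrite shrDr kDD wedgeD.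
  + apply: addm_add; last by move=> v w; rewrite kDD shrDr wedgeD.
    apply: addm_add; first exact: subDr.
    by move=> v w; rewrite shrDr wedgeD.
  + rewrite kD1 !shr1 kD0 shr0r !wedge0 !addr0.
    case: s is' {bs us} => [|d s] is'; first by rewrite wedge1 sub_0l.
    move: is'; rewrite /= mem_cat negb_or => /andP[id is'].
    by rewrite -bconsE wedge_bcons cat_rcons sub_in // shr1 wedge0 sg0.
  rewrite -bconsE kD_shr !wedgeD sub_wedge_rcons // wedge_sg.
  by rewrite addrC addrA addrAC.
- by move: h; rewrite count_uniq_mem //; case: (i \in b).
Qed.
End SubTheory.

(** * Associativity of substitution *)

Section SubAssoc.

Lemma sub_nil (X Z : choiceType) (f : X -> Z) i x : sub f i x (wd [::]) = 0.
Proof.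
move: x; apply: wmod_bind => [x y Hx Hy|x Hx||b y Hy].
- by rewrite subDl Hx Hy addr0.
- by rewrite subNl Hx oppr0.
- by rewrite sub1.
case: (sub_case i b) => [ic|[p [q [-> ip iq]]]|h].
- by rewrite sub_notin // Hy bcons0.
- by rewrite sub_in // shr1 wedge0 sg0.
- by rewrite sub_many.
Qed.

Lemma sub_shr_right (X Z : choiceType) (f : X -> Z) i A y u : i \notin flatten A ->
  sub f i (shr (wd A) y) u = shr (kmap f (wd A)) (sub f i y u).
Proof.
move=> iA; move: y; apply: wmod_bind => [x y Hx Hy|x Hx||c y _].
- by rewrite shrDr !subDl Hx Hy shrDr.
- by rewrite shrNr !subNl Hx shrNr.
- by rewrite shr1 sub1 shr0r sub_0l.
rewrite shr_bcons; case: (sub_case i c) => [ic|[p [q [-> ip iq]]]|h].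
- by rewrite !sub_notin // sigE sh_sgl sub_sgl sub_sh_right // shr_bcons bpar_map kmapE sigE sh_sgl wpar_map.
- rewrite !sub_in // kmap_sh kmap_sig shr_sh shr_sgr shr_wedge; congr (sg _ (wedge _ (shr (sig _ _) _))).
  by rewrite bpar_map /bpar !size_cat /= !oddD /=; case: odd; case: odd.
- by rewrite !sub_many // shr0r.
Qed.

(** The first substitution takes place in the block of i. The label j is then found in
    the inserted word, and the second substitution commutes with the wedge and the
    half-shuffle around it ([sub_wedge], [sub_shr_right]). *)
Lemma sub_seq (X Y G Z : choiceType) (F : G -> Z) (f : X -> G) (g : Y -> G) i j s y u :
  uniq (flatten s) -> (forall x, x != i -> f x != g j) ->
  (forall x, g x = g j -> x = j) ->
  sub F (g j) (sub f i (wd s) (kmap g y)) u =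
  sub (F \o f) i (wd s) (sub (F \o g) j y u).
Proof.
move=> us fg gj; elim: s us => [|b s IH] /=; first by rewrite !sub1 sub_0l.
rewrite cat_uniq => /and3P[ub /hasPn bs us]; have {}IH := IH us.
have fgN a : i \notin a -> g j \notin map f a.
  move=> ia; apply/mapP => -[x xa e]; have /fg : x != i by apply: contraNneq ia => <-.
  by rewrite -e eqxx.
rewrite -bconsE; case: (sub_case i b) => [ib|[p [q [Eb ip iq]]]|h]; last first.
- by rewrite !sub_many // sub_0l.
- have is' : i \notin flatten s by apply/negP => /bs; rewrite Eb mem_cat inE eqxx orbT.
  rewrite Eb !sub_in // sub_sgl sub_wedge; last by rewrite fgN // mem_cat negb_or ip.
  rewrite -map_comp kmapE sub_shr_right; last by rewrite -map_flatten fgN.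
  by rewrite kmapE sub_kmap // /wmap -map_comp kmapE; congr (sg _ (wedge _ (shr (wd _) _)));
     apply: eq_map => b'; rewrite /= -map_comp.
- by rewrite !sub_notin ?fgN // IH -map_comp.
Qed.

(** The normal form used when both labels of [sub_par] are in the same block. *)
Lemma bcons_last2 (X : choiceType) (b : seq X) i k : i \in b -> k \in b -> i != k ->
  uniq b -> exists r e, [/\ i \notin r, k \notin r &
    forall x : wmod X, bcons b x = sg e (bcons (r ++ [:: i; k]) x)].
Proof.
move=> ib kb ik; case/splitPr: kb ib => p q ib ub.
have : uniq (k :: p ++ q) by rewrite -cat1s uniq_catCA.
rewrite cons_uniq => /andP[kpq].
have : i \in p ++ q by move: ib; rewrite !mem_cat inE (negbTE ik).
have E x : bcons (p ++ k :: q) x = sg (odd (size q)) (bcons ((p ++ q) ++ [:: k]) x : wmod X).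
  by rewrite -[in LHS](cats0 q) bcons_move catA.
move=> ipq; case/splitPr: ipq kpq E => p' q'; rewrite mem_cat inE !negb_or => /and3P[kp' _ kq'] E.
rewrite -cat1s uniq_catCA cat1s cons_uniq => /andP[ipq _].
exists (p' ++ q'), (odd (size q) (+) odd (size q')); split=> // [|x].
  by rewrite mem_cat negb_or kp'.
by rewrite E -!catA cat_cons bcons_move sgsg.
Qed.

Section Parallel.
Variables (X Z : choiceType) (i k : X).

(** As k is not in the block of i, the second substitution takes place in the blocks
    which follow and commutes with the half-shuffle by [sub_shr_left], with the sign
    of U moving across T. *)
Lemma sub_par_one (G G' : choiceType) (f : X -> G) (f' : X -> G')
    (F : G -> Z) (F' : G' -> Z) b s T U :
  (forall x, f x = f k -> x = k) -> (forall x, f' x = f' i -> x = i) ->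
  (forall x, x != i -> x != k -> F (f x) = F' (f' x)) ->
  f k \notin flatten T -> uniq (flatten (b :: s)) -> i \in b -> k \notin b ->
  sub F (f k) (sub f i (wd (b :: s)) (wd T)) (kmap F' (wd U)) =
  sg (wpar T && wpar U)
    (sub F' (f' i) (sub f' k (wd (b :: s)) (wd U)) (kmap F (wd T))).
Proof.
move=> fk fi Ff kT; rewrite /= cat_uniq => /and3P[ub /hasPn bs us] ib kb.
have is' : i \notin flatten s by apply/negP => /bs; rewrite /= ib.
rewrite -bconsE; case: (sub_case i b) => [|[p [q [Eb ip iq]]]|]; first by rewrite ib.
  have kpq : k \notin p ++ q.
    by move: kb; rewrite Eb !mem_cat inE !negb_or => /and3P[-> _ ->].
  have ipq : i \notin p ++ q by rewrite mem_cat negb_or ip.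
  have fkN a : k \notin a -> f k \notin map f a.
    by move=> ka; apply/mapP => -[x xa /esym/fk xk]; rewrite -xk xa in ka.
  have fiN a : i \notin a -> f' i \notin map f' a.
    by move=> ia; apply/mapP => -[x xa /esym/fi xi]; rewrite -xi xa in ia.
  rewrite (sub_notin f' _ _ kb) Eb map_cat /= !sub_in ?fiN // size_map.
  rewrite sub_sgl sub_wedge ?fkN // sub_shr_left // sub_kmap //.
  rewrite kmap_sub sgsg addbC -sgsg; congr sg.
  rewrite -map_cat -!map_comp [kmap F' (wd U)]kmapE sigE wpar_map sub_sgr shr_sgl wedge_sg; congr sg.
  have -> : sub (F \o f) k (wd s) (wd (wmap F' U)) = sub (F' \o f') k (wd s) (wd (wmap F' U)).
    by apply: sub_ext => // x xs xk; apply: Ff => //; apply: contraNneq is' => <-.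
  congr wedge; apply/eq_in_map => x xpq.
  by apply: Ff; [apply: contraNneq ipq => <-|apply: contraNneq kpq => <-].
by rewrite count_uniq_mem // ib.
Qed.
End Parallel.

(** The essential case is that of a first block r ∧ i ∧ k. Then both sides insert the
    first blocks c and d of T and U after r, in one order or in the other, and shuffle
    the remaining blocks; they agree up to sign by antisymmetry and by the graded
    commutativity of the shuffle product. *)
Lemma sub_par (X G G' Z : choiceType) (f : X -> G) (f' : X -> G')
    (F : G -> Z) (F' : G' -> Z) i k s T U : i != k ->
  (forall x, f x = f k -> x = k) -> (forall x, f' x = f' i -> x = i) ->
  (forall x, x != i -> x != k -> F (f x) = F' (f' x)) ->
  f k \notin flatten T -> f' i \notin flatten U -> uniq (flatten s) ->
  sub F (f k) (sub f i (wd s) (wd T)) (kmap F' (wd U)) =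
  sg (wpar T && wpar U)
    (sub F' (f' i) (sub f' k (wd s) (wd U)) (kmap F (wd T))).
Proof.
move=> ik fk fi Ff kT iU; elim: s => [|b s IH] us; first by rewrite !sub1 !sub_0l sg0.
have fkN a : k \notin a -> f k \notin map f a.
  by move=> ka; apply/mapP => -[x xa /esym/fk xk]; rewrite -xk xa in ka.
have fiN a : i \notin a -> f' i \notin map f' a.
  by move=> ia; apply/mapP => -[x xa /esym/fi xi]; rewrite -xi xa in ia.
case: (boolP (i \in b)) => ib; case: (boolP (k \in b)) => kb; last first.
- rewrite -bconsE !sub_notin ?fkN ?fiN // IH ?bcons_sg; last first.
    by move: us; rewrite /= cat_uniq => /and3P[].
  congr (sg _ (bcons _ _)); rewrite -!map_comp; apply/eq_in_map => x xb.
  by apply: Ff; [apply: contraNneq ib => <-|apply: contraNneq kb => <-].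
- rewrite (@sub_par_one _ _ k i _ _ f' f F' F b s U T) // ?[wpar U && _]andbC ?sgK //.
  by move=> x xk xi; rewrite Ff.
- exact: sub_par_one.
move: us; rewrite /= cat_uniq => /and3P[ub /hasPn bs us].
have [r [e [ir kr E]]] := bcons_last2 ib kb ik ub.
have is' : i \notin flatten s by apply/negP => /bs; rewrite /= ib.
have ks : k \notin flatten s by apply/negP => /bs; rewrite /= kb.
rewrite -bconsE E !sub_sgl [in RHS]sgsg addbC -sgsg; congr sg.
have Er : map F (map f r) = map F' (map f' r).
  rewrite -!map_comp; apply/eq_in_map => x xr.
  by apply: Ff; [apply: contraNneq ir => <-|apply: contraNneq kr => <-].
have Es : kmap F (kmap f (wd s)) = kmap F' (kmap f' (wd s)).
  rewrite !kmap_comp; apply: eq_kmap => x xs.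
  by apply: Ff; [apply: contraNneq is' => <-|apply: contraNneq ks => <-].
rewrite [sub f i _ _]sub_in ?inE //.
have -> : r ++ [:: i; k] = rcons (rcons r i) k by rewrite -!cats1 -catA.
rewrite [sub f' k _ _]sub_last; last by rewrite mem_rcons inE negb_or eq_sym ik.
rewrite sub_sgl.
case: T kT {IH} => [_|c T]; first by rewrite kmap1 shr1 wedge0 sub_nil !(sg0, sub_0l).
case: U iU => [_|d U]; first by rewrite kmap1 shr1 wedge0 sub_nil !(sg0, sub_0l).
rewrite /= !mem_cat !negb_or => /andP[id iU] /andP[kc kT].
rewrite -!bconsE !shr_bcons !wedge_bcons cats1 !map_rcons !cat_rcons.
rewrite sub_in ?fkN // sub_in ?fiN // !kmap_bcons !shr_bcons !wedge_bcons.
rewrite !kmap_sh !kmap_sig -Es !sig_sh !sig_sig !shA !map_cat Er -!catA.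
have := bcons_exchange (map F' (map f' r)) (map F c) (map F' d) [::]; rewrite !cats0 => ->.
rewrite !kmapE !sigE !wpar_map !sh_sgl !sh_sgr !bcons_sg.
rewrite [sh (wd (wmap F T)) _]shC sigE !sh_sgr !wpar_map bcons_sg.
rewrite !bpar_map !size_map [bpar d (+) _]addbC !sgsg; congr sg.
rewrite /bpar.
by case: odd; case: odd; case: (wpar s); case: (wpar T); case: (wpar U).
Qed.

(** The labels of the second substitutions are given up to equality, which avoids
    rewriting in dependent types. *)
Lemma sub_par_at (X G G' Z : choiceType) (f : X -> G) (f' : X -> G')
    (F : G -> Z) (F' : G' -> Z) i k a b s T U : i != k -> a = f k -> b = f' i ->
  (forall x, f x = f k -> x = k) -> (forall x, f' x = f' i -> x = i) ->
  (forall x, x != i -> x != k -> F (f x) = F' (f' x)) ->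
  a \notin flatten T -> b \notin flatten U -> uniq (flatten s) ->
  sub F a (sub f i (wd s) (wd T)) (kmap F' (wd U)) =
  sg (wpar T && wpar U) (sub F' b (sub f' k (wd s) (wd U)) (kmap F (wd T))).
Proof. by move=> ik -> ->; exact: sub_par. Qed.

Lemma sub_unitl (Z : choiceType) (X : choiceType) (f : X -> Z) i b t :
  sub f i (wd [:: [:: i]]) (wd (b :: t)) = wd (b :: t).
Proof.
rewrite -bconsE (@sub_last _ _ f i [::]) // kmap1 -bconsE shr_bcons wedge_bcons.
by rewrite sig1 sh1l.
Qed.

Lemma sub_unitr (X Z : choiceType) (f g : X -> Z) i s : uniq (flatten s) ->
  i \in flatten s -> (forall x, x != i -> f x = g x) ->
  sub f i (wd s) (wd [:: [:: g i]]) = kmap g (wd s).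
Proof.
move=> us + fg; elim: s us => [|b s IH] //=; rewrite cat_uniq mem_cat => /and3P[ub /hasPn bs us].
rewrite -bconsE; case: (sub_case i b) => [ib|[p [q [Eb ip iq]]]|h].
- rewrite (negbTE ib) => is'; rewrite sub_notin // IH // kmap_bcons; congr bcons.
  by apply/eq_in_map => x xb; apply: fg; apply: contraNneq ib => <-.
- move=> _; have is' : i \notin flatten s by apply/negP => /bs; rewrite Eb mem_cat inE eqxx orbT.
  rewrite Eb sub_in // -bconsE shr_bcons wedge_bcons sh1r sigF kmap_bcons.
  rewrite [in RHS]map_cat /= -[in RHS](cats0 (map g q)) bcons_move size_map.
  have E a : i \notin a -> map f a = map g a.
    by move=> ia; apply/eq_in_map => x xa; apply: fg; apply: contraNneq ia => <-.
  rewrite E ?mem_cat ?negb_or ?ip // catA -map_cat; congr (sg _ (bcons _ _)).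
  by apply: eq_kmap => x xs; apply: fg; apply: contraNneq is' => <-.
- by move: h; rewrite count_uniq_mem //; case: (i \in b).
Qed.

End SubAssoc.

(** * The embedding of Pi into the words *)

Lemma eq_kmap1 (X Y : choiceType) (f g : X -> Y) x : f =1 g -> kmap f x = kmap g x.
Proof.
move=> fg; move: x; apply: wmod_ext => [x y|x y|s]; rewrite ?kmapD //.
by apply: eq_kmap => x _.
Qed.

Section Expr.
Variable I : finType.
Implicit Types (s : word I).

Lemma expr_uniq s : is_expr s -> uniq (flatten s).
Proof. by case/andP => _ /perm_uniq ->; exact: enum_uniq. Qed.

Lemma expr_mem s x : is_expr s -> x \in flatten s.
Proof. by case/andP => _ /perm_mem ->; rewrite mem_enum. Qed.

Lemma exprP s : [::] \notin s -> uniq (flatten s) -> (forall x, x \in flatten s) -> is_expr s.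
Proof.
move=> s0 us ms; rewrite /is_expr s0; apply: uniq_perm => // [|x]; first exact: enum_uniq.
by rewrite ms mem_enum.
Qed.

Lemma expr_swapped s s' : swapped s s' -> is_expr s = is_expr s'.
Proof.
move=> h; rewrite /is_expr; congr andb.
  elim: h => [u a b v t|c {}s {}s' h IH]; rewrite !in_cons; first by case: u.
  by rewrite !negb_or IH.
suff /permPl -> : perm_eq (flatten s) (flatten s') by [].
elim: h => [u a b v t|c {}s {}s' h IH] /=; last by rewrite perm_cat2l.
by rewrite perm_cat2r perm_cat2l (perm_catCA [:: a] [:: b]).
Qed.

Lemma wdim_size s : [::] \notin s -> (wdim s + size s = size (flatten s))%N.
Proof.
rewrite /wdim; elim: s => [|b s IH]; first by rewrite big_nil.
rewrite big_cons inE negb_or => /andP[b0 /IH] /=; rewrite size_cat => <-.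
by rewrite /bdim; case: b b0 => //= a b _; lia.
Qed.

Lemma expr_wdim s : is_expr s -> (wdim s + size s = #|I|)%N.
Proof. by case/andP => s0 /perm_size; rewrite -cardE => <-; apply: wdim_size. Qed.

Lemma linext_mono (V : zmodType) (phi : word I -> V) s :
  linext (fun e : expr I => phi (val e)) (mono s) = if is_expr s then phi s else 0.
Proof.
rewrite /mono; case: insubP => [e -> <-|/negbTE ->]; first exact: linextU.
by rewrite (addm0 (linextD _)).
Qed.

Lemma mono_expr (e : expr I) : mono (val e) = << e >>.
Proof. by rewrite /mono valK. Qed.

Lemma Pi_projD : addm (@Pi_proj I).
Proof. exact: zprojD. Qed.

Lemma Pi_mono_anti : anti (@Pi_mono I).
Proof.
move=> s s' /swappedP[p [u [a [b [v [t [-> ->]]]]]]]; apply: subr0_eq; rewrite opprK -Pi_projD.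
by apply/zproj_eq0/asboolP => S; apply.
Qed.

Definition wemb (x : Pi_car I) : wmod I :=
  linext (fun e : expr I => wd (val e)) (zrepr x).

Lemma wemb_proj y : wemb (Pi_proj y) = linext (fun e : expr I => wd (val e)) y.
Proof.
apply: zquot_lift; first exact: linextD.
move=> {}y /asboolP /(_ (kerm (linextD (fun e : expr I => wd (val e))))) h.
apply/eqP/h => s t u v a b.
have ss' := swapped_cat s u a b v t.
apply/eqP; rewrite linextD !linext_mono (expr_swapped ss'); case: ifP => _; last by rewrite addr0.
by rewrite (wd_anti ss') addNr.
Qed.

Lemma wembD : addm wemb.
Proof.
move=> x y; rewrite -[x]zreprK -[y]zreprK -(zprojD (@antisym I)).
by rewrite -[zproj _]/(@Pi_proj I) !wemb_proj linextD.
Qed.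

Lemma wemb_mono s : is_expr s -> wemb (Pi_mono s) = wd s.
Proof. by move=> es; rewrite wemb_proj linext_mono es. Qed.

Lemma PiE (x : Pi_car I) : x = linext (fun e : expr I => Pi_mono (val e)) (zrepr x).
Proof.
rewrite -[LHS]zreprK [in LHS](freegE (zrepr x)) (linext_comp _ (zprojD _)).
by apply: eq_linext => e; rewrite /Pi_mono mono_expr.
Qed.

Lemma Pi_ind (P : Pi_car I -> Prop) : P 0 ->
  (forall x y, P x -> P y -> P (x + y)) -> (forall x, P x -> P (- x)) ->
  (forall s, is_expr s -> P (Pi_mono s)) -> forall x, P x.
Proof. by move=> P0 PD PN Pm x; rewrite (PiE x); apply: linext_ind => // e _; apply/Pm/valP. Qed.

Lemma Pi_ext (V : zmodType) (f g : Pi_car I -> V) : addm f -> addm g ->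
  (forall s, is_expr s -> f (Pi_mono s) = g (Pi_mono s)) -> f =1 g.
Proof.
move=> fD gD fg; apply: Pi_ind => // [|x y fx fy|x fx]; first by rewrite (addm0 fD) (addm0 gD).
  by rewrite fD gD fx fy.
by rewrite (addmN fD) (addmN gD) fx.
Qed.

Definition Pi_lift (V : zmodType) (phi : word I -> V) x := wlift phi (wemb x).

Lemma Pi_liftD (V : zmodType) (phi : word I -> V) : anti phi -> addm (Pi_lift phi).
Proof. by move=> pA x y; rewrite /Pi_lift wembD (wliftD pA). Qed.

Lemma Pi_lift_mono (V : zmodType) (phi : word I -> V) s : anti phi -> is_expr s ->
  Pi_lift phi (Pi_mono s) = phi s.
Proof. by move=> pA es; rewrite /Pi_lift wemb_mono // (wliftE pA). Qed.

(** [Pi_mono] is defined and antisymmetric on all words, with the value 0 on those which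
    are not expressions, and hence extends to a retraction of [wemb]. *)
Lemma wembK x : Pi_lift (@Pi_mono I) x = x.
Proof.
move: x; apply: Pi_ext => //; first exact: (Pi_liftD Pi_mono_anti).
by move=> s es; rewrite (Pi_lift_mono Pi_mono_anti).
Qed.

Lemma wemb_inj : injective wemb.
Proof. by move=> x y e; rewrite -(wembK x) -(wembK y) /Pi_lift e. Qed.
End Expr.

(** * The grading of Pi *)

Section Degree.
Variable I : nfset.
Implicit Types (x y : Pi I) (n : int).

Lemma hdeg_Pi_mono n s : (is_expr s -> (wdim s)%:Z = n) -> @hdeg (Pi I) n (Pi_mono s).
Proof.
move=> h; exists (mono s) => // e; rewrite /mono; case: insubP => [e' es se'|_].
  by rewrite domU1 inE => /eqP ->; rewrite se' h.
by rewrite dom0.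
Qed.

Lemma hdeg_Pi_ind n (P : Pi I -> Prop) : P 0 ->
  (forall x y, P x -> P y -> P (x + y)) -> (forall x, P x -> P (- x)) ->
  (forall s, is_expr s -> (wdim s)%:Z = n -> P (Pi_mono s)) ->
  forall x, hdeg n x -> P x.
Proof.
move=> P0 PD PN Pm x [y hy ->].
have -> : Pi_proj y = linext (fun e : expr I => Pi_mono (val e)) y.
  rewrite [in LHS](freegE y) (linext_comp _ (@Pi_projD I)).
  by apply: eq_linext => e; rewrite /Pi_mono mono_expr.
by apply: linext_ind => // e /hy he; apply: Pm => //; exact: valP.
Qed.

Lemma hdeg_Pi0 n : @hdeg (Pi I) n 0.
Proof. by exists 0; [rewrite dom0|rewrite (addm0 (@Pi_projD I))]. Qed.

Lemma hdeg_PiD n x y : hdeg n x -> hdeg n y -> hdeg n (x + y).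
Proof.
move=> [u hu ->] [v hv ->]; exists (u + v); last by rewrite (@Pi_projD I).
by move=> e /domD_subset; rewrite mem_cat => /orP[/hu|/hv].
Qed.

Lemma hdeg_PiN n x : hdeg n x -> hdeg n (- x).
Proof.
move=> [u hu ->]; exists (- u); last by rewrite (addmN (@Pi_projD I)).
by move=> e; rewrite domN => /hu.
Qed.

Definition wdegree_part n (s : word I) : Pi_car I := if (wdim s)%:Z == n then Pi_mono s else 0.

Lemma wdegree_part_anti n : anti (wdegree_part n).
Proof.
move=> s s' h; rewrite /wdegree_part (Pi_mono_anti h).
have -> : wdim s = wdim s'.
  rewrite /wdim; elim: h => [u a b v t|c {}s {}s' h IH]; rewrite !big_cons ?IH //.
  by rewrite /bdim !size_cat.
by case: ifP => // _; rewrite oppr0.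
Qed.

Definition degree_part n (x : Pi_car I) : Pi_car I := Pi_lift (wdegree_part n) x.

Lemma degree_partD n : addm (degree_part n).
Proof. exact: (Pi_liftD (@wdegree_part_anti n)). Qed.

Lemma degree_part_hdeg m n x : @hdeg (Pi I) m x -> degree_part n x = if m == n then x else 0.
Proof.
move: x; apply: hdeg_Pi_ind.
- by rewrite (addm0 (@degree_partD n)) if_same.
- by move=> x y hx hy; rewrite degree_partD hx hy; case: ifP; rewrite ?addr0.
- by move=> x hx; rewrite (addmN (@degree_partD n)) hx; case: ifP; rewrite ?oppr0.
by move=> s es <-; rewrite /degree_part (Pi_lift_mono (@wdegree_part_anti n)).
Qed.

Lemma hdeg_degree_part n x : @hdeg (Pi I) n (degree_part n x).
Proof.
move: x; apply: Pi_ind.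
- by rewrite (addm0 (@degree_partD n)); exact: hdeg_Pi0.
- by move=> x y hx hy; rewrite degree_partD; apply: hdeg_PiD.
- by move=> x hx; rewrite (addmN (@degree_partD n)); apply: hdeg_PiN.
move=> s es; rewrite /degree_part (Pi_lift_mono (@wdegree_part_anti n)) // /wdegree_part.
by case: eqP => // [h|_]; [apply: hdeg_Pi_mono|exact: hdeg_Pi0].
Qed.

Lemma Pi_span x : exists (s : seq int) (f : int -> Pi I),
  [/\ uniq s, forall n, hdeg n (f n) & x = \sum_(n <- s) f n].
Proof.
pose s := [seq k%:Z | k <- index_iota 0 #|I|.+1].
exists s, (fun n => degree_part n x); split.
- by rewrite map_inj_uniq ?iota_uniq // => a b [].
- by move=> n; exact: hdeg_degree_part.
move: x; apply: Pi_ext => // [x y|w ew].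
  by rewrite -big_split; apply: eq_bigr => n _; exact: degree_partD.
transitivity (\sum_(n <- s) if n == (wdim w)%:Z then Pi_mono w else 0); last first.
  by apply: eq_bigr => n _; rewrite /degree_part (Pi_lift_mono (@wdegree_part_anti n)) // /wdegree_part eq_sym.
rewrite -big_mkcond big_map big_mkcond /=.
rewrite (eq_bigr (fun k : nat => if k == wdim w then Pi_mono w else 0)) //.
by rewrite -big_mkcond big_nat1_eq ltnS -(expr_wdim ew) leq_addr.
Qed.

Lemma Pi_direct (s : seq int) (f : int -> Pi I) : uniq s -> (forall n, hdeg n (f n)) ->
  \sum_(n <- s) f n = 0 -> forall n, n \in s -> f n = 0.
Proof.
move=> us hf f0 n ns; have := congr1 (degree_part n) f0.
rewrite (addm_sum (@degree_partD n)) (addm0 (@degree_partD n)) => <-.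
rewrite (bigD1_seq n) //= (degree_part_hdeg n (hf n)) eqxx big1 ?addr0 // => m /negbTE mn.
by rewrite (degree_part_hdeg n (hf m)) mn.
Qed.
End Degree.

(** * The operations of Pi on words *)

Section Merge.
Variable I : finType.
Implicit Types (s : word I).

Definition wmerge j s : word I :=
  take j s ++ (nth [::] s j ++ nth [::] s j.+1) :: drop j.+2 s.

Lemma wmergeS a j s : wmerge j.+1 (a :: s) = a :: wmerge j s.
Proof. by []. Qed.

Lemma wmerge_expr j s : (j.+1 < size s)%N -> is_expr s -> is_expr (wmerge j s).
Proof.
move=> js; have -> : is_expr s = is_expr (take j s ++ nth [::] s j :: nth [::] s j.+1 :: drop j.+2 s).
  by rewrite -!drop_nth ?cat_take_drop // ltnW.
rewrite /is_expr /wmerge !flatten_cat /= -catA; case/andP => + ->; rewrite andbT.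
rewrite !mem_cat !inE !negb_or => /and4P[-> + _ ->]; rewrite andbT.
by case: (nth _ _ j).
Qed.

Lemma wmerge_size j s : (j.+1 < size s)%N -> (size (wmerge j s)).+1 = size s.
Proof.
move=> js; rewrite /wmerge size_cat /= size_take size_drop (ltn_trans (ltnSn j) js).
by rewrite addnS -!addSn subnKC.
Qed.

Lemma wD_sum s : [::] \notin s ->
  wD s = \sum_(0 <= j < (size s).-1) sg (odd (wdim (take j.+1 s))) (wd (wmerge j s)).
Proof.
elim: s => [|a [|b s] IH] /=; first by rewrite big_nil.
  by rewrite big_nil wedge1 bcons0 addr0 sg0.
rewrite -/(wD (b :: s)) in_cons negb_or => /andP[a0 s0].
have wa t : odd (wdim (a :: t)) = bpar a (+) odd (wdim t).
  rewrite /wdim big_cons oddD; congr (_ (+) _); rewrite /bdim /bpar.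
  by case: a a0 => //= x a _; rewrite negbK.
rewrite big_nat_recl // sgD -bconsE wedge_bcons bconsE; congr (_ + _).
  by rewrite wa take0 /wdim big_nil addbF /wmerge /= drop0.
rewrite (IH s0) (addm_sum (@bconsD _ a)) (addm_sum (@sgD _ _)) /=; apply: eq_bigr => j _.
by rewrite wmergeS bcons_sg bconsE sgsg -wa.
Qed.
End Merge.

Section Diff.
Variable I : nfset.
Implicit Types (x : Pi I).

Lemma wemb_diff x : wemb (diff x) = kD (wemb x).
Proof.
rewrite wemb_proj (linext_comp _ (@linextD _ _ _)) /wemb (linext_comp _ (@kDD _)).
apply: eq_linext_dom => e _ /=; rewrite kDE; have ee := valP e.
rewrite /wdiff (addm_sum (@linextD _ _ _)) wD_sum; last by case/andP: ee.
apply: eq_big_nat => j /andP[_ jl]; rewrite mulz_sign (addm_sg (@linextD _ _ _)).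
by congr sg; rewrite (linext_mono wd) wmerge_expr // -ltn_predRL.
Qed.

Lemma Pi_diffD : addm (@diff (Pi I)).
Proof. by move=> x y; apply: wemb_inj; rewrite wembD !wemb_diff wembD kDD. Qed.

Lemma Pi_diff_mono s : is_expr s -> diff (Pi_mono s : Pi I) = Pi_proj (wdiff s).
Proof.
move=> es; apply: wemb_inj; rewrite wemb_diff wemb_mono // wemb_proj.
rewrite kDE /wdiff (addm_sum (@linextD _ _ _)) wD_sum; last by case/andP: es.
apply: eq_big_nat => j /andP[_ jl]; rewrite mulz_sign (addm_sg (@linextD _ _ _)).
by congr sg; rewrite (linext_mono wd) wmerge_expr // -ltn_predRL.
Qed.
End Diff.

Section Act.
Variables (I J : nfset) (f : bij I J).

Lemma wmap_expr s : is_expr s -> is_expr (wmap f s).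
Proof.
have finj := bij_inj (bfunP f); have [g fK gK] := bfunP f.
move=> es; have fs : flatten (wmap f s) = map f (flatten s) by rewrite -map_flatten.
apply: exprP; rewrite ?fs.
- by case/andP: es => + _; apply: contra => /mapP[[|a b] bs].
- by rewrite map_inj_uniq // expr_uniq.
- by move=> y; rewrite -(gK y) map_f // expr_mem.
Qed.

Lemma wemb_act (x : Pi I) : wemb (oact f x) = kmap f (wemb x).
Proof.
rewrite wemb_proj (linext_comp _ (@linextD _ _ _)) /wemb (linext_comp _ (@kmapD _ _ _)).
apply: eq_linext => e /=; rewrite kmapE (linext_mono wd).
by have := wmap_expr (valP e); rewrite /wmap => ->.
Qed.

Lemma Pi_act_mono s : is_expr s -> oact f (Pi_mono s : Pi I) = Pi_mono (wmap f s).
Proof. by move=> es; apply: wemb_inj; rewrite wemb_act !wemb_mono ?kmapE // wmap_expr. Qed.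

Lemma Pi_actD : addm (@oact Pi I J f).
Proof. by move=> x y; apply: wemb_inj; rewrite wembD !wemb_act wembD kmapD. Qed.
End Act.

Section Shuffles.
Variable Z : choiceType.
Implicit Types (A B : word Z).

Lemma shuffles_cons (X : Type) (a b : seq X) (A' B' : seq (seq X)) : shuffles (a :: A') (b :: B') =
  [seq (w.1, a :: w.2) | w <- shuffles A' (b :: B')]
  ++ [seq ((w.1 + bdim b * wdim (a :: A'))%N, b :: w.2) | w <- shuffles (a :: A') B'].
Proof. by []. Qed.

Lemma shuffles_perm A B w : w \in shuffles A B -> perm_eq w.2 (A ++ B).
Proof.
elim: A B w => [|a A IHA] B w; first by rewrite inE => /eqP ->.
elim: B w => [|b B IHB] w; first by rewrite inE => /eqP -> /=; rewrite cats0.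
rewrite shuffles_cons mem_cat => /orP[] /mapP[v vs ->] /=.
  by rewrite perm_cons; exact: IHA.
rewrite -[b :: v.2]/([:: b] ++ v.2) -[a :: (A ++ b :: B)]/((a :: A) ++ [:: b] ++ B).
by rewrite perm_sym perm_catCA perm_cat2l perm_sym; exact: IHB.
Qed.

Lemma odd_bdim (b : seq Z) : b != [::] -> odd (bdim b) = bpar b.
Proof. by rewrite /bdim /bpar; case: b => //= a b _; rewrite negbK. Qed.

Lemma odd_wdim A : [::] \notin A -> odd (wdim A) = wpar A.
Proof.
rewrite /wdim; elim: A => [|b s IH]; first by rewrite big_nil.
by rewrite big_cons inE negb_or eq_sym => /andP[b0 /IH]; rewrite oddD => -> /=; rewrite odd_bdim.
Qed.

Lemma wshuffle_sum A B : [::] \notin A -> [::] \notin B ->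
  wshuffle A B = \sum_(w <- shuffles A B) sg (odd w.1) (wd w.2).
Proof.
elim: A B => [|a A IHA] B A0; first by rewrite big_seq1 sg_false.
elim: B => [|b B IHB] B0; first by rewrite big_seq1 sg_false.
rewrite wshuffle_cons shuffles_cons big_cat !big_map.
move: (A0) (B0); rewrite !inE !negb_or => /andP[a0 A0'] /andP[b0 B0'].
rewrite IHA // IHB //; congr (_ + _).
  by rewrite (addm_sum (@bconsD _ a)); apply: eq_bigr => w _; rewrite bcons_sg bconsE.
rewrite (addm_sum (@bconsD _ b)) (addm_sum (@sgD _ _)); apply: eq_bigr => w _.
rewrite bcons_sg bconsE sgsg oddD oddM odd_bdim ?[b == _]eq_sym // odd_wdim //.
by rewrite addbC.
Qed.
End Shuffles.

Section Comp.
Variables (I : nfset) (i : I) (J : nfset).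

Definition nfset_default (K : nfset) : K := enum_val (Ordinal (nfset_gt0 K)).

(** The inclusion of I \ {i} in the grafted set, made total by a default value at i so
    that it acts on words; [sub_ext] discards this value. *)
Definition ginl (x : I) : graft i J :=
  if insub x is Some x' then inl (x' : {x : I | x != i}) else inr (nfset_default J).
Definition ginr (y : J) : graft i J := inr y.

Lemma ginlE x (h : x != i) : ginl x = inl (Sub x h).
Proof. by rewrite /ginl insubT. Qed.

Lemma ginl_val (x : {x : I | x != i}) : ginl (val x) = inl x.
Proof. by rewrite /ginl valK. Qed.

Lemma ginl_neq x j : x != i -> ginl x != ginr j.
Proof. by move=> h; rewrite ginlE. Qed.

Lemma ginl_inj x k : k != i -> ginl x = ginl k -> x = k.
Proof.
move=> ki; rewrite (ginlE ki) /ginl; case: insubP => // x' _ xx' [e].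
by rewrite -xx' e.
Qed.

Lemma ginr_inj : injective ginr. Proof. by move=> x y []. Qed.

Lemma inl_blockE b : inl_block i J b = map ginl (filter (predC1 i) b).
Proof.
rewrite /inl_block; elim: b => //= x b IH; case: insubP => [x' xi xx'|] /=.
  by rewrite xi /= -IH -xx' ginl_val.
by rewrite negbK => /eqP ->; rewrite eqxx.
Qed.

Lemma filter_notin b : i \notin b -> filter (predC1 i) b = b.
Proof. by move=> ib; apply/all_filterP/allP => x xb /=; apply: contraNneq ib => <-. Qed.

Lemma inl_block_notin b : i \notin b -> inl_block i J b = map ginl b.
Proof. by move=> ib; rewrite inl_blockE filter_notin. Qed.

Lemma map_inl_block s : i \notin flatten s -> map (inl_block i J) s = wmap ginl s.
Proof.
move=> h; apply/eq_in_map => b bs; apply: inl_block_notin; apply: contra h => ib.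
by apply/flattenP; exists b.
Qed.

Lemma graft_expr s1 b s2 c t w : is_expr (s1 ++ b :: s2) -> is_expr (c :: t) ->
  i \in b -> perm_eq w (wmap ginl s2 ++ wmap ginr t) ->
  is_expr (wmap ginl s1 ++ (inl_block i J b ++ map ginr c) :: w).
Proof.
move=> es et ib pw; have us := expr_uniq es.
pose L := map ginl (filter (predC1 i) (flatten (s1 ++ b :: s2))) ++ map ginr (flatten (c :: t)).
have [is1 is2] : i \notin flatten s1 /\ i \notin flatten s2.
  move: us; rewrite flatten_cat /= catA cat_uniq => /and3P[+ /hasPn h _].
  rewrite cat_uniq => /and3P[_ /hasPn h' _]; split.
    by have := h' _ ib; rewrite /= => ->.
  by apply/negP => /h; rewrite /= mem_cat ib orbT.
have pL : perm_eq (flatten (wmap ginl s1 ++ (inl_block i J b ++ map ginr c) :: w)) L.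
  rewrite /L !flatten_cat /= !filter_cat !(filter_notin is1) !(filter_notin is2).
  rewrite !map_cat -map_flatten -!catA perm_cat2l inl_blockE perm_cat2l.
  rewrite perm_sym perm_catCA perm_cat2l perm_sym.
  by rewrite (perm_trans (perm_flatten pw)) // flatten_cat -!map_flatten.
have uL : uniq L.
  rewrite cat_uniq map_inj_in_uniq ?filter_uniq //=; last first.
    by move=> x y _; rewrite mem_filter => /andP[yi _]; apply: ginl_inj.
  rewrite map_inj_uniq ?(expr_uniq et) ?andbT; last exact: ginr_inj.
  apply/hasPn => _ /mapP[y _ ->] /=; apply/mapP => -[x].
  by rewrite mem_filter => /andP[xi _] /esym/eqP; rewrite (negbTE (ginl_neq y xi)).
have c0 : c != [::] by case/andP: et; case: (c).
apply: exprP.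
- rewrite mem_cat inE !negb_or (perm_mem pw) mem_cat negb_or.
  have mapN (X Y : eqType) (f : X -> Y) (r : seq (seq X)) : [::] \notin r -> [::] \notin map (map f) r.
    by apply: contra => /mapP[[|x a] ar].
  case/andP: es => + _; rewrite mem_cat inE !negb_or => /and3P[s10 _ s20].
  case/andP: et => + _; rewrite inE negb_or => /andP[_ t0].
  rewrite !mapN // andbT andTb; case: (c) c0 => // y c' _.
  by rewrite /= eq_sym -size_eq0 size_cat addnS.
- by rewrite (perm_uniq pL).
move=> z; rewrite (perm_mem pL) mem_cat; case: z => [x|y]; last first.
  by rewrite [X in _ || X](map_f ginr) ?orbT // expr_mem.
by rewrite -ginl_val (map_f ginl) // mem_filter expr_mem // andbT; exact: valP x.
Qed.

Definition wprepend (Z : choiceType) (s : word Z) (x : wmod Z) := foldr (@bcons Z) x s.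

Lemma wprependD (Z : choiceType) (s : word Z) : addm (wprepend s).
Proof. by elim: s => // b s IH x y; rewrite /= IH bconsD. Qed.

Lemma wprependE (Z : choiceType) (s t : word Z) : wprepend s (wd t) = wd (s ++ t).
Proof. by elim: s => //= b s ->; rewrite bconsE. Qed.

Lemma sub_prepend (X Z : choiceType) (f : X -> Z) j s x u : j \notin flatten s ->
  sub f j (wprepend s x) u = wprepend (wmap f s) (sub f j x u).
Proof.
by elim: s => //= b s IH; rewrite mem_cat negb_or => /andP[jb js]; rewrite sub_notin // IH.
Qed.

Lemma expr_split s : is_expr s -> exists s1 b s2,
  [/\ s = s1 ++ b :: s2, i \in b, i \notin flatten s1, i \notin flatten s2 &
   [/\ find (fun b => i \in b) s = size s1, take (size s1) s = s1,
    nth [::] s (size s1) = b & drop (size s1).+1 s = s2]].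
Proof.
move=> es; have hs : has (fun b => i \in b) s.
  by have /flattenP[b bs ib] := expr_mem i es; apply/hasP; exists b.
set l := find (fun b => i \in b) s.
have ls : (l < size s)%N by rewrite -has_find.
have E : s = take l s ++ nth [::] s l :: drop l.+1 s by rewrite -drop_nth // cat_take_drop.
have sl : size (take l s) = l by rewrite size_takel // ltnW.
exists (take l s), (nth [::] s l), (drop l.+1 s).
have ib : i \in nth [::] s l := nth_find [::] hs.
have := expr_uniq es; rewrite [X in flatten X]E flatten_cat /= catA cat_uniq => /and3P[+ /hasPn h _].
rewrite cat_uniq => /and3P[_ /hasPn h' _]; rewrite sl; split => //.
  by have := h' _ ib; rewrite /= => ->.
by apply/negP => /h; rewrite /= mem_cat ib orbT.
Qed.

(** The same list r of signed expressions describes the composition in Pi and the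
    substitution of words; the degree is read off the number of blocks. *)
Lemma wcomp_sum s t : is_expr s -> is_expr t ->
  exists (r : seq (bool * word (graft i J))),
  [/\ Pi_proj (wcomp i s t) = \sum_(w <- r) sg w.1 (Pi_mono w.2),
      {in r, forall w, is_expr w.2 /\ (size w.2).+1 = (size s + size t)%N} &
      sub ginl i (wd s) (wd (wmap ginr t)) = \sum_(w <- r) sg w.1 (wd w.2)].
Proof.
move=> es et; have [s1 [b [s2 [Es ib is1 is2 [El E1 Eb E2]]]]] := expr_split es.
case: t et => [|c t] et.
  by have := expr_mem (nfset_default J) et.
rewrite /wcomp El E1 Eb E2 /= !map_inl_block //.
pose K w := wmap ginl s1 ++ (inl_block i J b ++ map ginr c) :: w.
pose e := odd (size b - (index i b).+1 + bdim c * wdim s2)%N.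
exists [seq (e (+) odd w.1, K w.2) | w <- shuffles (wmap ginl s2) (wmap ginr t)].
split.
- rewrite (addm_sum (@Pi_projD _)) big_map; apply: eq_bigr => w _.
  rewrite mulz_sign (addm_sg (@Pi_projD _)); congr (sg _ _).
  rewrite oddD; congr (odd (_ + _ * _) (+) _).
  - by rewrite /bdim size_map.
  - by rewrite /wdim big_map; apply: eq_bigr => a _; rewrite /bdim size_map.
- move=> _ /mapP[w /shuffles_perm pw ->] /=; rewrite Es in es; split.
    exact: (graft_expr es et ib pw).
  by rewrite Es /K !size_cat /= (perm_size pw) size_cat !size_map !addnS ?addSn addnA.
move: es; rewrite Es => es; case: (sub_case i b) => [|[p [q [Epq ip iq]]]|]; first by rewrite ib.
  have us := expr_uniq es.
  rewrite -wprependE -bconsE sub_prepend // Epq sub_in // -bconsE shr_bcons wedge_bcons.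
  rewrite kmapE sigE sh_sgl shE bcons_sg sgsg (addm_sg (@wprependD _ _)) wshuffle_sum.
  - rewrite (addm_sum (@bconsD _ _)) (addm_sum (@wprependD _ _)) (addm_sum (@sgD _ _)) big_map.
    apply: eq_bigr => w _; rewrite bcons_sg (addm_sg (@wprependD _ _)) sgsg bconsE wprependE.
    rewrite /K inl_blockE Epq filter_predC1 //; congr (sg (_ (+) _) _).
    rewrite /e Epq -[odd (size q)](esgnE _ ip) oddD -/(esgn i (p ++ i :: q)).
    rewrite oddM odd_bdim ?odd_wdim ?wpar_map ?bpar_map //.
      by case/andP: es => + _; rewrite mem_cat inE !negb_or => /and3P[].
    by case/andP: et => + _; rewrite inE negb_or eq_sym => /andP[].
  - case/andP: es => + _; rewrite mem_cat inE !negb_or => /and3P[_ _]; apply: contra.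
    by move=> /mapP[[|x a] ar].
  - case/andP: et => + _; rewrite inE negb_or => /andP[_]; apply: contra.
    by move=> /mapP[[|x a] ar].
have := expr_uniq es; rewrite flatten_cat /= catA cat_uniq => /and3P[+ _ _].
by rewrite cat_uniq => /and3P[_ _ ub]; rewrite count_uniq_mem // ib.
Qed.

Lemma wemb_comp (x : Pi I) (y : Pi J) :
  wemb (ocomp i x y) = sub ginl i (wemb x) (kmap ginr (wemb y)).
Proof.
rewrite wemb_proj (linext_comp _ (@linextD _ _ _)) /wemb (linext_comp _ (@subDl _ _ _ _ _)).
apply: eq_linext => e; rewrite /= (linext_comp _ (@linextD _ _ _)) (linext_comp _ (@kmapD _ _ _)).
rewrite (linext_comp _ (@subDr _ _ _ _ _)); apply: eq_linext => e' /=.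
rewrite kmapE; have [r [E1 E2 ->]] := wcomp_sum (valP e) (valP e').
rewrite -wemb_proj E1 (addm_sum (@wembD _)) !big_seq; apply: eq_bigr => w /E2[ew _].
by rewrite (addm_sg (@wembD _)) wemb_mono.
Qed.

Lemma Pi_comp_mono s t : is_expr s -> is_expr t ->
  ocomp i (Pi_mono s : Pi I) (Pi_mono t : Pi J) = Pi_proj (wcomp i s t).
Proof.
move=> es et; apply: wemb_inj; rewrite wemb_comp !wemb_mono // kmapE.
have [r [E1 E2 ->]] := wcomp_sum es et.
rewrite E1 (addm_sum (@wembD _)) !big_seq; apply: eq_bigr => w /E2[ew _].
by rewrite (addm_sg (@wembD _)) wemb_mono.
Qed.
End Comp.

(** * Pi is an operad *)

Section PiComp.
Variables (I : nfset) (i : I) (J : nfset).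

Lemma Pi_compDl (y : Pi J) : addm (fun x : Pi I => ocomp i x y).
Proof. by move=> x x'; apply: wemb_inj; rewrite wembD !wemb_comp wembD subDl. Qed.

Lemma Pi_compDr (x : Pi I) : addm (fun y : Pi J => ocomp i x y).
Proof. by move=> y y'; apply: wemb_inj; rewrite wembD !wemb_comp wembD kmapD subDr. Qed.

Lemma card_graft : (#|graft i J|.+1 = #|I| + #|J|)%N.
Proof.
rewrite card_sum card_sig -addSn; congr (_ + _)%N.
rewrite [in RHS](cardD1 i) add1n; congr S.
by apply: eq_card => x; rewrite !inE andbT.
Qed.

Lemma Pi_comp_hdeg m n (x : Pi I) (y : Pi J) :
  hdeg m x -> hdeg n y -> hdeg (m + n) (ocomp i x y).
Proof.
move=> + hy; move: x; apply: hdeg_Pi_ind.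
- by rewrite (addm0 (@Pi_compDl y)); exact: hdeg_Pi0.
- by move=> x x' hx hx'; rewrite (@Pi_compDl y); apply: hdeg_PiD.
- by move=> x hx; rewrite (addmN (@Pi_compDl y)); apply: hdeg_PiN.
move=> s es ws; move: y hy; apply: hdeg_Pi_ind.
- by rewrite (addm0 (@Pi_compDr _)); exact: hdeg_Pi0.
- by move=> y y' hy hy'; rewrite (@Pi_compDr _); apply: hdeg_PiD.
- by move=> y hy; rewrite (addmN (@Pi_compDr _)); apply: hdeg_PiN.
move=> t et wt; rewrite Pi_comp_mono //.
have [r [-> Er _]] := wcomp_sum i es et.
rewrite big_seq; apply: big_ind; [exact: hdeg_Pi0|exact: hdeg_PiD|].
move=> w /Er[ew sw].
have h : hdeg (m + n) (Pi_mono w.2 : Pi (graft i J)).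
  apply: hdeg_Pi_mono => _; rewrite -ws -wt -PoszD; congr Posz.
  have := expr_wdim ew; have := expr_wdim es; have := expr_wdim et.
  move: card_graft sw; rewrite /=.
  move: (size w.2) (size s) (size t) (wdim w.2) (wdim s) (wdim t) => a b c d e f.
  move: #|{: graft i J}| #|I| #|J| => A B C; lia.
by case: w.1; rewrite ?sg_false ?sg_true //; apply: hdeg_PiN.
Qed.

(** Relates the signs of the operad axioms, given by degrees, to the involution, which
    gives those of the identities between words. *)
Lemma wemb_hdeg m (x : Pi I) : hdeg m x -> forall k, sig k (wemb x) = sg (k && odd `|m|) (wemb x).
Proof.
move=> hx k; move: x hx; apply: hdeg_Pi_ind.
- by rewrite (addm0 (@wembD _)) sig0 sg0.
- by move=> x y hx hy; rewrite wembD sigD hx hy sgD.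
- by move=> x hx; rewrite (addmN (@wembD _)) sigN hx sgN.
move=> s es <-; rewrite wemb_mono // sigE; congr (sg (_ && _) _).
by rewrite /= odd_wdim //; case/andP: es.
Qed.

Lemma Pi_comp_diff m (x : Pi I) (y : Pi J) : hdeg m x ->
  diff (ocomp i x y) = ocomp i (diff x) y + ocomp i x (diff y) *~ sgnz m.
Proof.
move=> hx; apply: wemb_inj; rewrite wemb_diff wembD mulz_sgnz (addm_sg (@wembD _)).
rewrite !wemb_comp !wemb_diff -sub_sgl kmap_kD.
have := wemb_hdeg hx true; rewrite /= => <-.
move: x hx; apply: hdeg_Pi_ind.
- by rewrite (addm0 (@wembD _)) kD0 sig0 !sub_0l kD0 addr0.
- by move=> x x' Hx Hx'; rewrite wembD kDD sigD !subDl kDD Hx Hx' addrACA.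
- by move=> x Hx; rewrite (addmN (@wembD _)) kDN sigN !subNl kDN Hx opprD.
by move=> s es _; rewrite wemb_mono //; apply: kD_sub; apply: expr_uniq.
Qed.
End PiComp.

Lemma Pi_comp_act (I I' J J' : nfset) (f : bij I I') (g : bij J J') (i : I)
    (x : Pi I) (y : Pi J) :
  ocomp (f i) (oact f x) (oact g y) = oact (graft_map f g i) (ocomp i x y).
Proof.
apply: wemb_inj; rewrite wemb_comp !wemb_act wemb_comp kmap_sub !kmap_comp.
have finj := bij_inj (bfunP f); rewrite sub_kmap; last by move=> x' /finj.
move: x; apply: Pi_ext => [x x'|x x'|s es].
- by rewrite wembD subDl.
- by rewrite wembD subDl.
rewrite wemb_mono //; apply: sub_ext; first exact: expr_uniq.
move=> a _ ai; have fai : f a != f i by rewrite (inj_eq finj).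
by rewrite /= (ginlE J ai) (ginlE J' fai) /=; congr inl; apply: val_inj.
Qed.

Lemma Pi_comp_seq (I J K : nfset) (i : I) (j : J) (x : Pi I) (y : Pi J) (z : Pi K) :
  oact (seq_assoc K i j) (ocomp (inr j : graft i J) (ocomp i x y) z)
  = ocomp i x (ocomp j y z).
Proof.
apply: wemb_inj; rewrite wemb_act !wemb_comp !kmap_sub !kmap_comp.
move: x; apply: Pi_ext => [x x'|x x'|s es]; rewrite ?wembD ?subDl // wemb_mono //.
rewrite -[inr j]/(ginr i j) sub_seq; last 3 first.
- exact: expr_uniq.
- by move=> x xi; apply: ginl_neq.
- by move=> a /ginr_inj.
rewrite (@sub_ext _ _ _ (@ginl _ i (graft j K))); last 2 first.
- exact: expr_uniq.
- move=> a _ ai; rewrite /= (ginlE J ai).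
  have := @ginlE _ (ginr i j) K (inl (Sub a ai)) isT; rewrite /ginr => ->; rewrite (ginlE _ ai).
  exact: erefl.
congr (sub _ i _ _); move: y; apply: Pi_ext => [y y'|y y'|t et]; rewrite ?wembD ?subDl // wemb_mono //.
apply: sub_ext; first exact: expr_uniq.
move=> b _ bj; have h : ginr i b != ginr i j by apply: contra bj => /eqP/ginr_inj ->.
have := @ginlE _ (ginr i j) K (inr b) h; rewrite /= /ginr => ->; rewrite (ginlE _ bj).
by congr (inr (inl _)); apply: val_inj.
Qed.

Lemma Pi_comp_par (I J K : nfset) (i k : I) (ik : i != k) m n
    (x : Pi I) (y : Pi J) (z : Pi K) : hdeg m y -> hdeg n z ->
  ocomp (par_left J ik) (ocomp i x y) z
  = oact (par_assoc J K ik) (ocomp (par_right K ik) (ocomp k x z) y) *~ sgnz (m * n).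
Proof.
have ki : k != i by rewrite eq_sym.
move=> hy hz; rewrite mulz_sgnz; apply: wemb_inj.
rewrite (addm_sg (@wembD _)) wemb_act !wemb_comp kmap_sub kmap_comp.
have El : par_left J ik = ginl i J k by rewrite (ginlE _ ki); congr inl; apply: val_inj.
have Er : par_right K ik = ginl k K i by rewrite (ginlE _ ik).
move: x; apply: Pi_ext => [x x'|x x'|s es]; rewrite ?wembD ?subDl ?sgD // wemb_mono //.
move: y hy; apply: hdeg_Pi_ind => [|y y' Hy Hy'|y Hy|t et tm].
- by rewrite !(addm0 (@wembD _)) !(kmap0, sub_0r, sub_0l, sg0).
- by rewrite !wembD !kmapD !subDr subDl Hy Hy' sgD.
- by rewrite !(addmN (@wembD _)) !kmapN !subNr subNl Hy sgN.
move: z hz; apply: hdeg_Pi_ind => [|z z' Hz Hz'|z Hz|u eu un].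
- by rewrite !(addm0 (@wembD _)) !(kmap0, sub_0r, sub_0l, sg0).
- by rewrite !wembD !kmapD !subDr subDl Hz Hz' sgD.
- by rewrite !(addmN (@wembD _)) !kmapN !subNr subNl Hz sgN.
rewrite !wemb_mono // -tm -un.
have -> : odd `|((wdim t)%:Z * (wdim u)%:Z)%R| = wpar (wmap (@ginr I i J) t) && wpar (wmap (@ginr I k K) u).
  rewrite abszM oddM !wpar_map /= !odd_wdim //; [by case/andP: eu|by case/andP: et].
pose F' := par_assoc J K ik \o ginl (par_right K ik) J.
pose F := ginl (par_left J ik) K.
have EL : kmap (@ginr _ (par_left J ik) K) (wd u) = kmap F' (wd (wmap (@ginr I k K) u)).
  by rewrite -kmapE kmap_comp; apply: eq_kmap => c _; rewrite /F' /= (@ginlE (graft k K) (par_right K ik) J (inr c) isT).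
have ER : kmap (par_assoc J K ik \o ginr (par_right K ik) (J:=J)) (wd t)
    = kmap F (wd (wmap (@ginr I i J) t)).
  rewrite -kmapE kmap_comp; apply: eq_kmap => c _; rewrite /F /= (@ginlE (graft i J) (par_left J ik) K (inr c) isT).
  exact: erefl.
rewrite ER EL (kmapE (@ginr I i J)) (kmapE (@ginr I k K)); apply: sub_par_at => //.
- by move=> x; apply: ginl_inj.
- by move=> x; apply: ginl_inj.
- move=> x xi xk; rewrite /F /F' /= (ginlE _ xi) (ginlE _ xk).
  have h1 : inl (Sub x xi) != par_left J ik.
    by rewrite El -(ginlE _ xi); apply: contraNneq (xk) => /(ginl_inj ki) ->.
  have h2 : inl (Sub x xk) != par_right K ik.
    by rewrite Er -(ginlE _ xk); apply: contraNneq (xi) => /(ginl_inj ik) ->.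
  rewrite (@ginlE (graft i J) (par_left J ik) K _ h1) (@ginlE (graft k K) (par_right K ik) J _ h2).
  by congr inl; apply: val_inj; congr inl; apply: val_inj.
- by rewrite -map_flatten; apply/mapP => -[c _]; rewrite /par_left.
- by rewrite -map_flatten; apply/mapP => -[c _]; rewrite /par_right.
- exact: expr_uniq.
Qed.

Lemma Pi_unitl J (y : Pi J) : ocomp (ord0 : fin1) (ounit : Pi fin1) y = oact (graft_unitl J) y.
Proof.
apply: wemb_inj; rewrite wemb_comp wemb_act.
have e1 : is_expr ([:: [:: ord0]] : seq (seq fin1)).
  by apply: exprP => // x; rewrite (ord1 x).
rewrite wemb_mono //; move: y; apply: Pi_ext => [y y'|y y'|t et]; rewrite ?wembD ?kmapD ?subDr //.
rewrite wemb_mono // !kmapE; case: t et => [|b t] et; last exact: sub_unitl.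
by have := expr_mem (nfset_default J) et.
Qed.

Lemma Pi_unitr (I : nfset) (i : I) (x : Pi I) :
  oact (graft_unitr i) (ocomp i x (ounit : Pi fin1)) = x.
Proof.
apply: wemb_inj; rewrite wemb_act wemb_comp kmap_sub kmap_comp.
have e1 : is_expr ([:: [:: ord0]] : seq (seq fin1)).
  by apply: exprP => // y; rewrite (ord1 y).
rewrite wemb_mono // kmapE /=.
move: x; apply: Pi_ext => [x x'|x x'|s es]; rewrite ?wembD ?subDl // wemb_mono //.
rewrite -[RHS](@kmap_id _ id) // -[in LHS]/(id i).
apply: sub_unitr; [exact: expr_uniq|exact: expr_mem|].
by move=> a ai; rewrite /= (ginlE _ ai).
Qed.

Lemma Pi_diff_hdeg (I : nfset) n (x : Pi I) : hdeg n x -> hdeg (n + 1) (diff x).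
Proof.
move: x; apply: hdeg_Pi_ind.
- by rewrite (addm0 (@Pi_diffD I)); exact: hdeg_Pi0.
- by move=> x y hx hy; rewrite Pi_diffD; apply: hdeg_PiD.
- by move=> x hx; rewrite (addmN (@Pi_diffD I)); apply: hdeg_PiN.
move=> s es <-; rewrite Pi_diff_mono // /wdiff (addm_sum (@Pi_projD _)) big_nat_cond.
apply: big_ind; [exact: hdeg_Pi0|exact: hdeg_PiD|] => j /andP[/andP[_ jl] _].
rewrite mulz_sign (addm_sg (@Pi_projD _)).
have h : hdeg ((wdim s)%:Z + 1) (Pi_mono (wmerge j s) : Pi I).
  apply: hdeg_Pi_mono => em; have js : (j.+1 < size s)%N by rewrite -ltn_predRL.
  have := expr_wdim em; have := expr_wdim es; have := wmerge_size js.
  move: (size s) (size (wmerge j s)) (wdim s) (wdim (wmerge j s)) => a b c d; lia.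
by case: (odd _); rewrite ?sg_false ?sg_true //; apply: hdeg_PiN.
Qed.

Lemma Pi_act_hdeg (I J : nfset) (f : bij I J) n (x : Pi I) : hdeg n x -> hdeg n (oact f x).
Proof.
move: x; apply: hdeg_Pi_ind.
- by rewrite (addm0 (@Pi_actD _ _ f)); exact: hdeg_Pi0.
- by move=> x y hx hy; rewrite Pi_actD; apply: hdeg_PiD.
- by move=> x hx; rewrite (addmN (@Pi_actD _ _ f)); apply: hdeg_PiN.
move=> s es <-; rewrite Pi_act_mono //; apply: hdeg_Pi_mono => _; congr Posz.
by rewrite /wdim big_map; apply: eq_bigr => b _; rewrite /bdim size_map.
Qed.

Lemma Pi_is_operad : is_operad Pi.
Proof.
have e1 : is_expr ([:: [:: ord0]] : seq (seq fin1)).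
  by apply: exprP => // x; rewrite (ord1 x).
split.
- move=> I; split.
  + exact: hdeg_Pi0.
  + by move=> n x y hx hy; apply: hdeg_PiD => //; apply: hdeg_PiN.
  + exact: Pi_span.
  + exact: Pi_direct.
  + exact: Pi_diffD.
  + exact: Pi_diff_hdeg.
  + by move=> x; apply: wemb_inj; rewrite !wemb_diff kDK (addm0 (@wembD _)).
- move=> I J f; split.
  + exact: Pi_actD.
  + exact: Pi_act_hdeg.
  + by move=> x; apply: wemb_inj; rewrite wemb_act !wemb_diff wemb_act kmap_kD.
- by move=> I f x fid; apply: wemb_inj; rewrite wemb_act kmap_id.
- move=> I J K f g h x hfg; apply: wemb_inj; rewrite !wemb_act kmap_comp.
  exact: eq_kmap1.
- by apply: hdeg_Pi_mono => _; rewrite /wdim big_seq1.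
- by apply: wemb_inj; rewrite wemb_diff wemb_mono // (addm0 (@wembD _)) kDE /= wedge1 bcons0 addr0 sg0.
- by move=> I i J x x' y; exact: Pi_compDl.
- by move=> I i J x y y'; exact: Pi_compDr.
- exact: Pi_comp_hdeg.
- exact: Pi_comp_diff.
- exact: Pi_comp_act.
- exact: Pi_comp_seq.
- exact: Pi_comp_par.
- exact: Pi_unitl.
- exact: Pi_unitr.
Qed.

(** * The basis of Pi({1,2}) *)

Lemma fin2P (x : fin2) : x = lab1 \/ x = lab2.
Proof. by case: x => -[|[|n]] h //; [left|right]; apply: val_inj. Qed.

Lemma expr2P s : @is_expr fin2 s ->
  [\/ s = [:: [:: lab1]; [:: lab2]], s = [:: [:: lab2]; [:: lab1]],
      s = [:: [:: lab1; lab2]] | s = [:: [:: lab2; lab1]]].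
Proof.
move=> es; have us := expr_uniq es.
have sz : size (flatten s) = 2%N.
  by case/andP: (es) => _ /perm_size ->; rewrite -cardE card_ord.
case/andP: es => s0 _; move: s0 us sz.
case: s => [|[|a [|b [|? ?]]] [|[|c [|? ?]] [|[|? ?] ?]]] //=; rewrite ?inE ?orbT //.
- rewrite andbT => _ ab _.
  case: (fin2P a) (fin2P c) ab => -> [->|->]; rewrite ?eqxx // => _; by [constructor 1|constructor 2].
- rewrite andbT => _ ab _.
  case: (fin2P a) (fin2P b) ab => -> [->|->]; rewrite ?eqxx // => _; by [constructor 3|constructor 4].
Qed.

(** [coefT] and [coefW] are the coordinates on Pi({1,2}); as antisymmetric functions of all
    words they extend to Pi by [Pi_lift]. *)
Definition coefT (a b : fin2) (s : word fin2) : int := (s == [:: [:: a]; [:: b]])%:R.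

Lemma coefT_anti a b : anti (coefT a b).
Proof.
have h s s' : swapped s s' -> has (fun c => 1 < size c)%N s && has (fun c => 1 < size c)%N s'.
  by elim=> [u p q v t|c {}s {}s' _ /andP[e e']] /=; rewrite ?size_cat /= ?addnS ?e ?e' ?orbT.
by move=> s s' /h/andP[e e']; rewrite /coefT; case: eqP e e' => [->|_] //; case: eqP => [->|_].
Qed.

Definition coefW (s : word fin2) : int :=
  if s is [:: [:: a; b]] then (a < b)%N%:R - (b < a)%N%:R else 0.

Lemma coefW_anti : anti coefW.
Proof.
move=> s s' [u p q v t|c {}s {}s' h].
  case: t => [|c t]; last by case: u => [|? [|? [|? ?]]]; case: v => [|? ?].
  case: u => [|x [|y [|z u]]]; case: v => [|w v] //=; by rewrite opprB.
have: s != [::] /\ s' != [::] by case: h.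
by case: s s' {h} => [|b s] [|b' s'] [] //= _ _; case: c => [|? [|? [|? ?]]].
Qed.

Lemma is_expr_t12 : is_expr ([:: [:: lab1]; [:: lab2]] : word fin2).
Proof. by apply: exprP => // x; case: (fin2P x) => ->. Qed.
Lemma is_expr_t21 : is_expr ([:: [:: lab2]; [:: lab1]] : word fin2).
Proof. by apply: exprP => // x; case: (fin2P x) => ->. Qed.
Lemma is_expr_w12 : is_expr ([:: [:: lab1; lab2]] : word fin2).
Proof. by apply: exprP => // x; case: (fin2P x) => ->. Qed.

Lemma hdeg_t12 : hdeg 0 t12.
Proof. by apply: hdeg_Pi_mono => _; rewrite /wdim !big_cons big_nil. Qed.
Lemma hdeg_t21 : hdeg 0 t21.
Proof. by apply: hdeg_Pi_mono => _; rewrite /wdim !big_cons big_nil. Qed.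
Lemma hdeg_w12 : hdeg 1 w12.
Proof. by apply: hdeg_Pi_mono => _; rewrite /wdim !big_cons big_nil. Qed.

Lemma w21E : w21 = - w12.
Proof. exact: (Pi_mono_anti (@swap_head _ [::] _ _ [::] [::])). Qed.

Lemma Pi2_span (x : Pi fin2) : exists c : int * int * int,
  x = t12 *~ c.1.1 + t21 *~ c.1.2 + w12 *~ c.2.
Proof.
move: x; apply: Pi_ind.
- by exists (0, 0, 0); rewrite /= !mulr0z !addr0.
- move=> _ _ [[[a b] c] ->] [[[a' b'] c'] ->]; exists (a + a', b + b', c + c') => /=.
  move: t12 t21 w12 => p q r; by rewrite !mulrzDr addrACA; congr (_ + _); rewrite addrACA.
- move=> _ [[[a b] c] ->]; exists (- a, - b, - c) => /=.
  by move: t12 t21 w12 => p q r; rewrite !mulrNz -!opprD.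
move=> s /expr2P[] ->.
- by exists (1, 0, 0); rewrite /= mulr1z !mulr0z !addr0.
- by exists (0, 1, 0); rewrite /= mulr1z !mulr0z addr0 add0r.
- by exists (0, 0, 1); rewrite /= mulr1z !mulr0z !add0r.
- by exists (0, 0, -1); rewrite /= mulrNz mulr1z !mulr0z !add0r -w21E.
Qed.

Lemma Pi2_basisP : Pi2_basis.
Proof.
split; [exact: hdeg_t12|exact: hdeg_t21|exact: hdeg_w12|by rewrite w21E opprK|].
move=> x; have [c xc] := Pi2_span x; exists c; split=> // c' xc'.
pose val phi := (@Pi_lift fin2 int phi x).
have get phi (pA : anti phi) d : x = t12 *~ d.1.1 + t21 *~ d.1.2 + w12 *~ d.2 ->
    val phi = phi [:: [:: lab1]; [:: lab2]] * d.1.1 + phi [:: [:: lab2]; [:: lab1]] * d.1.2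
      + phi [:: [:: lab1; lab2]] * d.2.
  move=> E; rewrite /val [in LHS]E !(Pi_liftD pA) !(addmMz (Pi_liftD pA)).
  rewrite !(Pi_lift_mono pA) ?is_expr_t12 ?is_expr_t21 ?is_expr_w12 //.
  by rewrite !mulrzz.
have := get _ (@coefT_anti lab1 lab2) _ xc; rewrite (get _ (@coefT_anti lab1 lab2) _ xc').
have := get _ (@coefT_anti lab2 lab1) _ xc; rewrite (get _ (@coefT_anti lab2 lab1) _ xc').
have := get _ coefW_anti _ xc; rewrite (get _ coefW_anti _ xc').
rewrite /coefT /coefW /= !subr0 ?(mul1r, mul0r, add0r, addr0).
by case: c c' {xc xc'} => [[a b] e] [[a' b'] e'] /= -> -> ->.
Qed.

(** * Free operads *)

Section Bijections.

Definition bij_id (I : nfset) : bij I I := Bij (Bijective (fun=> erefl) (fun=> erefl) : bijective (@id I)).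

Definition bij_cmp (I J K : nfset) (g : bij J K) (f : bij I J) : bij I K :=
  Bij (bij_comp (bfunP g) (bfunP f)).

Lemma bij_inv_ex (I J : nfset) (f : bij I J) : exists g : bij J I, cancel f g /\ cancel g f.
Proof. by have [g fK gK] := bfunP f; exists (Bij (Bijective gK fK)). Qed.

Definition bij_inv (I J : nfset) (f : bij I J) : bij J I := sval (cid (bij_inv_ex f)).

Lemma bij_invK (I J : nfset) (f : bij I J) : cancel f (bij_inv f).
Proof. by case: (svalP (cid (bij_inv_ex f))). Qed.

Lemma bij_invKV (I J : nfset) (f : bij I J) : cancel (bij_inv f) f.
Proof. by case: (svalP (cid (bij_inv_ex f))). Qed.

Lemma bij_std_ex (I : nfset) : exists n (f : bij I (nset n)), true.
Proof.
have h : (#|I|.-1.+1 = #|I|)%N by rewrite prednK // nfset_gt0.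
have b : bijective (fun x : I => cast_ord (esym h) (enum_rank x)).
  exists (fun k => enum_val (cast_ord h k)) => x; first by rewrite cast_ordKV enum_rankK.
  by rewrite enum_valK cast_ordK.
by exists #|I|.-1, (@Bij I (nset #|I|.-1) _ b).
Qed.

End Bijections.

Section OperadLemmas.
Variables (P : operad) (hP : is_operad P).

Lemma actD (I J : nfset) (f : bij I J) : addm (@oact P I J f).
Proof. exact: cmorphD (act_cmorphism hP f). Qed.

Lemma diffA (I : nfset) : addm (@diff (P I)).
Proof. exact: diffD (operad_complex hP I). Qed.

Lemma act1 (I : nfset) (x : P I) : oact (bij_id I) x = x.
Proof. exact: act_id. Qed.

Lemma actM (I J K : nfset) (g : bij J K) (f : bij I J) (x : P I) :
  oact g (oact f x) = oact (bij_cmp g f) x.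
Proof. by rewrite -(act_comp hP (h := bij_cmp g f)). Qed.

Lemma eq_act (I J : nfset) (f g : bij I J) (x : P I) : f =1 g -> oact f x = oact g x.
Proof. by move=> fg; rewrite (act_comp hP (f := f) (g := bij_id J) (h := g)) ?act1 // => a; rewrite /= fg. Qed.

Lemma actK (I J : nfset) (f : bij I J) (x : P I) : oact (bij_inv f) (oact f x) = x.
Proof. by rewrite actM; apply: (act_id hP) => a; exact: bij_invK. Qed.

Lemma compAl (I : nfset) (i : I) J (y : P J) : addm (fun x : P I => ocomp i x y).
Proof. by move=> x x'; exact: compDl. Qed.

Lemma compAr (I : nfset) (i : I) J (x : P I) : addm (fun y : P J => ocomp i x y).
Proof. by move=> y y'; exact: compDr. Qed.
End OperadLemmas.

(** Terms compose operations on standard sets only, so that they form a small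
    type; the bijection at each composition relabels its result. *)
Inductive term (E : Type) (I : nfset) : Type :=
| Tgen (e : E) (b : bij fin2 I)
| Tone (b : bij fin1 I)
| Tcomp (m n : nat) (i : nset m) (b : bij (graft i (nset n)) I)
    (x : term E (nset m)) (y : term E (nset n))
| Tdiff (x : term E I).

Fixpoint eval (E : Type) (Q : operad) (f : E -> Q fin2) (I : nfset) (t : term E I) : Q I :=
  match t with
  | Tgen e b => oact b (f e)
  | Tone b => oact b ounit
  | Tcomp m n i b x y => oact b (ocomp i (eval f x) (eval f y))
  | Tdiff x => diff (eval f x)
  end.

Fixpoint relabel (E : Type) (I J : nfset) (g : bij I J) (t : term E I) : term E J :=
  match t with
  | Tgen e b => Tgen e (bij_cmp g b)
  | Tone b => Tone E (bij_cmp g b)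
  | Tcomp m n i b x y => Tcomp (bij_cmp g b) x y
  | Tdiff x => Tdiff (relabel g x)
  end.

Definition std_size (I : nfset) : nat := sval (cid (bij_std_ex I)).
Definition std (I : nfset) : bij I (nset (std_size I)) :=
  sval (cid (svalP (cid (bij_std_ex I)))).

Definition graft_term (E : Type) (I : nfset) (i : I) (J : nfset)
    (t : term E I) (u : term E J) : term E (graft i J) :=
  Tcomp (bij_inv (graft_map (std I) (std J) i)) (relabel (std I) t) (relabel (std J) u).

Section Eval.
Variables (E : Type) (Q : operad) (hQ : is_operad Q) (f : E -> Q fin2).

Lemma eval_relabel (I J : nfset) (g : bij I J) (t : term E I) :
  eval f (relabel g t) = oact g (eval f t).
Proof.
elim: t J g => [{}I e b|{}I b|{}I m n i b x _ y _|{}I x IH] J g /=; rewrite ?(actM hQ) //.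
by rewrite IH (cmorph_diff (act_cmorphism hQ g)).
Qed.

Lemma eval_graft (I : nfset) (i : I) (J : nfset) (t : term E I) (u : term E J) :
  eval f (graft_term i t u) = ocomp i (eval f t) (eval f u).
Proof. by rewrite /= !eval_relabel (comp_act hQ) (actK hQ). Qed.
End Eval.

HB.instance Definition _ (E : Type) (I : nfset) := gen_eqMixin (term E I).
HB.instance Definition _ (E : Type) (I : nfset) := gen_choiceMixin (term E I).

Section Free.
Variable E : s2complex.

(** Quantifying over all operads, instead of listing relations between terms, makes
    each axiom of operads hold in the quotient because it holds in all operads. *)
Definition null_term (I : nfset) : {pred {freeg (term E I)}} :=
  fun x => `[< forall (Q : operad) (f : E -> Q fin2), is_operad Q -> is_s2morphism f ->
     linext (eval f (I := I)) x = 0 >].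

Lemma null_term_closed I : zmod_closed (@null_term I).
Proof.
split; first by apply/asboolP => Q f _ _; exact: (addm0 (@linextD _ _ _)).
move=> x y /asboolP hx /asboolP hy; apply/asboolP => Q f hQ hf.
by rewrite (addmB (@linextD _ _ _)) hx // hy // subrr.
Qed.
HB.instance Definition _ I :=
  GRing.isZmodClosed.Build {freeg (term E I)} (@null_term I) (@null_term_closed I).

Definition tcl (I : nfset) (t : term E I) : zquot (@null_term I) := zproj _ << t >>.

Definition free_complex (I : nfset) : complex := {|
  ccar := zquot (@null_term I);
  hdeg := fun n x => forall (Q : operad) (f : E -> Q fin2), is_operad Q -> is_s2morphism f ->
     hdeg n (linext (eval f (I := I)) (zrepr x));
  diff := fun x => linext (fun t => tcl (Tdiff t)) (zrepr x) |}.

Definition free_op : operad := {|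
  ocar := free_complex;
  oact := fun I J g x => linext (fun t => tcl (relabel g t)) (zrepr x);
  ounit := tcl (Tone E (bij_id fin1));
  ocomp := fun I i J x y =>
    linext (fun t => linext (fun u => tcl (graft_term i t u)) (zrepr y)) (zrepr x) |}.

Definition free_gen (e : E) : free_op fin2 := tcl (Tgen e (bij_id fin2)).

Definition free_eval (Q : operad) (f : E -> Q fin2) (I : nfset) (x : free_op I) : Q I :=
  linext (eval f (I := I)) (zrepr x).

Section FreeEval.
Variables (Q : operad) (f : E -> Q fin2) (hQ : is_operad Q) (hf : is_s2morphism f).
Local Notation ev := (@free_eval Q f _).

Lemma free_eval_proj (I : nfset) x : ev (zproj (@null_term I) x) = linext (eval f (I := I)) x.
Proof.
apply: zquot_lift => [|{}x /asboolP]; first exact: linextD.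
exact.
Qed.

Lemma free_evalD (I : nfset) : addm (@free_eval Q f I).
Proof.
move=> x y; rewrite -[x]zreprK -[y]zreprK -(zprojD (@null_term I)).
by rewrite !free_eval_proj linextD.
Qed.

Lemma free_eval_tcl (I : nfset) (t : term E I) : ev (tcl t) = eval f t.
Proof. by rewrite free_eval_proj linextU. Qed.

Lemma free_eval_act (I J : nfset) (g : bij I J) (x : free_op I) : ev (oact g x) = oact g (ev x).
Proof.
rewrite (linext_comp _ (@free_evalD J)) [in RHS]/free_eval (linext_comp _ (actD hQ g)).
by apply: eq_linext => t; rewrite /= free_eval_tcl eval_relabel.
Qed.

Lemma free_eval_diff (I : nfset) (x : free_op I) : ev (diff x) = diff (ev x).
Proof.
rewrite (linext_comp _ (@free_evalD I)) [in RHS]/free_eval (linext_comp _ (@diffA _ hQ I)).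
by apply: eq_linext => t; rewrite /= free_eval_tcl.
Qed.

Lemma free_eval_one : ev (ounit : free_op fin1) = ounit.
Proof. by rewrite free_eval_tcl /= (act1 hQ). Qed.

Lemma free_eval_comp (I : nfset) (i : I) (J : nfset) (x : free_op I) (y : free_op J) :
  ev (ocomp i x y) = ocomp i (ev x) (ev y).
Proof.
rewrite (linext_comp _ (@free_evalD _)) [in RHS]/free_eval (linext_comp _ (compAl hQ i _)).
apply: eq_linext => t; rewrite /= (linext_comp _ (@free_evalD _)) (linext_comp _ (compAr hQ i _)).
by apply: eq_linext => u; rewrite /= free_eval_tcl eval_graft.
Qed.

Lemma free_eval_gen e : ev (free_gen e) = f e.
Proof. by rewrite free_eval_tcl /= (act1 hQ). Qed.
End FreeEval.

Lemma free_eq (I : nfset) (x y : free_op I) :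
  (forall (Q : operad) (f : E -> Q fin2), is_operad Q -> is_s2morphism f ->
    free_eval f x = free_eval f y) -> x = y.
Proof.
move=> h; rewrite -[x]zreprK -[y]zreprK; apply/zproj_eq/asboolP => Q f hQ hf.
by rewrite (addmB (@linextD _ _ _)); apply/eqP; rewrite subr_eq0; apply/eqP; exact: h.
Qed.

Lemma free_actD (I J : nfset) (g : bij I J) : addm (@oact free_op I J g).
Proof.
move=> x y; apply: free_eq => Q f hQ hf.
by rewrite (free_evalD hQ hf) !(free_eval_act hQ hf) (free_evalD hQ hf) (actD hQ).
Qed.

Lemma free_diffD (I : nfset) : addm (@diff (free_op I)).
Proof.
move=> x y; apply: free_eq => Q f hQ hf.
by rewrite (free_evalD hQ hf) !(free_eval_diff hQ hf) (free_evalD hQ hf) (diffA hQ).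
Qed.

Lemma free_compDl (I : nfset) (i : I) J (y : free_op J) : addm (fun x : free_op I => ocomp i x y).
Proof.
move=> x x'; apply: free_eq => Q f hQ hf.
by rewrite (free_evalD hQ hf) !(free_eval_comp hQ hf) (free_evalD hQ hf) (compDl hQ).
Qed.

Lemma free_compDr (I : nfset) (i : I) J (x : free_op I) : addm (fun y : free_op J => ocomp i x y).
Proof.
move=> y y'; apply: free_eq => Q f hQ hf.
by rewrite (free_evalD hQ hf) !(free_eval_comp hQ hf) (free_evalD hQ hf) (compDr hQ).
Qed.

(** Each constructor of terms is an operation of the free operad, as can be tested in
    all operads. *)
Lemma free_op_ind (P : forall I, free_op I -> Prop) :
  (forall I, P I 0) ->
  (forall I (x y : free_op I), P I x -> P I y -> P I (x + y)) ->
  (forall I (x : free_op I), P I x -> P I (- x)) ->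
  (forall I J (g : bij I J) x, P I x -> P J (oact g x)) ->
  (forall e, P fin2 (free_gen e)) -> P fin1 ounit ->
  (forall (I : nfset) (i : I) (J : nfset) x y, P I x -> P J y -> P (graft i J) (ocomp i x y)) ->
  (forall I (x : free_op I), P I x -> P I (diff x)) ->
  forall I x, P I x.
Proof.
move=> P0 PD PN Pa Pg P1 Pc Pd I x.
have Pt (J : nfset) (t : term E J) : P J (tcl t).
  elim: t => [{}J e b|{}J b|{}J m n i b u IHu v IHv|{}J u IHu].
  - have -> : tcl (Tgen e b) = oact b (free_gen e) by apply: free_eq => Q f hQ hf;
      rewrite (free_eval_act hQ hf) (free_eval_gen hQ hf) (free_eval_tcl hQ hf).
    exact: Pa.
  - have -> : tcl (Tone E b) = oact b (ounit : free_op fin1) by apply: free_eq => Q f hQ hf;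
      rewrite (free_eval_act hQ hf) (free_eval_one hQ hf) (free_eval_tcl hQ hf).
    exact: Pa.
  - have -> : tcl (Tcomp b u v) = oact b (ocomp i (tcl u : free_op _) (tcl v : free_op _)).
      apply: free_eq => Q f hQ hf.
      by rewrite (free_eval_act hQ hf) (free_eval_comp hQ hf) !(free_eval_tcl hQ hf).
    by apply: Pa; exact: Pc.
  - have -> : tcl (Tdiff u) = diff (tcl u : free_op J) by apply: free_eq => Q f hQ hf;
      rewrite (free_eval_diff hQ hf) !(free_eval_tcl hQ hf).
    exact: Pd.
have -> : x = linext (@tcl I) (zrepr x).
  by rewrite -[LHS]zreprK [in LHS](freegE (zrepr x)) (linext_comp _ (zprojD _)).
by apply: linext_ind; [exact: P0|exact: PD|exact: PN|move=> t _; exact: Pt].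
Qed.

Lemma free_hdeg (I : nfset) n (x : free_op I) :
  (forall (Q : operad) (f : E -> Q fin2), is_operad Q -> is_s2morphism f ->
    hdeg n (free_eval f x)) -> hdeg n x.
Proof. exact. Qed.

Lemma free_hdeg0 (I : nfset) n : hdeg n (0 : free_op I).
Proof.
apply: free_hdeg => Q f hQ hf; rewrite (addm0 (@free_evalD _ _ hQ hf I)).
exact: hdeg0 (operad_complex hQ I) n.
Qed.

Lemma free_hdegB (I : nfset) n (x y : free_op I) : hdeg n x -> hdeg n y -> hdeg n (x - y).
Proof.
move=> hx hy; apply: free_hdeg => Q f hQ hf; rewrite (addmB (@free_evalD _ _ hQ hf I)).
by apply: (hdegB (operad_complex hQ I)); [exact: hx|exact: hy].
Qed.

Lemma free_hdegD (I : nfset) n (x y : free_op I) : hdeg n x -> hdeg n y -> hdeg n (x + y).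
Proof.
move=> hx hy; rewrite -[y]opprK -[- y]sub0r; apply: free_hdegB => //.
by apply: free_hdegB => //; exact: free_hdeg0.
Qed.

Lemma free_hdeg_diff (I : nfset) n (x : free_op I) : hdeg n x -> hdeg (n + 1) (diff x).
Proof.
move=> hx; apply: free_hdeg => Q f hQ hf; rewrite (free_eval_diff hQ hf).
exact: (diff_hdeg (operad_complex hQ I) (hx Q f hQ hf)).
Qed.

Lemma free_hdeg_act (I J : nfset) (g : bij I J) n (x : free_op I) : hdeg n x -> hdeg n (oact g x).
Proof.
move=> hx; apply: free_hdeg => Q f hQ hf; rewrite (free_eval_act hQ hf).
exact: (cmorph_hdeg (act_cmorphism hQ g) (hx Q f hQ hf)).
Qed.

Lemma free_hdeg_comp (I : nfset) (i : I) (J : nfset) m n (x : free_op I) (y : free_op J) :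
  hdeg m x -> hdeg n y -> hdeg (m + n) (ocomp i x y).
Proof.
move=> hx hy; apply: free_hdeg => Q f hQ hf; rewrite (free_eval_comp hQ hf).
exact: (comp_hdeg hQ i (hx Q f hQ hf) (hy Q f hQ hf)).
Qed.

Lemma free_hdeg_one : hdeg 0 (ounit : free_op fin1).
Proof. by apply: free_hdeg => Q f hQ hf; rewrite (free_eval_one hQ hf); exact: one_hdeg. Qed.

Lemma free_hdeg_gen n e : hdeg n e -> hdeg n (free_gen e).
Proof.
move=> he; apply: free_hdeg => Q f hQ hf; rewrite (free_eval_gen hQ hf).
exact: (cmorph_hdeg (s2morph_cmorphism hf) he).
Qed.

Lemma free_gen_morphism : is_s2morphism free_gen.
Proof.
split; first split.
- move=> x y; apply: free_eq => Q f hQ hf.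
  by rewrite (free_evalD hQ hf) !(free_eval_gen hQ hf) (cmorphD (s2morph_cmorphism hf)).
- by move=> n x; exact: free_hdeg_gen.
- move=> x; apply: free_eq => Q f hQ hf.
  by rewrite (free_eval_diff hQ hf) !(free_eval_gen hQ hf) (cmorph_diff (s2morph_cmorphism hf)).
- move=> s x; apply: free_eq => Q f hQ hf.
  by rewrite (free_eval_act hQ hf) !(free_eval_gen hQ hf) (s2morph_act hf).
Qed.

Hypothesis hE : is_s2complex E.

(** That every element is a sum of homogeneous elements cannot be tested in each operad
    separately; it is proved by [free_op_ind]. *)
Definition homsum (I : nfset) (x : free_op I) := exists r : seq (int * free_op I),
  (forall p, p \in r -> hdeg p.1 p.2) /\ x = \sum_(p <- r) p.2.

Lemma homsum_hdeg (I : nfset) n (x : free_op I) : hdeg n x -> homsum x.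
Proof. by move=> hx; exists [:: (n, x)]; rewrite big_seq1; split=> // p; rewrite inE => /eqP ->. Qed.

Lemma homsumD (I : nfset) (x y : free_op I) : homsum x -> homsum y -> homsum (x + y).
Proof.
move=> [r [hr ->]] [r' [hr' ->]]; exists (r ++ r'); rewrite big_cat; split=> // p.
by rewrite mem_cat => /orP[/hr|/hr'].
Qed.

Lemma homsum_map (I J : nfset) (f : free_op I -> free_op J) : addm f ->
  (forall n x, hdeg n x -> homsum (f x)) -> forall x, homsum x -> homsum (f x).
Proof.
move=> fD fh x [r [hr ->]]; rewrite (addm_sum fD).
elim: r hr => [|p r IH] hr.
  by rewrite big_nil; apply: (homsum_hdeg (n := 0)); exact: free_hdeg0.
rewrite big_cons; apply: homsumD; first by apply: (fh p.1); apply: hr; rewrite mem_head.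
by apply: IH => q qr; apply: hr; rewrite inE qr orbT.
Qed.

Lemma free_homsum (I : nfset) (x : free_op I) : homsum x.
Proof.
move: I x; apply: free_op_ind.
- by move=> I; apply: (homsum_hdeg (n := 0)); exact: free_hdeg0.
- by move=> I x y; exact: homsumD.
- move=> I; apply: homsum_map => [x y|n x hx]; first by rewrite opprD.
  by rewrite -sub0r; apply: (homsum_hdeg (n := n)); apply: free_hdegB => //; exact: free_hdeg0.
- move=> I J g; apply: homsum_map => [|n x hx]; first exact: free_actD.
  by apply: (homsum_hdeg (n := n)); exact: free_hdeg_act.
- move=> e; have [s [f [us hf ->]]] := hdeg_span (s2_complex hE) e.
  rewrite (addm_sum (cmorphD (s2morph_cmorphism free_gen_morphism))).
  elim: s {us} => [|n s IH].
    by rewrite big_nil; apply: (homsum_hdeg (n := 0)); exact: free_hdeg0.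
  rewrite big_cons; apply: homsumD => //.
  by apply: (homsum_hdeg (n := n)); exact: free_hdeg_gen.
- by apply: (homsum_hdeg (n := 0)); exact: free_hdeg_one.
- move=> I i J x y hx hy; move: x hx; apply: homsum_map => [|m x hx]; first exact: free_compDl.
  move: y hy; apply: homsum_map => [|n y hy]; first exact: free_compDr.
  by apply: (homsum_hdeg (n := m + n)); exact: free_hdeg_comp.
- move=> I; apply: homsum_map => [|n x hx]; first exact: free_diffD.
  by apply: (homsum_hdeg (n := n + 1)); exact: free_hdeg_diff.
Qed.

Lemma free_hdeg_span (I : nfset) (x : free_op I) : exists (s : seq int) (f : int -> free_op I),
  [/\ uniq s, forall n, hdeg n (f n) & x = \sum_(n <- s) f n].
Proof.
have [r [hr ->]] := free_homsum x.
exists (undup [seq p.1 | p <- r]), (fun n => \sum_(p <- r | p.1 == n) p.2); split.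
- exact: undup_uniq.
- move=> n; rewrite big_seq_cond; apply: big_ind; [exact: free_hdeg0|exact: free_hdegD|].
  by move=> p /andP[/hr + /eqP <-].
rewrite (exchange_big_dep xpredT) //= big_seq [RHS]big_seq; apply: eq_bigr => p pr.
rewrite (eq_bigl (pred1 p.1)) => [|n]; last by rewrite /= eq_sym.
by rewrite -big_filter filter_pred1_uniq ?undup_uniq ?mem_undup ?map_f // big_seq1.
Qed.

Lemma free_hdeg_direct (I : nfset) (s : seq int) (f : int -> free_op I) : uniq s ->
  (forall n, hdeg n (f n)) -> \sum_(n <- s) f n = 0 -> forall n, n \in s -> f n = 0.
Proof.
move=> us hf f0 n ns; apply: free_eq => Q g hQ hg; rewrite (addm0 (@free_evalD _ _ hQ hg I)).
apply: (hdeg_direct (operad_complex hQ I) us (f := fun n => free_eval g (f n))) => //.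
  by move=> m; exact: (hf m Q g hQ hg).
by rewrite -(addm_sum (@free_evalD _ _ hQ hg I)) f0 (addm0 (@free_evalD _ _ hQ hg I)).
Qed.

Lemma free_op_is_operad : is_operad free_op.
Proof.
split.
- move=> I; split.
  + by move=> n; exact: free_hdeg0.
  + by move=> n x y; exact: free_hdegB.
  + exact: free_hdeg_span.
  + exact: free_hdeg_direct.
  + exact: free_diffD.
  + by move=> n x; exact: free_hdeg_diff.
  + move=> x; apply: free_eq => Q f hQ hf; rewrite !(free_eval_diff hQ hf).
    by rewrite (diffK (operad_complex hQ I)) (addm0 (@free_evalD _ _ hQ hf I)).
- move=> I J g; split.
  + exact: free_actD.
  + by move=> n x; exact: free_hdeg_act.
  + move=> x; apply: free_eq => Q f hQ hf.
    by rewrite !(free_eval_act hQ hf, free_eval_diff hQ hf) (cmorph_diff (act_cmorphism hQ g)).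
- move=> I g x gid; apply: free_eq => Q f hQ hf.
  by rewrite (free_eval_act hQ hf) (act_id hQ).
- move=> I J K f g h x hfg; apply: free_eq => Q k hQ hk.
  by rewrite !(free_eval_act hQ hk) (act_comp hQ _ hfg).
- exact: free_hdeg_one.
- apply: free_eq => Q f hQ hf.
  by rewrite (free_eval_diff hQ hf) (free_eval_one hQ hf) (one_diff hQ) (addm0 (@free_evalD _ _ hQ hf _)).
- by move=> I i J x x' y; exact: free_compDl.
- by move=> I i J x y y'; exact: free_compDr.
- by move=> I i J m n x y; exact: free_hdeg_comp.
- move=> I i J m x y hx; apply: free_eq => Q f hQ hf; rewrite mulz_sgnz.
  rewrite (free_evalD hQ hf) (addm_sg (@free_evalD _ _ hQ hf _)).
  rewrite !(free_eval_comp hQ hf, free_eval_diff hQ hf) -mulz_sgnz.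
  exact: (comp_diff hQ i _ (hx Q f hQ hf)).
- move=> I I' J J' f g i x y; apply: free_eq => Q h hQ hh.
  by rewrite !(free_eval_comp hQ hh, free_eval_act hQ hh) (comp_act hQ).
- move=> I J K i j x y z; apply: free_eq => Q h hQ hh.
  by rewrite !(free_eval_comp hQ hh, free_eval_act hQ hh) (comp_seq hQ).
- move=> I J K i k ik m n x y z hy hz; apply: free_eq => Q h hQ hh; rewrite mulz_sgnz.
  rewrite (addm_sg (@free_evalD _ _ hQ hh _)) !(free_eval_comp hQ hh, free_eval_act hQ hh).
  by rewrite -mulz_sgnz; exact: (comp_par hQ ik _ (hy Q h hQ hh) (hz Q h hQ hh)).
- move=> J y; apply: free_eq => Q h hQ hh.
  by rewrite !(free_eval_comp hQ hh, free_eval_act hQ hh) (free_eval_one hQ hh) (comp_onel hQ).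
- move=> I i x; apply: free_eq => Q h hQ hh.
  by rewrite !(free_eval_comp hQ hh, free_eval_act hQ hh) (free_eval_one hQ hh) (comp_oner hQ).
Qed.

Lemma free_op_free : is_free_operad free_gen.
Proof.
split; [exact: free_op_is_operad|exact: free_gen_morphism|].
move=> Q f hQ hf; exists (fun I => @free_eval Q f I); split.
- split.
  + move=> I; split; first exact: free_evalD.
    * by move=> n x hx; exact: (hx Q f hQ hf).
    * by move=> x; exact: free_eval_diff.
  + by move=> I J g x; exact: free_eval_act.
  + exact: free_eval_one.
  + by move=> I i J x y; exact: free_eval_comp.
- by move=> x; exact: free_eval_gen.
move=> psi hpsi psiE; have phiD (I : nfset) := @free_evalD _ _ hQ hf I.
have psiD (I : nfset) : addm (psi I) := cmorphD (morph_cmorphism hpsi I).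
apply: free_op_ind.
- by move=> I; rewrite (addm0 (@phiD I)) (addm0 (@psiD I)).
- by move=> I x y hx hy; rewrite phiD psiD hx hy.
- by move=> I x hx; rewrite (addmN (@phiD I)) (addmN (@psiD I)) hx.
- by move=> I J g x hx; rewrite (morph_act hpsi) hx (free_eval_act hQ hf).
- by move=> e; rewrite psiE (free_eval_gen hQ hf).
- by rewrite (morph_one hpsi) (free_eval_one hQ hf).
- by move=> I i J x y hx hy; rewrite (morph_comp hpsi) hx hy (free_eval_comp hQ hf).
- move=> I x hx; rewrite (cmorph_diff (morph_cmorphism hpsi I)) hx.
  by rewrite (free_eval_diff hQ hf).
Qed.
End Free.

(** * The relations in Pi *)

Section PiRelations.

Lemma wemb_eq_mono (I : finType) (x : Pi_car I) s : wemb x = wd s -> x = Pi_mono s.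
Proof. by move=> E; rewrite -[LHS]wembK /Pi_lift E (wliftE (@Pi_mono_anti I)). Qed.

Lemma wemb_scomp m n (i : nset m) (x : Pi (nset m)) (y : Pi (nset n)) :
  wemb (scomp i x y) = sub (graft_std n i \o ginl i (nset n)) i (wemb x)
    (kmap (graft_std n i \o ginr i (J:=nset n)) (wemb y)).
Proof. by rewrite /scomp wemb_act wemb_comp kmap_sub kmap_comp. Qed.

Definition wcons (X : Type) (c : bool) (x : X) (s : seq (seq X)) : seq (seq X) :=
  if c then (if s is b :: s' then (x :: b) :: s' else [::]) else [:: x] :: s.

Definition pgen (c : bool) : Pi fin2 := if c then w12 else t12.

(** The half-shuffle with the empty word is trivial, so the first block of s is only
    multiplied by the letter 1 for 1 ∧ 2, and only preceded by it for 1 ⊗ 2. *)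
Lemma wemb_comp_gen (c : bool) (J : nfset) s : is_expr s ->
  wemb (ocomp lab2 (pgen c) (Pi_mono s : Pi J)) =
  wd (wcons c (ginl lab2 J lab1) (wmap (@ginr fin2 lab2 J) s)).
Proof.
move=> es; rewrite wemb_comp (wemb_mono es) kmapE.
case: s es => [|b s] es; first by have := expr_mem (nfset_default J) es.
have shr1l (Z : choiceType) (b' : seq Z) (s' : word Z) : shr (wd [::]) (wd (b' :: s')) = wd (b' :: s').
  by rewrite -bconsE shr_bcons sig1 sh1l.
case: c; rewrite /pgen /w12 /t12 wemb_mono ?is_expr_w12 ?is_expr_t12 // -bconsE.
  by rewrite (@sub_last _ _ _ _ [:: lab1]) // kmap1 shr1l -bconsE wedge_bcons bconsE.
rewrite sub_notin // -bconsE (@sub_last _ _ _ _ [::]) // kmap1 shr1l -[wd (map _ _ :: _)]bconsE.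
by rewrite wedge_bcons !bconsE.
Qed.

Let a0 : fin3 := @Ordinal 3 0 isT.
Let a1 : fin3 := @Ordinal 3 1 isT.
Let a2 : fin3 := @Ordinal 3 2 isT.

Lemma graft_std12 (i : fin2) (z : graft i fin2) : graft_std 1 i z =
  match z with
  | inl x => if (val x < i)%N then a0 else a2
  | inr y => if (i == lab1) then (if y == lab1 then a0 else a1) else (if y == lab1 then a1 else a2)
  end.
Proof.
apply: val_inj; case: z => [[x xi]|y] /=.
  by case: (fin2P i) xi => ->; case: (fin2P x) => -> //= _; rewrite inordK.
by case: (fin2P i) => ->; case: (fin2P y) => -> /=; rewrite inordK.
Qed.

Definition std1l (x : fin2) : fin3 := a2.
Definition std1r (y : fin2) : fin3 := if y == lab1 then a0 else a1.
Definition std2l (x : fin2) : fin3 := a0.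
Definition std2r (y : fin2) : fin3 := if y == lab1 then a1 else a2.

Lemma wemb_scomp_mono (i : nset 1) (f g : fin2 -> fin3) s t : is_expr s -> is_expr t ->
  (forall x, x != i -> graft_std 1 i (ginl i fin2 x) = f x) ->
  (forall y, graft_std 1 i (ginr i y) = g y) ->
  wemb (scomp i (Pi_mono s : Pi (nset 1)) (Pi_mono t : Pi (nset 1))) =
  sub f i (wd s) (wd (wmap g t)).
Proof.
move=> es et hf hg; rewrite wemb_scomp !wemb_mono // -[in RHS]kmapE.
rewrite (@eq_kmap1 _ _ _ g) => [|y]; last exact: hg.
by apply: sub_ext; [exact: expr_uniq|move=> x _; exact: hf].
Qed.

Lemma wemb_circ1 s t : is_expr s -> is_expr t ->
  wemb (scomp (lab1 : nset 1) (Pi_mono s : Pi (nset 1)) (Pi_mono t : Pi (nset 1))) =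
  sub std1l lab1 (wd s) (wd (wmap std1r t)).
Proof.
move=> es et; apply: wemb_scomp_mono => // [x x1|y]; rewrite graft_std12 //.
by rewrite (ginlE _ x1) /=; case: (fin2P x) x1 => ->.
Qed.

Lemma wemb_circ2 s t : is_expr s -> is_expr t ->
  wemb (scomp (lab2 : nset 1) (Pi_mono s : Pi (nset 1)) (Pi_mono t : Pi (nset 1))) =
  sub std2l lab2 (wd s) (wd (wmap std2r t)).
Proof.
move=> es et; apply: wemb_scomp_mono => // [x x1|y]; rewrite graft_std12 //.
by rewrite (ginlE _ x1) /=; case: (fin2P x) x1 => ->.
Qed.

Section SubBinary.
Variables (X Z : choiceType) (f : X -> Z) (i k : X) (ik : i != k).
Let ki : i \notin [:: k]. Proof. by rewrite inE. Qed.

Lemma sub_tensorl b t : sub f i (wd [:: [:: i]; [:: k]]) (wd (b :: t)) =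
  bcons b (sh (sig (bpar b) (wd [:: [:: f k]])) (wd t)).
Proof. by rewrite -bconsE (@sub_last _ _ _ _ [::]) // kmapE -bconsE shr_bcons wedge_bcons. Qed.

Lemma sub_tensorr b t : sub f i (wd [:: [:: k]; [:: i]]) (wd (b :: t)) = wd ([:: f k] :: b :: t).
Proof.
rewrite -bconsE sub_notin // -bconsE (@sub_last _ _ _ _ [::]) // kmap1.
by rewrite -bconsE shr_bcons wedge_bcons sig1 sh1l !bconsE.
Qed.

Lemma sub_wedger b t : sub f i (wd [:: [:: k; i]]) (wd (b :: t)) = wd ((f k :: b) :: t).
Proof.
rewrite -bconsE (@sub_last _ _ _ _ [:: k]) // kmap1.
by rewrite -bconsE shr_bcons wedge_bcons sig1 sh1l !bconsE.
Qed.

Lemma sub_wedgel b t : sub f i (wd [:: [:: i; k]]) (wd (b :: t)) = - wd ((f k :: b) :: t).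
Proof.
rewrite -sub_wedger -subNl; congr (sub _ _ _ _).
exact: (wd_anti (@swap_head _ [::] _ _ [::] [::])).
Qed.
End SubBinary.

(** The two terms are the two shuffles of the blocks 2 and 3. *)
Lemma tensor_circ1_tensor : scomp (lab1 : nset 1) t12 t12 =
  scomp (lab2 : nset 1) t12 t12 + scomp (lab2 : nset 1) t12 t21.
Proof.
have E1 := wemb_circ1 is_expr_t12 is_expr_t12.
have E2 := wemb_circ2 is_expr_t12 is_expr_t12.
have E3 := wemb_circ2 is_expr_t12 is_expr_t21.
have E4 := etrans (@wembD _ (scomp _ t12 t12) (scomp _ t12 t21)) (congr2 +%R E2 E3).
apply: (wemb_inj (etrans E1 (etrans _ (esym E4)))).
rewrite /wmap /= sub_tensorl // !sub_tensorr //.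
rewrite sigE sg_false shE /= sg_false.
by rewrite !bconsE bconsD !bconsE addrC.
Qed.

Lemma wedge_circ2_tensor : scomp (lab2 : nset 1) w12 t12 = scomp (lab1 : nset 1) t12 w12.
Proof.
have E1 := wemb_circ2 is_expr_w12 is_expr_t12.
have E2 := wemb_circ1 is_expr_t12 is_expr_w12.
apply: (wemb_inj (etrans E1 (etrans _ (esym E2)))).
rewrite /wmap /= sub_wedger // sub_tensorl //.
by rewrite sh1r sigE andbF sg_false bconsE.
Qed.

Lemma tensor_circ1_wedge : scomp (lab1 : nset 1) t12 w12 = oact tau (scomp (lab1 : nset 1) w12 t21).
Proof.
have E1 := wemb_circ1 is_expr_t12 is_expr_w12.
have E2 := wemb_circ1 is_expr_w12 is_expr_t21.
apply: (wemb_inj (etrans E1 (esym (etrans (@wemb_act _ _ tau _) (etrans (congr1 _ E2) _))))).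
rewrite /wmap /= sub_wedgel // sub_tensorl //.
rewrite sh1r sigE andbF sg_false bconsE kmapN kmapE -(wd_anti (@swap_head _ [::] _ _ [::] _)).
congr (wd [:: [:: _; _]; [:: _]]); exact: val_inj.
Qed.

Lemma wedge_circ1_wedge : scomp (lab1 : nset 1) w21 w12 = scomp (lab2 : nset 1) w12 w12.
Proof.
have e21 : is_expr ([:: [:: lab2; lab1]] : word fin2).
  by apply: exprP => // x; case: (fin2P x) => ->.
have E1 := wemb_circ1 e21 is_expr_w12.
have E2 := wemb_circ2 is_expr_w12 is_expr_w12.
apply: (wemb_inj (etrans E1 (etrans _ (esym E2)))).
rewrite /wmap /= !sub_wedger //.
have swp (u v : seq fin3) a b := wd_anti (@swap_head _ u a b v [::]).
by apply: (etrans (swp [::] [:: a1] a2 a0)); rewrite (swp [:: a0] [::] a2 a1) opprK.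
Qed.
End PiRelations.

(** * Combs span the quotient *)

Notation slot1 := (@Ordinal 3 1 isT : nfcar fin3).
Notation slot2 := (@Ordinal 3 2 isT : nfcar fin3).

Lemma arity2_Pi_s2complex : is_s2complex (arity2 Pi).
Proof.
split; first exact: operad_complex Pi_is_operad _.
- by move=> f; exact: act_cmorphism Pi_is_operad _ _ f.
- by move=> f x; exact: act_id Pi_is_operad _ f x.
- by move=> f g h x; exact: act_comp Pi_is_operad _ _ _ f g h x.
Qed.

(** Two free operads on the same module are isomorphic, hence any free operad inherits
    the induction principle [free_op_ind]. *)
Lemma free_generated (E : s2complex) (F : operad) (eta : E -> F fin2)
    (P : forall I, F I -> Prop) : is_s2complex E -> is_free_operad eta ->
  (forall I, P I 0) ->
  (forall I (x y : F I), P I x -> P I y -> P I (x + y)) ->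
  (forall I (x : F I), P I x -> P I (- x)) ->
  (forall I J (g : bij I J) x, P I x -> P J (oact g x)) ->
  (forall e, P fin2 (eta e)) -> P fin1 ounit ->
  (forall (I : nfset) (i : I) (J : nfset) x y, P I x -> P J y -> P (graft i J) (ocomp i x y)) ->
  (forall I (x : F I), P I x -> P I (diff x)) ->
  forall I x, P I x.
Proof.
move=> hE hF P0 PD PN Pa Pg P1 Pc Pd I x.
have h0 := free_op_free hE; have hFo := free_operad hF.
have [al [hal alE _]] := free_univ h0 hFo (free_eta hF).
have [be [hbe beE _]] := free_univ hF (free_operad h0) (free_eta h0).
have [ph [_ _ uni]] := free_univ hF hFo (free_eta hF).
have hid : is_morphism (fun I (y : F I) => y) by split.
have hab : is_morphism (fun I (y : F I) => al I (be I y)).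
  split; [move=> J; split| | | ].
  - by move=> y z; rewrite (cmorphD (morph_cmorphism hbe J)) (cmorphD (morph_cmorphism hal J)).
  - by move=> n y /(cmorph_hdeg (morph_cmorphism hbe J))/(cmorph_hdeg (morph_cmorphism hal J)).
  - by move=> y; rewrite (cmorph_diff (morph_cmorphism hbe J)) (cmorph_diff (morph_cmorphism hal J)).
  - by move=> J K f y; rewrite (morph_act hbe) (morph_act hal).
  - by rewrite (morph_one hbe) (morph_one hal).
  - by move=> J i K y z; rewrite (morph_comp hbe) (morph_comp hal).
have -> : x = al I (be I x).
  rewrite (uni _ hab); last by move=> e; rewrite beE alE.
  exact: (uni _ hid).
have alD (J : nfset) : addm (al J) := cmorphD (morph_cmorphism hal J).
move: (be I x) => {x}; move: I; apply: free_op_ind => //.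
- by move=> J; rewrite (addm0 (@alD J)).
- by move=> J y z hy hz; rewrite alD; apply: PD.
- by move=> J y hy; rewrite (addmN (@alD J)); apply: PN.
- by move=> J K g y hy; rewrite (morph_act hal); apply: Pa.
- by move=> e; rewrite alE.
- by rewrite (morph_one hal).
- by move=> J i K y z hy hz; rewrite (morph_comp hal); apply: Pc.
- by move=> J y hy; rewrite (cmorph_diff (morph_cmorphism hal J)); apply: Pd.
Qed.

(** The effect of relabelling the first factor of a composition; stating the
   index of the relabelled composition separately avoids dependent rewriting. *)
Lemma comp_actl (P : operad) (hP : is_operad P) (I I' J : nfset) (i : I) (i' : I')
    (f : bij I I') : i' = f i -> exists h : bij (graft i J) (graft i' J),
  [/\ forall (x : P I) (y : P J), ocomp i' (oact f x) y = oact h (ocomp i x y),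
      forall u : {z : I | z != i}, exists2 v : {z : I' | z != i'},
        h (inl u) = inl v & val v = f (val u) &
      forall y, h (inr y) = inr y].
Proof.
move=> ->; exists (graft_map f (bij_id J) i); split => //.
  by move=> x y; rewrite -(comp_act hP) (act1 hP).
by move=> u; eexists; first by [].
Qed.

Section Presentation.
Variables (F : operad) (eta : arity2 Pi -> F fin2).
Hypothesis hF : is_free_operad eta.
Let hFo : is_operad F := free_operad hF.
Let etaD : addm eta := cmorphD (s2morph_cmorphism (free_eta hF)).

Definition in_ideal (I : nfset) (x : F I) : Prop := x \in @ideal_gen F 2 (Pi_relations eta) I.

Lemma in_ideal0 I : in_ideal (0 : F I). Proof. exact: rpred0. Qed.
Lemma in_idealD I (x y : F I) : in_ideal x -> in_ideal y -> in_ideal (x + y). Proof. exact: rpredD. Qed.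
Lemma in_idealN I (x : F I) : in_ideal x -> in_ideal (- x). Proof. by move=> h; rewrite /in_ideal rpredN. Qed.

Lemma in_ideal_act (I J : nfset) (f : bij I J) (x : F I) : in_ideal x -> in_ideal (oact f x).
Proof. by move=> /asboolP h; apply/asboolP => S hS hR; apply: (ideal_act hS); apply: h. Qed.

Lemma in_ideal_compl (I : nfset) (i : I) (J : nfset) (x : F I) (y : F J) : in_ideal x -> in_ideal (ocomp i x y).
Proof. by move=> /asboolP h; apply/asboolP => S hS hR; apply: (ideal_compl hS); apply: h. Qed.

Lemma in_ideal_compr (I : nfset) (i : I) (J : nfset) (x : F I) (y : F J) : in_ideal y -> in_ideal (ocomp i x y).
Proof. by move=> /asboolP h; apply/asboolP => S hS hR; apply: (ideal_compr hS); apply: h. Qed.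

Lemma in_ideal_diff (I : nfset) (x : F I) : in_ideal x -> in_ideal (diff x).
Proof. by move=> /asboolP h; apply/asboolP => S hS hR; apply: (ideal_diff hS); apply: h. Qed.

Lemma in_ideal_rel r : Pi_relations eta r -> in_ideal r.
Proof. by move=> hr; apply/asboolP => S hS; apply. Qed.

Definition gF (c : bool) : F fin2 := eta (pgen c).

(** The right comb with one generator for each flag: these are the normal forms in the
    quotient. *)
Fixpoint comb (fl : seq bool) : F (nset (size fl)) :=
  if fl is c :: fl' then @scomp F 1 (size fl') (lab2 : nset 1) (gF c) (comb fl') else ounit.

Lemma hdeg_gF (c : bool) : hdeg (Posz c) (gF c).
Proof.
apply: (cmorph_hdeg (s2morph_cmorphism (free_eta hF))).
by case: c; [exact: hdeg_w12|exact: hdeg_t12].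
Qed.

Lemma hdeg_comb fl : hdeg (Posz (count id fl)) (comb fl).
Proof.
elim: fl => [|c fl IH]; first exact: one_hdeg.
rewrite /= PoszD; apply: (cmorph_hdeg (act_cmorphism hFo _)).
by apply: (comp_hdeg hFo _ (hdeg_gF c) IH).
Qed.

(** That the combs span everything modulo the ideal ([Sp_all]) bounds the quotient from
    above. *)
Inductive Sp (I : nfset) : F I -> Prop :=
| Sp_comb fl (e : bij (nset (size fl)) I) : Sp (oact e (comb fl))
| Sp_ideal x : in_ideal x -> Sp x
| SpD x y : Sp x -> Sp y -> Sp (x + y)
| SpN x : Sp x -> Sp (- x).

Lemma Sp0 I : Sp (0 : F I). Proof. by apply/Sp_ideal/in_ideal0. Qed.

Lemma Sp_sg (I : nfset) b (x : F I) : Sp x -> Sp (sg b x).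
Proof. by case: b => h; rewrite ?sg_true ?sg_false //; apply: SpN. Qed.

Lemma Sp_eqv (I : nfset) (x y : F I) : in_ideal (x - y) -> Sp y -> Sp x.
Proof. by move=> h hy; rewrite -(subrK y x); apply: SpD => //; apply: Sp_ideal. Qed.

Lemma Sp_act (I J : nfset) (f : bij I J) (x : F I) : Sp x -> Sp (oact f x).
Proof.
elim=> [fl e|{}x hx|{}x y _ IHx _ IHy|{}x _ IHx].
- by rewrite (actM hFo); exact: Sp_comb.
- by apply: Sp_ideal; exact: in_ideal_act.
- by rewrite (actD hFo); exact: SpD.
- by rewrite (addmN (actD hFo f)); exact: SpN.
Qed.

Lemma Sp_actI (I J : nfset) (f : bij I J) (x : F I) : Sp (oact f x) -> Sp x.
Proof. by move=> h; rewrite -(actK hFo f x); exact: Sp_act. Qed.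

Lemma Sp_index (I J : nfset) (i i' : I) (x : F I) (y : F J) : i = i' ->
  Sp (ocomp i x y) -> Sp (ocomp i' x y).
Proof. by move=> ->. Qed.

Lemma Sp_comp_actl (I I' J : nfset) (i : I) (i' : I') (f : bij I I') (x : F I) (y : F J) :
  i' = f i -> Sp (ocomp i x y) -> Sp (ocomp i' (oact f x) y).
Proof. by move=> /(comp_actl hFo J)[h [-> _ _]]; exact: Sp_act. Qed.

Lemma Sp_comp_actr (I J J' : nfset) (i : I) (g : bij J J') (x : F I) (y : F J) :
  Sp (ocomp i x y) -> Sp (ocomp i x (oact g y)).
Proof.
move=> h; rewrite -[x](act1 hFo); rewrite -[i]/(bij_id I i) (comp_act hFo).
exact: Sp_act.
Qed.

Lemma Sp_comp_combr (I J : nfset) (i : I) (x : F I) (y : F J) :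
  (forall fl, Sp (ocomp i x (comb fl))) -> Sp y -> Sp (ocomp i x y).
Proof.
move=> h; elim=> [fl e|{}y hy|{}y z _ IHy _ IHz|{}y _ IHy].
- by apply: Sp_comp_actr.
- by apply: Sp_ideal; exact: in_ideal_compr.
- by rewrite (compDr hFo); exact: SpD.
- by rewrite (addmN (compAr hFo i x)); exact: SpN.
Qed.

Lemma Sp_gen (J : nfset) c (x : F J) : Sp x -> Sp (ocomp lab2 (gF c) x).
Proof.
apply: Sp_comp_combr => fl; apply: (Sp_actI (f := graft_std (size fl) (lab2 : nset 1))).
by rewrite -[X in Sp X](act1 hFo); exact: (@Sp_comb (nset (size fl).+1) (c :: fl) (bij_id _)).
Qed.

(** (q ∘_1 t) ∘_2 s *)
Definition comp12 (J K : nfset) (q : F fin2) (t : F J) (s : F K) :=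
  ocomp (par_left J (isT : lab1 != lab2)) (ocomp lab1 q t) s.

(** (r ∘_2 t) ∘_3 s *)
Definition comp_slots (J K : nfset) (r : F fin3) (t : F J) (s : F K) :=
  ocomp (par_left J (isT : slot1 != slot2)) (ocomp slot1 r t) s.

Lemma comp_slotsD (J K : nfset) (t : F J) (s : F K) : addm (fun r => comp_slots r t s).
Proof. by move=> r r'; rewrite /comp_slots !(compDl hFo). Qed.

Lemma comp_slots_in_ideal (J K : nfset) r (t : F J) (s : F K) : in_ideal r -> in_ideal (comp_slots r t s).
Proof. by move=> h; apply: in_ideal_compl; apply: in_ideal_compl. Qed.

(** Up to relabelling, (q ∘_1 (q' ∘_2 t)) ∘_2 s is ((q ∘_1 q') ∘_2 t) ∘_3 s. *)
Lemma Sp_circ1 (J K : nfset) q q' (t : F J) (s : F K) :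
  Sp (comp_slots (@scomp F 1 1 lab1 q q') t s) -> Sp (comp12 q (ocomp lab2 q' t) s).
Proof.
move=> H; rewrite /comp12.
pose st := graft_std 1 (lab1 : nset 1).
have e1 : (inr lab2 : graft (lab1 : fin2) fin2) = bij_inv st slot1.
  by apply: (bij_inj (bfunP st)); rewrite bij_invKV [LHS]graft_std12.
have [h [hE hl _]] := comp_actl hFo J e1.
pose sa := seq_assoc J (lab1 : fin2) (lab2 : fin2).
have E : ocomp lab1 q (ocomp lab2 q' t) = oact (bij_cmp sa h) (ocomp slot1 (@scomp F 1 1 lab1 q q') t).
  by rewrite -(actM hFo) -hE (actK hFo) (comp_seq hFo).
rewrite E; apply: Sp_comp_actl H.
have [[z zj] hv /= zE] := hl (exist _ slot2 (parallel_subproof (isT : slot1 != slot2))).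
apply/esym/(etrans (congr1 sa hv)); move: zj hv.
have -> : z = inl (exist (fun x => x != lab1) lab2 isT).
  by rewrite zE; apply: (bij_inj (bfunP st)); rewrite bij_invKV [RHS]graft_std12.
by move=> zj _ /=; congr inl; apply: val_inj.
Qed.

(** Up to relabelling, ((q' ∘_2 q) ∘_2 t) ∘_3 s is q' ∘_2 ((q ∘_1 t) ∘_2 s), for the
    generator q' of index c. *)
Lemma Sp_circ2 (J K : nfset) c q (t : F J) (s : F K) :
  Sp (comp12 q t s) -> Sp (comp_slots (@scomp F 1 1 lab2 (gF c) q) t s).
Proof.
move=> H; rewrite /comp_slots /scomp.
pose st := graft_std 1 (lab2 : nset 1).
have e1 : slot1 = st (inr lab1) by rewrite [RHS]graft_std12.
have [h [hE hl _]] := comp_actl hFo J e1.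
pose sa := seq_assoc J (lab2 : fin2) (lab1 : fin2).
have E : ocomp slot1 (oact st (ocomp lab2 (gF c) q)) t =
    oact (bij_cmp h (bij_inv sa)) (ocomp lab2 (gF c) (ocomp lab1 q t)).
  by rewrite hE -(actM hFo) -(comp_seq hFo) (actK hFo).
rewrite E; pose i1 : graft (lab2 : fin2) (graft (lab1 : fin2) J) := inr (par_left J (isT : lab1 != lab2)).
apply: (@Sp_comp_actl _ _ _ i1); last first.
  apply: (Sp_actI (f := seq_assoc K (lab2 : fin2) (par_left J (isT : lab1 != lab2)))).
  by rewrite (comp_seq hFo); apply: Sp_gen.
pose u : {z : graft (lab2 : fin2) fin2 | z != inr lab1} := exist _ (inr lab2) isT.
have -> : i1 = sa (inl u).
  by rewrite /=; congr (inr (inl _)); apply: val_inj.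
apply/esym/(etrans (congr1 h (bij_invK sa (inl u)))); have [v -> vE] := hl u.
by congr inl; apply: val_inj; rewrite vE [LHS]graft_std12.
Qed.

Definition swap12 : bij fin2 fin2 := @Bij fin2 fin2 (@rev_ord 2) (inv_bij (@rev_ordK 2)).

(** Homogeneity is needed for the sign of exchanging t and s. *)
Lemma Sp_comp12_swap (J K : nfset) q m n (t : F J) (s : F K) : hdeg m t -> hdeg n s ->
  Sp (comp12 q s t) -> Sp (comp12 (oact swap12 q) t s).
Proof.
move=> ht hs H; rewrite /comp12.
have e1 : lab1 = swap12 lab2 by apply: val_inj.
have [h [-> hl _]] := comp_actl hFo J e1.
have ne21 : lab2 != lab1 by [].
apply: (@Sp_comp_actl _ _ _ (par_left J ne21)).
  have [v -> vE] := hl (exist _ lab1 (parallel_subproof ne21)).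
  by congr inl; apply: val_inj; rewrite vE; apply: val_inj.
rewrite (comp_par hFo ne21 _ ht hs) mulz_sgnz; apply: Sp_sg; apply: Sp_act.
by apply: Sp_index H; congr inl; apply: val_inj.
Qed.

Lemma pgen_t21 : oact swap12 (pgen false) = t21.
Proof.
rewrite /pgen /t12 Pi_act_mono ?is_expr_t12 //.
by congr (Pi_mono [:: [:: _]; [:: _]]); apply: val_inj.
Qed.

Lemma pgen_w21 : oact swap12 (pgen true) = w21.
Proof.
rewrite /pgen /w12 Pi_act_mono ?is_expr_w12 //.
by congr (Pi_mono [:: [:: _; _]]); apply: val_inj.
Qed.

Lemma eta_act q : eta (oact swap12 q : Pi fin2) = oact swap12 (eta q).
Proof. exact: (s2morph_act (free_eta hF) swap12). Qed.

Lemma in_ideal_tensor_circ1_tensor : in_ideal (circ1 eta t12 t12 - (circ2 eta t12 t12 + circ2 eta t12 t21)).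
Proof. by apply: in_ideal_rel; rewrite /Pi_relations mem_head. Qed.
Lemma in_ideal_wedge_circ2_tensor : in_ideal (circ2 eta w12 t12 - circ1 eta t12 w12).
Proof. by apply: in_ideal_rel; rewrite /Pi_relations !inE eqxx orbT. Qed.
Lemma in_ideal_tensor_circ1_wedge : in_ideal (circ1 eta t12 w12 - oact tau (circ1 eta w12 t21)).
Proof. by apply: in_ideal_rel; rewrite /Pi_relations !inE eqxx !orbT. Qed.
Lemma in_ideal_wedge_circ1_wedge : in_ideal (circ1 eta w21 w12 - circ2 eta w12 w12).
Proof. by apply: in_ideal_rel; rewrite /Pi_relations !inE eqxx !orbT. Qed.

(** The transposition of k and k+1. *)
Definition tpn (k j : nat) : nat := if j == k then k.+1 else if j == k.+1 then k else j.

Lemma tpnK k : involutive (tpn k).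
Proof.
move=> j; rewrite /tpn; case: (eqVneq j k) => [->|jk].
  by rewrite (gtn_eqF (ltnSn k)) eqxx.
case: (eqVneq j k.+1) => [->|jk']; first by rewrite eqxx.
by rewrite (negbTE jk) (negbTE jk').
Qed.

Lemma tpn_lt k j n : (k < n)%N -> (j < n.+1)%N -> (tpn k j < n.+1)%N.
Proof. by rewrite /tpn => kn jn; case: eqP => // _; case: eqP => // _; exact: ltnW. Qed.

Definition tpo k n (h : (k < n)%N) (j : 'I_n.+1) : 'I_n.+1 := Ordinal (tpn_lt h (ltn_ord j)).

Lemma tpoK k n (h : (k < n)%N) : involutive (tpo h).
Proof. by move=> j; apply: val_inj; exact: tpnK. Qed.

Definition tp k n (h : (k < n)%N) : bij (nset n) (nset n) := @Bij (nset n) (nset n) _ (inv_bij (tpoK h)).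

Let tp01 : bij fin3 fin3 := @tp 0 2 isT.
Let tp12 : bij fin3 fin3 := @tp 1 2 isT.

Lemma circ1_swap q q' : @scomp F 1 1 lab1 q (oact swap12 q') = oact tp01 (@scomp F 1 1 lab1 q q').
Proof.
rewrite /scomp -[q in LHS](act1 hFo) -[lab1 in LHS]/(bij_id fin2 lab1) (comp_act hFo) !(actM hFo).
apply: (eq_act hFo) => z; apply: (etrans (graft_std12 _)).
apply/esym/(etrans (congr1 _ (graft_std12 _))); apply: val_inj.
by case: z => [[x xi]|y] /=; [case: (fin2P x) xi => ->|case: (fin2P y) => ->].
Qed.

Lemma circ2_swap q q' : @scomp F 1 1 lab2 q (oact swap12 q') = oact tp12 (@scomp F 1 1 lab2 q q').
Proof.
rewrite /scomp -[q in LHS](act1 hFo) -[lab2 in LHS]/(bij_id fin2 lab2) (comp_act hFo) !(actM hFo).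
apply: (eq_act hFo) => z; apply: (etrans (graft_std12 _)).
apply/esym/(etrans (congr1 _ (graft_std12 _))); apply: val_inj.
by case: z => [[x xi]|y] /=; [case: (fin2P x) xi => ->|case: (fin2P y) => ->].
Qed.

(** The relation between (1 ∧ 2) ∘_2 (1 ⊗ 2) and τ((1 ∧ 2) ∘_1 (2 ⊗ 1)), relabelled so that
    the composition at the first input carries no permutation. *)
Lemma circ1_wt : in_ideal (circ1 eta w12 t12 - circ2 eta w12 t21).
Proof.
have h3 := in_ideal_act (bij_inv tau) in_ideal_tensor_circ1_wedge.
rewrite (addmB (actD hFo _)) (actK hFo) in h3.
have h2 := in_ideal_act (bij_inv tau) in_ideal_wedge_circ2_tensor; rewrite (addmB (actD hFo _)) in h2.
have := in_ideal_act tp01 (in_idealD h2 h3); rewrite addrA subrK (addmB (actD hFo _)).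
have -> : circ1 eta w12 t21 = oact tp01 (circ1 eta w12 t12).
  by rewrite /circ1 -circ1_swap -eta_act pgen_t21.
have -> : circ2 eta w12 t21 = oact tp12 (circ2 eta w12 t12).
  by rewrite /circ2 -circ2_swap -eta_act pgen_t21.
move: (circ1 eta w12 t12) (circ2 eta w12 t12) => X Y.
rewrite !(actM hFo) => /in_idealN; rewrite opprB (act_id hFo (f := bij_cmp tp01 tp01)); last first.
  by move=> j; exact: (tpoK (isT : (0 < 2)%N) j).
suff -> : oact (bij_cmp tp01 (bij_inv tau)) Y = oact tp12 Y by [].
apply: (eq_act hFo) => j; rewrite -[in RHS](bij_invKV tau j) /=.
by case: (bij_inv tau j) => -[|[|[|n]]] h //; apply: val_inj.
Qed.

(** The relations replace each composition of two generators at the first input by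
    compositions at the second input, of a generator with a generator or with 2 ⊗ 1. *)
Lemma Sp_circ1_gen (J K : nfset) (t : F J) (s : F K) c c' :
  (forall b, Sp (comp12 (gF b) t s)) -> Sp (comp12 (eta t21) t s) ->
  Sp (comp_slots (circ1 eta (pgen c) (pgen c')) t s).
Proof.
move=> Hg H21.
have key r r' : in_ideal (r - r') -> Sp (comp_slots r' t s) -> Sp (comp_slots r t s).
  move=> h; apply: Sp_eqv; rewrite -(addmB (@comp_slotsD J K t s)).
  exact: comp_slots_in_ideal.
have c2 b b' : Sp (comp_slots (circ2 eta (pgen b) (pgen b')) t s) by exact: (@Sp_circ2 J K b _ t s (Hg b')).
have c21 b : Sp (comp_slots (circ2 eta (pgen b) t21) t s) by exact: (@Sp_circ2 J K b _ t s H21).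
case: c; case: c'.
- apply: (key _ (- circ2 eta w12 w12)).
    have := in_idealN in_ideal_wedge_circ1_wedge; rewrite opprB /circ1 w21E (addmN etaD) /circ2 opprK addrC.
    by rewrite {1}/scomp (addmN (compAl hFo _ _)) (addmN (actD hFo _)) opprK.
  by rewrite (addmN (@comp_slotsD J K t s)); apply: SpN; exact: (c2 true true).
- exact: key circ1_wt (c21 true).
- apply: (key _ (circ2 eta w12 t12)); last exact: (c2 true false).
  by have := in_idealN in_ideal_wedge_circ2_tensor; rewrite opprB.
- apply: key in_ideal_tensor_circ1_tensor _; rewrite (@comp_slotsD J K t s); apply: SpD; last exact: (c21 false).
  exact: (c2 false false).
Qed.

(** Induction on the number of generators in the two combs. The first generator of the
    left comb is moved to the root by [Sp_circ1], and the relations leave a smaller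
    left comb; the term with 2 ⊗ 1 exchanges the two combs, whence the induction on the
    sum of the sizes. *)
Lemma Sp_comp12_comb fl fl' c : Sp (comp12 (gF c) (comb fl) (comb fl')).
Proof.
have [n] := ubnP (size fl + size fl'); elim: n fl fl' c => // n IH fl fl' c ltn.
case: fl ltn => [|c' fl] ltn.
  rewrite /comp12 /= -(actK hFo (graft_unitr (lab1 : fin2)) (ocomp _ _ _)) (comp_oner hFo).
  apply: (@Sp_comp_actl _ _ _ (lab2 : fin2)).
    by apply: (bij_inj (bfunP (graft_unitr (lab1 : fin2)))); rewrite bij_invKV.
  by apply: Sp_gen; rewrite -(act1 hFo (comb fl')); exact: Sp_comb.
pose st := graft_std (size fl) (lab2 : nset 1).
have -> : comb (c' :: fl) = oact st (ocomp lab2 (gF c') (comb fl)) by [].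
have H : Sp (comp12 (gF c) (ocomp lab2 (gF c') (comb fl)) (comb fl')).
  apply: Sp_circ1; apply: Sp_circ1_gen => [b|]; first exact: IH.
  rewrite -pgen_t21 eta_act; apply: (Sp_comp12_swap (hdeg_comb _) (hdeg_comb _)).
  by apply: IH; rewrite addnC.
rewrite /comp12 -[gF c](act1 hFo) -[X in ocomp _ (ocomp X _ _) _]/(bij_id fin2 lab1) (comp_act hFo).
apply: Sp_comp_actl H.
by rewrite /=; congr inl; apply: val_inj.
Qed.

Lemma Sp_comb1 fl : Sp (comb fl).
Proof. by rewrite -(act1 hFo (comb fl)); exact: Sp_comb. Qed.

(** The input i of the comb x belongs either to the rest of the comb, which is handled
    by induction on x, or to its first generator; the two insertions at this generator
    then commute up to sign, and [Sp_comp12_comb] applies. *)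
Lemma Sp_comp (I : nfset) (i : I) (J : nfset) (x : F I) (y : F J) :
  Sp x -> Sp y -> Sp (ocomp i x y).
Proof.
move=> hx hy; elim: hx i => [fl e|{}x hx|{}x z _ IHx _ IHz|{}x _ IHx] i; last 3 first.
- by apply: Sp_ideal; exact: in_ideal_compl.
- by rewrite (compDl hFo); exact: SpD.
- by rewrite (addmN (compAl hFo i y)); exact: SpN.
apply: (Sp_comp_actl (i := bij_inv e i)); first by rewrite bij_invKV.
move: (bij_inv e i) => {i e}; elim: fl => [|c fl IH] i.
  apply: (@Sp_index _ _ (ord0 : fin1)); first by apply: val_inj; case: i => -[].
  by rewrite (comp_onel hFo); exact: Sp_act.
pose st := graft_std (size fl) (lab2 : nset 1).
have -> : comb (c :: fl) = oact st (ocomp lab2 (gF c) (comb fl)) by [].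
apply: (Sp_comp_actl (i := bij_inv st i)); first by rewrite bij_invKV.
move: (bij_inv st i) => {i st}; case=> [[u hu]|j]; last first.
  apply: (Sp_actI (f := seq_assoc J (lab2 : fin2) j)).
  by rewrite (comp_seq hFo); apply: Sp_gen.
apply: Sp_comp_combr hy => fl'; have ne21 : lab2 != lab1 by [].
have eu : u = lab1 by case: (fin2P u) hu => ->.
apply: (@Sp_index _ _ (par_left (nset (size fl)) ne21)); first by congr inl; apply: val_inj.
rewrite (comp_par hFo ne21 _ (hdeg_comb _) (hdeg_comb _)) mulz_sgnz.
apply/Sp_sg/Sp_act; apply: Sp_index (Sp_comp12_comb fl' fl c).
by congr inl; apply: val_inj.
Qed.

Lemma Sp_eta q : Sp (eta q).
Proof.
have Sg c : Sp (gF c).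
  by rewrite -(comp_oner hFo (lab2 : fin2) (gF c)); apply: Sp_act; exact: Sp_gen (Sp_comb1 [::]).
have Sz (x : F fin2) n : Sp x -> Sp (x *~ n).
  move=> hx; have Sn (k : nat) : Sp (x *+ k).
    by elim: k => [|k IH]; rewrite ?mulr0n ?mulrS; [exact: Sp0|exact: SpD].
  by case: n => n; rewrite ?NegzE ?mulrNz -pmulrn; [|apply: SpN]; exact: Sn.
have [c ->] := Pi2_span q; rewrite !etaD !(addmMz etaD).
apply: SpD; first apply: SpD; apply: Sz; [exact: (Sg false)| |exact: (Sg true)].
by rewrite -pgen_t21 eta_act; apply: Sp_act; exact: (Sg false).
Qed.

Lemma Sp_diff (I : nfset) (x : F I) : Sp x -> Sp (diff x).
Proof.
have Ad (J : nfset) : addm (@diff (F J)) := @diffA _ hFo J.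
elim=> [fl e|{}x hx|{}x y _ IHx _ IHy|{}x _ IHx].
- rewrite -(cmorph_diff (act_cmorphism hFo e)); apply: Sp_act.
  elim: fl {I x e} => [|c fl IH]; first by rewrite /= (one_diff hFo); exact: Sp0.
  rewrite /= -(cmorph_diff (act_cmorphism hFo _)); apply: Sp_act.
  rewrite (comp_diff hFo _ _ (hdeg_gF c)) mulz_sgnz; apply: SpD.
    rewrite -(cmorph_diff (s2morph_cmorphism (free_eta hF))).
    by apply: Sp_comp (Sp_eta _) (Sp_comb1 _).
  by apply: Sp_sg; exact: Sp_gen.
- by apply: Sp_ideal; exact: in_ideal_diff.
- by rewrite Ad; exact: SpD.
- by rewrite (addmN (@Ad I)); exact: SpN.
Qed.

Lemma Sp_all (I : nfset) (x : F I) : Sp x.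
Proof.
move: I x; apply: (free_generated arity2_Pi_s2complex hF).
- by move=> I; exact: Sp0.
- by move=> I x y; exact: SpD.
- by move=> I x; exact: SpN.
- by move=> I J g x; exact: Sp_act.
- exact: Sp_eta.
- exact: (Sp_comb1 [::]).
- by move=> I i J x y; exact: Sp_comp.
- by move=> I x; exact: Sp_diff.
Qed.
End Presentation.

(** * Words and sequences of flags *)

Section Flags.
Variable X : Type.
Implicit Types (s : seq (seq X)) (h : nat -> X) (fl : seq bool).

(** The k-th flag of a word tells whether its letters k and k+1 are in the same block. *)
Definition flags s : seq bool := behead (flatten [seq false :: nseq (size b).-1 true | b <- s]).

Fixpoint word_of fl h : seq (seq X) :=
  if fl is c :: fl' then wcons c (h 0) (word_of fl' (fun k => h k.+1)) else [:: [:: h 0]].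

Lemma word_of_cons fl h : exists b s, word_of fl h = (h 0 :: b) :: s.
Proof.
elim: fl h => [|c fl IH] h /=; first by exists [::], [::].
have [b [s ->]] := IH (fun k => h k.+1).
by case: c; [exists (h 1 :: b), s|exists [::], ((h 1 :: b) :: s)].
Qed.

Lemma flags_wcons c x y b s : flags (wcons c x ((y :: b) :: s)) = c :: flags ((y :: b) :: s).
Proof. by case: c. Qed.

Lemma flags_word_of fl h : flags (word_of fl h) = fl.
Proof.
elim: fl h => //= c fl IH h; have [b [s E]] := word_of_cons fl (fun k => h k.+1).
by rewrite E flags_wcons -E IH.
Qed.

Lemma flatten_word_of fl h : flatten (word_of fl h) = mkseq h (size fl).+1.
Proof.
elim: fl h => [|c fl IH] h //=; have [b [s E]] := word_of_cons fl (fun k => h k.+1).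
have -> : flatten (wcons c (h 0) (word_of fl (fun k => h k.+1))) =
    h 0 :: flatten (word_of fl (fun k => h k.+1)) by rewrite E; case: c.
rewrite IH /mkseq -[iota 0 (size fl).+2]/(0 :: iota (1 + 0) (size fl).+1) iotaDl.
by rewrite [in RHS]map_cons -map_comp.
Qed.

Lemma eq_word_of fl h h' : (forall k, (k <= size fl)%N -> h k = h' k) -> word_of fl h = word_of fl h'.
Proof.
elim: fl h h' => [|c fl IH] h h' E /=; first by rewrite E.
by rewrite E // (IH _ (fun k => h' k.+1)) // => k kf; apply: E.
Qed.

Lemma word_of_flags x0 s : all (fun b => 0 < size b)%N s -> (0 < size s)%N ->
  word_of (flags s) (nth x0 (flatten s)) = s.
Proof.
have [n] := ubnP (size (flatten s)); elim: n s => // n IH s ln.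
case: s ln => [|[|x [|y b]] s] //= ln; last first.
  move=> as_ _; rewrite -/(flags ((y :: b) :: s)).
  have := IH ((y :: b) :: s); rewrite /= => -> //.
case: s ln => [|[|y b] s] //= ln as_ _.
by have := IH ((y :: b) :: s); rewrite /= => ->.
Qed.

Lemma size_flags s : all (fun b => 0 < size b)%N s -> (0 < size s)%N ->
  size (flatten s) = (size (flags s)).+1.
Proof.
case: s => [|[|x b] s] // h _; have E := word_of_flags x h isT.
by rewrite -[in LHS]E flatten_word_of size_mkseq.
Qed.
End Flags.

Lemma wmap_word_of (X Y : choiceType) (f : X -> Y) fl h :
  wmap f (word_of fl h) = word_of fl (f \o h).
Proof.
elim: fl h => //= c fl IH h; rewrite -[in RHS](IH (fun k => h k.+1)).
by case: c => //; case: (word_of fl _).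
Qed.

Lemma swapped_flags (X : choiceType) (x0 : X) (s s' : word X) : [::] \notin s -> swapped s s' ->
  exists k, [/\ nth false (flags s) k, flags s' = flags s &
    forall j, nth x0 (flatten s') j = nth x0 (flatten s) (tpn k j)].
Proof.
move=> s0 /swappedP[p [u [a [b [v [t [Es Es']]]]]]].
exists (size (flatten p) + size u)%N; split.
- rewrite Es /flags nth_behead map_cat flatten_cat /=.
  have -> : size (flatten p) = size (flatten [seq false :: nseq (size c).-1 true | c <- p]).
    rewrite !size_flatten; congr sumn; rewrite /shape -map_comp; apply/eq_in_map => c cp /=.
    rewrite size_nseq prednK //; case: (c) cp => // cp; case/negP: s0.
    by rewrite Es mem_cat cp.
  rewrite nth_cat -addnS ltnNge leq_addr /= addKn /= nth_cat.
  have h : (size u < (size (u ++ [:: a, b & v])).-1)%N.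
    by rewrite size_cat /= addnS /= addnS ltnS leq_addr.
  by rewrite size_nseq h nth_nseq h.
- by rewrite Es Es' /flags !map_cat /= !size_cat.
move=> j; rewrite Es Es' !flatten_cat /= !catA -!(catA (flatten p ++ u)).
have -> : (size (flatten p) + size u = size (flatten p ++ u))%N by rewrite size_cat.
move: (flatten p ++ u) => w /=; rewrite /tpn !nth_cat.
case: (eqVneq j (size w)) => [->|jw].
  by rewrite ltnn subnn ltnNge leqnSn /= subSnn.
case: (eqVneq j (size w).+1) => [->|jw'].
  by rewrite ltnn subnn ltnNge leqnSn /= subSnn.
case: ltnP => // wj; have : (1 < j - size w)%N.
  by rewrite ltn_subRL addn1 ltn_neqAle eq_sym jw' ltn_neqAle eq_sym jw.
by case: (j - size w)%N => [|[|k]].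
Qed.

Lemma expr_blocks (I : finType) (s : word I) : is_expr s -> all (fun b => 0 < size b)%N s.
Proof.
case/andP => s0 _; apply/allP => b bs; rewrite lt0n size_eq0.
by apply: contraNneq s0 => <-.
Qed.

Lemma expr_nonempty (I : nfset) (s : word I) : is_expr s -> (0 < size s)%N.
Proof. by case: s => // es; have := expr_mem (nfset_default I) es. Qed.

Section WordBij.
Variable I : nfset.
Implicit Types (s : word I).

Definition letter s (k : nat) : I := nth (nfset_default I) (flatten s) k.

Lemma word_of_letter s : is_expr s -> word_of (flags s) (letter s) = s.
Proof. by move=> es; apply: word_of_flags; [exact: expr_blocks|exact: (@expr_nonempty I)]. Qed.

Lemma letter_bij s : is_expr s -> exists e : bij (nset (size (flags s))) I,
  forall k : nset (size (flags s)), e k = letter s k.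
Proof.
move=> es; have sz := size_flags (expr_blocks es) (@expr_nonempty I s es).
have inj : injective (fun k : nset (size (flags s)) => letter s k).
  move=> k l kl; apply/val_inj/eqP.
  rewrite -(nth_uniq (nfset_default I) _ _ (expr_uniq es)) ?sz;
    [exact/eqP|exact: (ltn_ord (k : 'I__))|exact: (ltn_ord (l : 'I__))].
have card : (#|I| <= #|nset (size (flags s))|)%N.
  by rewrite card_ord -sz; case/andP: es => _ /perm_size ->; rewrite -cardE.
by exists (@Bij (nset (size (flags s))) I _ (inj_card_bij inj card)).
Qed.

Lemma word_of_expr fl (e : bij (nset (size fl)) I) (h : nat -> I) :
  (forall k : nset (size fl), h k = e k) -> is_expr (word_of fl h).
Proof.
move=> he; have bl : [::] \notin word_of fl h.
  elim: fl h {e he} => //= c fl IH h; have := IH (fun k => h k.+1).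
  have [b [s ->]] := word_of_cons fl (fun k => h k.+1).
  by case: c; rewrite !inE.
apply: exprP => //; rewrite flatten_word_of.
  rewrite /mkseq map_inj_in_uniq ?iota_uniq // => k l.
  rewrite !mem_iota !add0n => kf lf; rewrite (he (Ordinal kf)) (he (Ordinal lf)).
  by move/(bij_inj (bfunP e)) => [].
move=> x; rewrite -(bij_invKV e x) -he; apply: map_f; rewrite mem_iota add0n.
exact: ltn_ord.
Qed.
End WordBij.

(** * Antisymmetry of combs *)

Section Iso.
Variables (F : operad) (eta : arity2 Pi -> F fin2).
Hypothesis hF : is_free_operad eta.
Let hFo : is_operad F := free_operad hF.
Let etaD : addm eta := cmorphD (s2morph_cmorphism (free_eta hF)).
Local Notation comb := (comb eta).
Local Notation gF := (gF eta).
Local Notation in_ideal := (@in_ideal F eta _).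
Local Notation tp01 := (@tp 0 2 isT).

(** By the relations, (1 ∧ 2) ∘_2 g is, up to sign, a generator with 1 ∧ 2 grafted on its
    first input, which the transposition of 1 and 2 multiplies by -1. *)
Lemma circ2_antisym c : in_ideal (oact tp01 (circ2 eta w12 (pgen c)) + circ2 eta w12 (pgen c)).
Proof.
have key X R : in_ideal (X - R) -> oact tp01 R = - R -> in_ideal (oact tp01 X + X).
  move=> h hR; have := in_idealD (in_ideal_act tp01 h) h; rewrite (addmB (actD hFo _)) hR.
  by rewrite opprK -addrA [R + _]addrC subrK.
case: c.
- apply: (key _ (circ1 eta w21 w12)); first by have := in_idealN (in_ideal_wedge_circ1_wedge eta); rewrite opprB.
  rewrite /circ1 -(circ1_swap hF) -(eta_act hF) (pgen_w21 : oact swap12 w12 = w21) w21E.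
  by rewrite (addmN etaD) /scomp (addmN (compAr hFo _ _)) (addmN (actD hFo _)).
apply: key (in_ideal_wedge_circ2_tensor eta) _.
rewrite /circ1 -(circ1_swap hF) -(eta_act hF) (pgen_w21 : oact swap12 w12 = w21) w21E.
by rewrite (addmN etaD) /scomp (addmN (compAr hFo _ _)) (addmN (actD hFo _)).
Qed.

(** By associativity, a comb is the rest of the comb grafted on the last input of
    g_1 ∘_2 g_2, to which the relations apply. *)
Lemma comb_cons2 c c' fl : exists e : bij (graft slot2 (nset (size fl))) (nset (size fl).+2),
  [/\ comb [:: c, c' & fl] = oact e (ocomp slot2 (circ2 eta (pgen c) (pgen c')) (comb fl)),
      forall u, val (e (inl u)) = val (val u) &
      forall y : nset (size fl), val (e (inr y)) = y.+2].
Proof.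
pose n := size fl; pose st := graft_std n.+1 (lab2 : nset 1); pose st2 := graft_std n (lab2 : nset 1).
pose st11 := graft_std 1 (lab2 : nset 1); pose sa := seq_assoc (nset n) (lab2 : fin2) (lab2 : fin2).
have e1 : slot2 = st11 (inr lab2) by rewrite [RHS]graft_std12.
have [h [hE hl hr]] := comp_actl hFo (nset n) e1.
pose gm := graft_map (bij_id fin2) st2 (lab2 : fin2).
pose s := bij_cmp st (bij_cmp gm sa).
exists (bij_cmp s (bij_inv h)); split.
- have G : oact gm (ocomp (lab2 : fin2) (gF c) (ocomp lab2 (gF c') (comb fl))) =
      ocomp lab2 (gF c) (oact st2 (ocomp lab2 (gF c') (comb fl))).
    by rewrite -(comp_act hFo) (act1 hFo).
  rewrite -(actM hFo) /circ2 /scomp hE (actK hFo) /s -!(actM hFo) (comp_seq hFo).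
  exact/esym/(congr1 _ G).
- move=> u; suff [z hz zE] : exists2 z, h z = inl u & val (s z) = val (val u).
    by rewrite -zE /= -hz bij_invK.
  case: u => -[[|[|[|k]]] hk] hu //.
  + exists (inl (exist _ (inl (exist (fun x => x != lab2) lab1 isT)) isT)).
      have [v -> vE] := hl (exist _ (inl (exist (fun x => x != lab2) lab1 isT)) isT).
      by congr inl; apply: val_inj; rewrite vE [LHS]graft_std12; apply: val_inj.
    by rewrite /= inordK.
  + exists (inl (exist _ (inr lab1) isT)).
      have [v -> vE] := hl (exist _ (inr lab1) isT).
      by congr inl; apply: val_inj; rewrite vE [LHS]graft_std12; apply: val_inj.
    by rewrite /= !inordK.
- move=> y; have hy : (y < (size fl).+1)%N := ltn_ord (y : 'I__).
  by rewrite /= -(hr y) bij_invK /= !inordK ?add1n ?ltnS.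
Qed.

(** Below the first generator, the sign comes by induction. At the first generator,
    which is 1 ∧ 2, it comes from the antisymmetry of 1 ∧ 2 if there is no other one,
    and from [circ2_antisym] otherwise. *)
Lemma comb_swap fl k (h : (k < size fl)%N) : nth false fl k -> in_ideal (oact (tp h) (comb fl) + comb fl).
Proof.
elim: fl k h => // c fl IH [|k] h /= hk; last first.
  pose st := graft_std (size fl) (lab2 : nset 1).
  have hk' : (k < size fl)%N by [].
  have E : oact (tp h) (oact st (ocomp lab2 (gF c) (comb fl))) =
      oact st (ocomp lab2 (gF c) (oact (tp hk') (comb fl))).
    rewrite -[gF c in RHS](act1 hFo) -[lab2 in RHS]/(bij_id fin2 lab2) (comp_act hFo) !(actM hFo).
    apply: (eq_act hFo) => -[[x hx]|y]; apply: val_inj => /=.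
      by case: (fin2P x) hx => -> //= _; rewrite !inordK.
    have lt_inord j : (j <= size fl)%N -> nat_of_ord (inord (1 + j) : 'I_(1 + size fl).+1) = j.+1.
      by move=> hj; rewrite inordK // add1n !ltnS.
    rewrite !lt_inord ?(leq_ord (y : 'I_(size fl).+1)) //; last exact: (tpn_lt hk' (ltn_ord y)).
    by rewrite /tpn !eqSS; case: (_ == k) => [] //; case: (_ == k.+1).
  rewrite /scomp E -(actD hFo) -(compDr hFo); apply: in_ideal_act; apply: in_ideal_compr.
  exact: IH.
case: c h hk => h hk //; clear hk; case: fl {IH} h => [|c fl] h.
  have E : comb [:: true] = gF true.
    rewrite -[RHS](comp_oner hFo (lab2 : fin2)) /= /scomp; apply: (eq_act hFo) => z.
    apply: val_inj; case: z => [[x hx]|y] /=; last by rewrite inordK ?(ord1 (y : 'I_1)).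
    by case: (fin2P x) hx => -> //= _; rewrite inordK.
  change (in_ideal (oact (tp h) (comb [:: true]) + comb [:: true])).
  rewrite E (eq_act hFo (g := swap12)); last first.
    by move=> x; apply: val_inj => /=; case: (fin2P x) => ->.
  by rewrite -(eta_act hF) pgen_w21 w21E (addmN etaD) addNr; exact: in_ideal0.
have [e [E el er]] := comb_cons2 true c fl.
have e1 : slot2 = tp01 slot2 by apply: val_inj.
have [g [gE gl gr]] := comp_actl hFo (nset (size fl)) e1.
change (in_ideal (oact (tp h) (comb [:: true, c & fl]) + comb [:: true, c & fl])).
rewrite E (actM hFo) (eq_act hFo (f := bij_cmp (tp h) e) (g := bij_cmp e g)); last first.
  move=> [u|y]; apply: val_inj.
    have [v gv vE] := gl u; apply: (etrans (congr1 (tpn 0) (el u))).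
    apply/esym/(etrans (congr1 (fun z => val (e z)) gv))/(etrans (el v)).
    by rewrite vE.
  apply: (etrans (congr1 (tpn 0) (er y))); apply/esym.
  exact: (etrans (congr1 (fun z => val (e z)) (gr y)) (er y)).
rewrite -(actM hFo) -gE -(actD hFo) -(compDl hFo); apply: in_ideal_act; apply: in_ideal_compl.
exact: circ2_antisym.
Qed.
End Iso.

(** * The isomorphism *)

Lemma count_flags (X : Type) (s : seq (seq X)) : count id (flags s) = wdim s.
Proof.
have count_blocks (t : seq (seq X)) :
    count id (flatten [seq false :: nseq (size b).-1 true | b <- t]) = wdim t.
  rewrite /wdim; elim: t => [|b t IH]; rewrite ?big_nil // big_cons /= count_cat count_nseq IH.
  by rewrite mul1n.
by rewrite -count_blocks /flags; case: s.
Qed.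

Lemma wmap_wcons (X Y : choiceType) (f : X -> Y) c x s :
  wmap f (wcons c x s) = wcons c (f x) (wmap f s).
Proof. by case: c => //; case: s. Qed.

Section Quotient.
Variables (F : operad) (eta : arity2 Pi -> F fin2).
Hypothesis hF : is_free_operad eta.
Let hFo : is_operad F := free_operad hF.
Local Notation comb := (comb eta).
Local Notation gF := (gF eta).
Local Notation in_ideal := (@in_ideal F eta _).
Local Notation ideal I := (@ideal_gen F 2 (Pi_relations eta) I : zmodClosed (F I)).
Local Notation Q := (quot_by (Pi_relations eta)).

Section WordComb.
Variable I : nfset.

Definition wcomb (s : word I) : F I :=
  if pselect (is_expr s) is left es then oact (sval (cid (letter_bij es))) (comb (flags s))
  else 0.

Lemma wcomb_default s : ~~ is_expr s -> wcomb s = 0.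
Proof. by rewrite /wcomb; case: pselect => // es /negP. Qed.

Lemma wcombE fl (e : bij (nset (size fl)) I) s : is_expr s -> flags s = fl ->
  (forall k : nset (size fl), e k = letter s k) -> wcomb s = oact e (comb fl).
Proof.
move=> es fE; case: fl / fE e => e eE; rewrite /wcomb; case: pselect => // es'.
by case: cid => e' e'E; apply: (eq_act hFo) => k; rewrite eE -e'E.
Qed.

Lemma wcomb_anti s s' : swapped s s' -> in_ideal (wcomb s + wcomb s').
Proof.
move=> sw; case: (boolP (is_expr s)) => es; last first.
  by rewrite !wcomb_default -?(expr_swapped sw) // addr0; exact: in_ideal0.
have s0 : [::] \notin s by case/andP: es.
have [k [fk fE lE]] := swapped_flags (nfset_default I) s0 sw.
have h : (k < size (flags s))%N by rewrite ltnNge; apply: contraL fk => /(nth_default false) ->.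
have [e eE] := letter_bij es.
rewrite (wcombE es erefl eE) (@wcombE _ (bij_cmp e (tp h)) s') //; last first.
- by move=> j; rewrite /letter lE; exact: eE.
- by rewrite -(expr_swapped sw).
rewrite -(actM hFo) -(actD hFo) addrC; apply: in_ideal_act; exact: comb_swap.
Qed.

Lemma hdeg_wcomb s : is_expr s -> hdeg (Posz (wdim s)) (wcomb s).
Proof.
move=> es; have [e eE] := letter_bij es; rewrite (wcombE es erefl eE) -count_flags.
exact: (cmorph_hdeg (act_cmorphism hFo e)) (hdeg_comb hF _).
Qed.

Definition qcomb (s : word I) : Q I := zproj (ideal I) (wcomb s).

Lemma qcomb_anti : anti qcomb.
Proof.
move=> s s' sw; apply: subr0_eq; rewrite opprK /qcomb -(@zprojD _ (ideal I)).
by apply/zproj_eq0; exact: wcomb_anti.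
Qed.

Definition of_Pi : Pi I -> Q I := Pi_lift qcomb.

Lemma of_PiD : addm of_Pi. Proof. exact: (Pi_liftD qcomb_anti). Qed.

Lemma hdeg_of_Pi n (x : Pi I) : hdeg n x -> hdeg n (of_Pi x).
Proof.
have D0 m : hdeg m (0 : F I) := hdeg0 (operad_complex hFo I) m.
have DB m (x' y : F I) : hdeg m x' -> hdeg m y -> hdeg m (x' - y).
  exact: (hdegB (operad_complex hFo I)).
move: x; apply: hdeg_Pi_ind.
- by exists 0; rewrite ?(addm0 of_PiD) ?(addm0 (@zprojD _ (ideal I))).
- move=> x y [x' hx xE] [y' hy yE]; exists (x' - (0 - y')).
    by apply: (DB) => //; apply: DB.
  by rewrite of_PiD xE yE sub0r opprK (@zprojD _ (ideal I)).
- move=> x [x' hx xE]; exists (0 - x'); first exact: DB.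
  by rewrite (addmN of_PiD) xE sub0r (addmN (@zprojD _ (ideal I))).
- move=> s es sn; exists (wcomb s); first by rewrite -sn; exact: hdeg_wcomb.
  by rewrite /of_Pi (Pi_lift_mono qcomb_anti).
Qed.
End WordComb.

Section Morphism.
Variable phi : forall I, F I -> Pi I.
Hypotheses (hphi : is_morphism phi) (phi_eta : forall x, phi (eta x) = x).

Let phiD I : addm (@phi I) := cmorphD (morph_cmorphism hphi I).

Lemma phi_scomp m n (i : nset m) x y :
  phi (@scomp F m n i x y) = scomp i (phi x : Pi (nset m)) (phi y : Pi (nset n)).
Proof. by rewrite /scomp (morph_act hphi) (morph_comp hphi). Qed.

(** The kernel is graded because Pi is the direct sum of its homogeneous components. *)
Lemma phi_ker_ideal : is_ideal (fun I => kerm (@phiD I) : zmodClosed (F I)).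
Proof.
have hP := Pi_is_operad.
split.
- by move=> I J f x /eqP h; apply/eqP; rewrite (morph_act hphi) h (addm0 (actD hP f)).
- move=> I x /eqP h; apply/eqP; rewrite (cmorph_diff (morph_cmorphism hphi I)) h.
  exact: (addm0 (@diffA _ hP I)).
- move=> I s f us hf /eqP; rewrite (addm_sum (@phiD I)) => h n ns; apply/eqP.
  apply: (hdeg_direct (operad_complex hP I) us _ h ns) => m.
  exact: (cmorph_hdeg (morph_cmorphism hphi I)).
- by move=> I i J x y /eqP h; apply/eqP; rewrite (morph_comp hphi) h (addm0 (compAl hP i _)).
- by move=> I i J x y /eqP h; apply/eqP; rewrite (morph_comp hphi) h (addm0 (compAr hP i _)).
Qed.

Lemma phi_circ1 x y : phi (circ1 eta x y) = @scomp Pi 1 1 lab1 x y.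
Proof. by apply: (etrans (@phi_scomp 1 1 lab1 (eta x) (eta y))); rewrite !phi_eta. Qed.

Lemma phi_circ2 x y : phi (circ2 eta x y) = @scomp Pi 1 1 lab2 x y.
Proof. by apply: (etrans (@phi_scomp 1 1 lab2 (eta x) (eta y))); rewrite !phi_eta. Qed.

Lemma phi_in_ideal I (x : F I) : in_ideal x -> phi x = 0.
Proof.
move=> /asboolP /(_ _ phi_ker_ideal) h; apply/eqP/h => r.
rewrite /Pi_relations !inE => rE; apply/eqP; case/or4P: rE => /eqP ->; rewrite (addmB (@phiD _)).
- by rewrite (@phiD fin3) phi_circ1 !phi_circ2 tensor_circ1_tensor subrr.
- by rewrite phi_circ1 phi_circ2 wedge_circ2_tensor subrr.
- by rewrite (morph_act hphi) !phi_circ1 tensor_circ1_wedge subrr.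
- by rewrite phi_circ1 phi_circ2 wedge_circ1_wedge subrr.
Qed.

Lemma phi_comb fl : phi (comb fl) = Pi_mono (word_of fl (inord : nat -> nset (size fl))).
Proof.
elim: fl => [|c fl IH].
  by rewrite /= (morph_one hphi); congr (Pi_mono [:: [:: _]]); apply: val_inj; rewrite /= inordK.
apply: (etrans (@phi_scomp 1 (size fl) lab2 (gF c) (comb fl))).
rewrite IH /gF phi_eta; apply: wemb_eq_mono.
have es : is_expr (word_of fl (inord : nat -> nset (size fl))).
  by apply: (word_of_expr (e := bij_id _)) => k; exact: inord_val.
apply: (etrans (wemb_act _ _)); rewrite (wemb_comp_gen c es) kmapE wmap_wcons !wmap_word_of.
congr (wd (wcons c _ _)).
  by rewrite ginlE //; apply: val_inj; rewrite /= !inordK.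
apply: eq_word_of => k kfl; apply: val_inj; rewrite /= !inordK ?add1n //.
Qed.

Lemma phi_act_comb I fl (e : bij (nset (size fl)) I) :
  phi (oact e (comb fl)) = Pi_mono (word_of fl (fun k => e (inord k))).
Proof.
rewrite (morph_act hphi) phi_comb Pi_act_mono ?wmap_word_of //.
by apply: (word_of_expr (e := bij_id _)) => k; exact: inord_val.
Qed.

Lemma phi_wcomb (I : nfset) (s : word I) : is_expr s -> phi (wcomb s) = Pi_mono s.
Proof.
move=> es; have [e eE] := letter_bij es; rewrite (wcombE es erefl eE) phi_act_comb.
congr (Pi_mono _); rewrite -[RHS](word_of_letter es); apply: eq_word_of => k kfl.
by rewrite eE inordK.
Qed.

Definition to_Pi I (x : Q I) : Pi I := phi (zrepr (x : zquot (ideal I))).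

Lemma to_PiE I (y : F I) : to_Pi (zproj (ideal I) y : Q I) = phi y.
Proof. by apply: zquot_lift => //; exact: phi_in_ideal. Qed.

Lemma of_PiK I : cancel (@of_Pi I) (@to_Pi I).
Proof.
move=> x; have toD : addm (@to_Pi I).
  by move=> y z; rewrite -[y]zreprK -[z]zreprK -(@zprojD _ (ideal I)) !to_PiE phiD.
move: x; apply: Pi_ext => [x y|x y|s es]; rewrite ?of_PiD ?toD //.
by rewrite /of_Pi (Pi_lift_mono (@qcomb_anti I) es) to_PiE phi_wcomb.
Qed.

(** Since the combs span, it is enough to take a relabelled comb for y; the flags and
    letters of its image in Pi are those of the comb. *)
Lemma of_Pi_phi I (y : F I) : of_Pi (phi y) = zproj (ideal I) y.
Proof.
have zD := @zprojD _ (ideal I); elim: (Sp_all hF y) => {y} [fl e|y hy|y z _ IHy _ IHz|y _ IHy].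
- have es : is_expr (word_of fl (fun k => e (inord k))).
    by apply: (word_of_expr (e := e)) => k; rewrite inord_val.
  rewrite phi_act_comb /of_Pi (Pi_lift_mono (@qcomb_anti I) es) /qcomb.
  rewrite (wcombE (e := e) es (flags_word_of _ _)) // => k.
  by rewrite /letter flatten_word_of nth_mkseq ?inord_val //; exact: ltn_ord.
- by rewrite phi_in_ideal // (addm0 (@of_PiD I)); apply/esym/zproj_eq0.
- by rewrite phiD of_PiD IHy IHz zD.
- by rewrite (addmN (@phiD I)) (addmN (@of_PiD I)) IHy (addmN zD).
Qed.

Lemma to_PiK I : cancel (@to_Pi I) (@of_Pi I).
Proof. by move=> x; rewrite /to_Pi of_Pi_phi zreprK. Qed.

Lemma to_Pi_morphism : is_morphism to_Pi.
Proof.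
split=> [I|I J f x| |I i J x y].
- split=> [x y|n x [y hy ->]|x].
  + by rewrite -[x]zreprK -[y]zreprK -(@zprojD _ (ideal I)) !to_PiE phiD.
  + by rewrite to_PiE; exact: (cmorph_hdeg (morph_cmorphism hphi I)).
  + by rewrite to_PiE (cmorph_diff (morph_cmorphism hphi I)).
- by rewrite to_PiE (morph_act hphi).
- by rewrite to_PiE (morph_one hphi).
- by rewrite to_PiE (morph_comp hphi).
Qed.

(** As the inverse of a morphism; only the degree is checked on combs. *)
Lemma of_Pi_morphism : is_morphism of_Pi.
Proof.
have h := to_Pi_morphism.
split=> [I|I J f x| |I i J x y].
- split; [exact: of_PiD|exact: hdeg_of_Pi|move=> x].
  by apply: (can_inj (@to_PiK I)); rewrite of_PiK (cmorph_diff (morph_cmorphism h I)) of_PiK.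
- by apply: (can_inj (@to_PiK J)); rewrite of_PiK (morph_act h) of_PiK.
- by apply: (can_inj (@to_PiK _)); rewrite of_PiK (morph_one h).
- by apply: (can_inj (@to_PiK _)); rewrite of_PiK (morph_comp h) !of_PiK.
Qed.
End Morphism.

Lemma Pi_presentation : operad_isomorphic Q Pi.
Proof.
have hid : is_s2morphism (P := Pi) (fun x : arity2 Pi => x) by split.
have [phi [hphi phi_eta _]] := free_univ hF Pi_is_operad hid.
exists (to_Pi phi), of_Pi; split.
- exact: to_Pi_morphism.
- exact: of_Pi_morphism phi_eta.
- exact: to_PiK.
- exact: of_PiK.
Qed.
End Quotient.

Theorem proposition3 :
  is_operad Pi /\
  Pi2_basis /\
  (exists (F : operad) (eta : arity2 Pi -> F fin2), is_free_operad eta) /\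
  (forall (F : operad) (eta : arity2 Pi -> F fin2), is_free_operad eta ->
     operad_isomorphic (quot_by (Pi_relations eta)) Pi) /\
  binary_quadratic Pi.
Proof.
have hf := free_op_free arity2_Pi_s2complex.
split; first exact: Pi_is_operad.
split; first exact: Pi2_basisP.
split; first by exists (free_op (arity2 Pi)), (@free_gen (arity2 Pi)).
split; first exact: Pi_presentation.
exists (arity2 Pi), (free_op (arity2 Pi)), (@free_gen (arity2 Pi)), (Pi_relations (@free_gen (arity2 Pi))).
by split => //; [exact: arity2_Pi_s2complex|exact: Pi_presentation].
Qed.
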